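(* Let $\mathfrak g=\mathfrak{osp}(1\vert2)$. The set $$\{L_{-3/2}(\mathfrak g),\ L^{\mathfrak g}_{-3/2}(-\omega_1)\}$$ is a complete set of irreducible $L_{-3/2}(\mathfrak g)$-modules in the category $\mathcal O$. There exists a highest weight module $\mathcal M^{\mathfrak g}_{-1}$ such that the following extension of $L_{-3/2}(\mathfrak g)$-modules is non-split: $$0\to L_{-3/2}(\mathfrak g)\to\mathcal M^{\mathfrak g}_{-1}\to L^{\mathfrak g}_{-3/2}(-\omega_1)\to0.$$
   Context: Everything is over $\mathbb C$. $\mathfrak{osp}(1\vert2)$ has even part $\mathfrak g_0=\mathrm{span}\{e,f,h\}\cong\mathfrak{sl}(2)$, odd part $\mathrm{span}\{x,y\}$, relations $[e,f]=h$, $[h,e]=2e$, $[h,f]=-2f$, $[h,x]=x$, $[e,x]=0$, $[f,x]=-y$, $[h,y]=-y$, $[e,y]=-x$, $[f,y]=0$, $\{x,x\}=2e$, $\{x,y\}=h$, $\{y,y\}=-2f$, and form $(e,f)=(f,e)=1$, $(h,h)=2$, $(x,y)=-(y,x)=2$. $\omega_1$ is the fundamental dominant weight of $\mathfrak g_0$, $\omega_1(h)=1$. $L_k(\mathfrak g)$ is the unique simple (graded) quotient of the universal affine vertex superalgebra $V^k(\mathfrak g)$; $k=-3/2$ is the critical level. $U_{\mathfrak g}(t\omega_1)$, $t\in\mathbb C$, is the irreducible highest weight $\mathfrak g$-module with highest weight $t\omega_1$ (highest weight vector killed by $e,x$), and $L^{\mathfrak g}_{-3/2}(t\omega_1)$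 is the corresponding irreducible graded $V^{-3/2}(\mathfrak g)$-module, i.e. the irreducible $\frac12\mathbb Z_{\ge0}$-graded module with top component $U_{\mathfrak g}(t\omega_1)$. Category $\mathcal O$ is the usual category $\mathcal O$ of graded $\widehat{\mathfrak g}$-modules of level $-3/2$ (semisimple $h(0)$-action, finite-dimensional weight spaces in each graded component, weights bounded above), and modules are considered up to isomorphism and parity reversal. *)

(* Defs.v *)
From mathcomp Require Import all_boot all_order all_algebra.
From mathcomp Require Import complex.
From mathcomp Require Import reals.

Set Implicit Arguments.
Unset Strict Implicit.
Unset Printing Implicit Defensive.

Import Order.TTheory GRing.Theory Num.Theory.
Local Open Scope ring_scope.

(* A superspace is a vector space with a linear involution [sv_par], acting by
   1 on the even part and by -1 on the odd part. *)
Record superVec (K : numFieldType) := SuperVec {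
  sv_space :> lmodType K;
  sv_par : {linear sv_space -> sv_space};
  sv_parK : involutive sv_par
}.

Section LinearAlgebra.
Variable K : numFieldType.

Definition homog (M : superVec K) (p : bool) (v : M) : Prop :=
  sv_par M v = (-1) ^+ p *: v.

Definition semisimple_on (M : lmodType K) (T : M -> M) (P : K -> Prop) : Prop :=
  forall v : M, exists s : seq M,
    v = \sum_(u <- s) u /\
    forall u, u \in s -> exists c : K, P c /\ T u = c *: u.

Definition half_nat (c : K) : Prop := exists j : nat, c = j%:R / 2.

Definition fin_dim (M : lmodType K) (P : M -> Prop) : Prop :=
  exists (n : nat) (b : 'I_n -> M),
    forall v, P v -> exists c : 'I_n -> K, v = \sum_(i < n) c i *: b i.

(* binomial coefficient "m choose j" for an arbitrary integer m *)
Definition zbinom (m : int) (j : nat) : K :=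
  (\prod_(i < j) (m%:~R - (i : nat)%:R)) / (j`!)%:R.

End LinearAlgebra.

(* Vertex superalgebras and their modules, presented by n-th products:
   Y(a, z) = \sum_n a_(n) z^(-n-1), and [act n a m] is a_(n) m. *)
Section VertexAxioms.
Variable K : numFieldType.

(* The three sums of the Borcherds identity have finitely many nonzero terms,
   by truncation; they are therefore written as partial sums over all
   sufficiently long initial ranges. *)
Definition borcherds (V M : superVec K)
    (prod : int -> V -> V -> V) (act : int -> V -> M -> M) : Prop :=
  forall (p q : bool) (a b : V), homog p a -> homog q b ->
  forall (c : M) (l m n : int),
  exists N0 : nat, forall N : nat, (N0 <= N)%N ->
    \sum_(j < N) zbinom K m j *: act (m + n - j%:Z) (prod (l + j%:Z) a b) c
  = \sum_(j < N) ((-1) ^+ j * zbinom K l j) *: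
      (act (m + l - j%:Z) a (act (n + j%:Z) b c)
       - ((-1) ^ l * (-1) ^+ (p && q)) *:
           act (n + l - j%:Z) b (act (m + j%:Z) a c)).

Record is_vertex_action (V M : superVec K) (vac : V)
    (prod : int -> V -> V -> V) (act : int -> V -> M -> M) : Prop := {
  va_linear_l : forall n (m : M), linear (fun a : V => act n a m);
  va_linear_r : forall n (a : V), linear (act n a);
  va_parity : forall n (a : V) (m : M),
    sv_par M (act n a m) = act n (sv_par V a) (sv_par M m);
  va_truncation : forall (a : V) (m : M),
    exists N : nat, forall n : int, N%:Z <= n -> act n a m = 0;
  va_vacuum : forall n (m : M), act n vac m = if n == -1 then m else 0;
  va_borcherds : borcherds prod act
}.

(* [D] is the degree operator of a (1/2)Z_{>=0}-grading: the component of
   degree j/2 is its (j/2)-eigenspace, and a_(n) has degree deg a - n - 1. *)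
Record is_half_grading (V M : superVec K) (DV : V -> V)
    (act : int -> V -> M -> M) (D : M -> M) : Prop := {
  hg_semisimple : semisimple_on D (@half_nat K);
  hg_parity : forall m, D (sv_par M m) = sv_par M (D m);
  hg_action : forall n (a : V) (m : M),
    D (act n a m) = act n (DV a) m + act n a (D m) - (n + 1)%:~R *: act n a m
}.

End VertexAxioms.

(* (1/2)Z_{>=0}-graded vertex superalgebras *)
Record vsa (K : numFieldType) := Vsa {
  vsa_space :> superVec K;
  vac : vsa_space;
  vprod : int -> vsa_space -> vsa_space -> vsa_space;
  vdeg : {linear vsa_space -> vsa_space};
  vsa_action : is_vertex_action vac vprod vprod;
  vac_even : homog false vac;
  vac_creation : forall v, vprod (-1) v vac = v;
  vac_regular : forall (n : nat) v, vprod n%:Z v vac = 0;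
  vsa_grading : is_half_grading vdeg vprod vdeg
}.

(* graded modules over a graded vertex superalgebra *)
Record vmodule (K : numFieldType) (V : vsa K) := Vmodule {
  vm_space :> superVec K;
  vact : int -> V -> vm_space -> vm_space;
  mdeg : {linear vm_space -> vm_space};
  vm_action : is_vertex_action (vac V) (@vprod K V) vact;
  vm_grading : is_half_grading (vdeg V) vact mdeg
}.

Arguments vac {K} _.
Arguments vprod {K _}.
Arguments vdeg {K _}.
Arguments vact {K V _}.
Arguments mdeg {K V _}.

Section Modules.
Variable K : numFieldType.

Definition adjoint_module (V : vsa K) : vmodule V :=
  Vmodule (vsa_action V) (vsa_grading V).

(* A graded submodule is a subspace stable under the action, the parity and
   the degree operator; stability under the (semisimple) degree operator
   expresses that the subspace is the sum of its graded pieces. *)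
Record is_submodule (V : vsa K) (M : vmodule V) (S : {pred M}) : Prop := {
  sub_linear : submod_closed S;
  sub_action : forall n (a : V) m, m \in S -> vact n a m \in S;
  sub_parity : forall m, m \in S -> sv_par M m \in S;
  sub_degree : forall m, m \in S -> mdeg m \in S
}.

Definition irreducible (V : vsa K) (M : vmodule V) : Prop :=
  (exists m : M, m != 0) /\
  forall S : {pred M}, is_submodule S ->
    (exists m : M, m \in S /\ m != 0) -> forall m : M, m \in S.

Record is_graded_ideal (V : vsa K) (I : {pred V}) : Prop := {
  ideal_linear : submod_closed I;
  ideal_l : forall n (a v : V), v \in I -> vprod n a v \in I;
  ideal_r : forall n (a v : V), v \in I -> vprod n v a \in I;
  ideal_parity : forall v, v \in I -> sv_par V v \in I;
  ideal_degree : forall v, v \in I -> vdeg v \in I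
}.

Definition graded_simple (V : vsa K) : Prop :=
  (exists v : V, v != 0) /\
  forall I : {pred V}, is_graded_ideal I ->
    (exists v : V, v \in I /\ v != 0) -> forall v : V, v \in I.

Record is_vsa_hom (V W : vsa K) (pi : {linear V -> W}) : Prop := {
  vh_vac : pi (vac V) = vac W;
  vh_prod : forall n (a b : V), pi (vprod n a b) = vprod n (pi a) (pi b);
  vh_parity : forall v, pi (sv_par V v) = sv_par W (pi v);
  vh_degree : forall v, pi (vdeg v) = vdeg (pi v)
}.

(* Module morphisms are allowed to preserve or to reverse parity, since modules
   are considered up to parity reversal; they need not preserve the degree,
   since the gradings of isomorphic modules may differ by a shift. *)
Definition is_vmod_hom (V : vsa K) (M N : vmodule V) (phi : {linear M -> N})
    : Prop :=
  (forall n (a : V) m, phi (vact n a m) = vact n a (phi m)) /\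
  exists p : bool, forall m, phi (sv_par M m) = (-1) ^+ p *: sv_par N (phi m).

Definition vmod_iso (V : vsa K) (M N : vmodule V) : Prop :=
  exists phi : {linear M -> N}, is_vmod_hom phi /\ bijective phi.

Definition nonsplit_extension (V : vsa K) (A M B : vmodule V) : Prop :=
  exists (i : {linear A -> M}) (p : {linear M -> B}),
    [/\ is_vmod_hom i /\ is_vmod_hom p,
        injective i,
        (forall b, exists m, p m = b),
        (forall m, p m = 0 <-> exists a, i a = m)
      & ~ exists s : {linear B -> M}, is_vmod_hom s /\ cancel s p].

Section Pullback.
Variables (V W : vsa K) (pi : {linear V -> W}) (hpi : is_vsa_hom pi).
Variable M : vmodule W.

Let act (n : int) (a : V) (m : M) : M := vact n (pi a) m.

Lemma pullback_action : is_vertex_action (vac V) (@vprod K V) act.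
Proof.
have [ll lr par tr va bo] := vm_action M.
split; rewrite /act.
- by move=> n m c a b; rewrite linearP ll.
- by move=> n a; apply: lr.
- by move=> n a m; rewrite par (vh_parity hpi).
- by move=> a m; apply: tr.
- by move=> n m; rewrite (vh_vac hpi) va.
- move=> p q a b ha hb c l m n.
  have h r (x : V) : homog r x -> homog r (pi x).
    by rewrite /homog -(vh_parity hpi) => ->; rewrite linearZ.
  have [N0 H] := bo p q _ _ (h _ _ ha) (h _ _ hb) c l m n.
  exists N0 => N /H <-; apply: eq_bigr => j _.
  by rewrite (vh_prod hpi).
Qed.

Lemma pullback_grading : is_half_grading (@vdeg K V) act (@mdeg K W M).
Proof.
have [ss par ac] := vm_grading M.
split=> // n a m; by rewrite /act ac (vh_degree hpi).
Qed.

(* [M] viewed as a [V]-module through [pi] *)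
Definition pullback : vmodule V := Vmodule pullback_action pullback_grading.

End Pullback.
End Modules.

(* The Lie superalgebra osp(1|2), given by structure constants in the basis
   e, f, h, x, y. Each superbracket of basis elements is an integer multiple
   of a basis element: [osp_bracket a b = (c, d)] means [a, b] = c d. *)
Inductive osp : Set := e_ | f_ | h_ | x_ | y_.

Definition osp_odd (a : osp) : bool :=
  match a with x_ | y_ => true | _ => false end.

Definition osp_bracket (a b : osp) : int * osp :=
  match a, b with
  | e_, f_ => (1, h_)  | f_, e_ => (-1, h_)
  | h_, e_ => (2, e_)  | e_, h_ => (-2, e_)
  | h_, f_ => (-2, f_) | f_, h_ => (2, f_)
  | h_, x_ => (1, x_)  | x_, h_ => (-1, x_)
  | f_, x_ => (-1, y_) | x_, f_ => (1, y_)
  | h_, y_ => (-1, y_) | y_, h_ => (1, y_)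
  | e_, y_ => (-1, x_) | y_, e_ => (1, x_)
  | x_, x_ => (2, e_)
  | x_, y_ => (1, h_)  | y_, x_ => (1, h_)
  | y_, y_ => (-2, f_)
  | _, _ => (0, e_)
  end.

Definition osp_form (a b : osp) : int :=
  match a, b with
  | e_, f_ => 1 | f_, e_ => 1
  | h_, h_ => 2
  | x_, y_ => 2 | y_, x_ => -2
  | _, _ => 0
  end.

Section Affine.
Variable K : numFieldType.

(* [op a n] is the action of a (x) t^n on a module of level k over the
   affinization of osp(1|2). *)
Record is_affine_rep (k : K) (W : superVec K) (op : osp -> int -> {linear W -> W})
    : Prop := {
  ar_parity : forall a n w,
    sv_par W (op a n w) = (-1) ^+ osp_odd a *: op a n (sv_par W w);
  ar_bracket : forall a b m n w,
    op a m (op b n w) - (-1) ^+ (osp_odd a && osp_odd b) *: op b n (op a m w)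
    = (osp_bracket a b).1%:~R *: op (osp_bracket a b).2 (m + n) w
      + (if m + n == 0 then m%:~R * (osp_form a b)%:~R * k else 0) *: w
}.

(* [V] is the universal affine vertex superalgebra of level k, with
   [J a] = a(-1)1. The last clause is the universal property of the induced
   module U(g^) (x)_{U(g[t] + C K)} C 1. *)
Record is_universal_affine (k : K) (V : vsa K) (J : osp -> V) : Prop := {
  ua_parity : forall a, homog (osp_odd a) (J a);
  ua_degree : forall a, vdeg (J a) = J a;
  ua_bracket : forall a b,
    vprod 0 (J a) (J b) = (osp_bracket a b).1%:~R *: J (osp_bracket a b).2;
  ua_level : forall a b,
    vprod 1 (J a) (J b) = ((osp_form a b)%:~R * k) *: vac V;
  ua_regular : forall a b (n : nat), vprod n.+2%:Z (J a) (J b) = 0;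
  ua_induced : forall (W : superVec K) (op : osp -> int -> {linear W -> W}),
    is_affine_rep k op ->
    forall w : W, homog false w -> (forall a (n : nat), op a n%:Z w = 0) ->
    let is_extension (phi : {linear V -> W}) :=
      [/\ phi (vac V) = w,
          forall v, phi (sv_par V v) = sv_par W (phi v)
        & forall a n v, phi (vprod n (J a) v) = op a n (phi v)] in
    exists phi : {linear V -> W}, is_extension phi /\
      forall psi : {linear V -> W}, is_extension psi -> psi =1 phi
}.

Definition is_simple_graded_quotient (V L : vsa K) (pi : {linear V -> L})
    : Prop :=
  (forall l : L, exists v : V, pi v = l) /\ graded_simple L.

Variables (V : vsa K) (J : osp -> V).

Definition current (M : vmodule V) (a : osp) (n : int) (m : M) : M :=
  vact n (J a) m.

(* The subspace [U], stable under osp(1|2) acting by zero modes, is the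
   irreducible highest weight module U_g(t omega_1). *)
Definition is_irr_hw_osp (M : vmodule V) (t : K) (U : M -> Prop) : Prop :=
  (exists v : M, [/\ U v, v != 0, current e_ 0 v = 0, current x_ 0 v = 0
                   & current h_ 0 v = t *: v]) /\
  forall S : {pred M},
    submod_closed S -> (forall m, m \in S -> U m) ->
    (forall m, m \in S -> sv_par M m \in S) ->
    (forall a m, m \in S -> current a 0 m \in S) ->
    (exists m : M, m \in S /\ m != 0) ->
    forall m, U m -> m \in S.

(* [M] is L^g(t omega_1) *)
Definition is_irr_with_top (M : vmodule V) (t : K) : Prop :=
  irreducible M /\ is_irr_hw_osp t (fun m : M => mdeg m = 0).

Definition weight_vector (M : vmodule V) (mu : K) (j : nat) (m : M) : Prop :=
  current h_ 0 m = mu *: m /\ mdeg m = (j%:R / 2) *: m.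

(* The weights lie in finitely many cones Lambda - n1 alpha_1 - n0 alpha_0, with
   alpha_1 the odd simple root (h-weight 1, degree 0) and
   alpha_0 = delta - 2 alpha_1; subtracting alpha_0 raises the h-weight by 2
   and the degree by 1. *)
Definition in_category_O (M : vmodule V) : Prop :=
  [/\ semisimple_on (@current M h_ 0) (fun _ => True),
      (forall mu j, fin_dim (@weight_vector M mu j))
    & exists s : seq (K * nat),
        forall mu j (m : M), weight_vector mu j m -> m != 0 ->
        exists (lam : K * nat) (n1 n0 : nat),
          [/\ lam \in s, mu = lam.1 - n1%:R + 2 * n0%:R
            & j = (lam.2 + 2 * n0)%N]].

Definition is_highest_weight_module (M : vmodule V) : Prop :=
  exists (v : M) (mu : K) (j : nat) (p : bool),
    [/\ v != 0 /\ homog p v, weight_vector mu j v,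
        current e_ 0 v = 0 /\ current x_ 0 v = 0,
        (forall a (n : nat), current a n.+1%:Z v = 0)
      & forall S : {pred M}, is_submodule S -> v \in S -> forall m, m \in S].

End Affine.

(* Main.v *)
(* Write L for the simple quotient, k = -3/2. At this level the Sugawara vector is
   vacuum-like, so it vanishes in L; applied to a singular vector of weight t it
   acts by a nonzero multiple of t (t + 1), whence t = 0 or t = -1. An irreducible
   highest weight module is determined by t: in the product of two of them, the
   pair of highest weight vectors generates the graph of an isomorphism.

   The weight -1 modules come from Mathieu's twisted localization. The mode e(-1)
   is injective on L, and twisting the localization of L at e(-1) by e(-1)^(-1/2)
   turns the vacuum into a singular vector n0 of weight -1, which generates an
   irreducible module N0. In the localization of N0 at f(0), the vector
   p = y(0) f(0)^-1 n0 is singular of weight 0; a second twist by e(-1)^(-1/2)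
   makes it a singular vector m of weight -1 for which
   u = -(e(-1) y(0) m + x(-1) m / 2) is nonzero and vacuum-like. Thus m generates
   an extension M of the irreducible N = M / <u> by <u> = L. A splitting of M, or
   an isomorphism of L and N, would give a singular vector of weight -1 in L; then
   f(0) would be injective on L, although it kills the vacuum. *)

Require Import Defs.
From HB Require Import structures.
From mathcomp Require Import all_boot all_order all_algebra.
From mathcomp Require Import complex.
From mathcomp Require Import reals.
From mathcomp Require Import boolp functions.
From mathcomp Require Import ring zify.

Set Implicit Arguments.
Unset Strict Implicit.
Unset Printing Implicit Defensive.

Import Order.TTheory GRing.Theory Num.Theory.
Local Open Scope ring_scope.

(** * Deciding identities in modules *)

(** The exponent is forced: on a singular vector [w] of weight [t], [f(1) e(-1)^mu w] is
    [mu (k - t - mu + 1) e(-1)^(mu - 1) w], so for [t = 0] the nonzero exponent preserving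
    singularity is [mu = k + 1 = -1/2]. Since [k] is half-integral and the weights met are integral,
    the sl2 of [e(-1)] and [f(1)] never resonates; this lets submodules be carried between a module
    and its localization. The operator defining [u] is [e(-1) y(0)] conjugated by the twist: as
    [[y(0), e(-1)^m] = m e(-1)^(m-1) x(-1)], applying [e(-1) y(0) + x(-1) / 2] to the image of [w]
    gives the image of [e(-1) y(0) w]. Hence it kills [n0], because [y(0)] kills the vacuum, and it
    yields [u] because [y(0) p = - n0]. Powers [e(-1)^mu] are reached by interpolation: [ad e(-1)]
    is locally nilpotent, so [e(-1)^-m a e(-1)^m] is polynomial in [m] and may be evaluated at [mu].
    The level being critical, no Sugawara conformal vector makes translation a mode. A submodule of
    [L] is therefore not visibly an ideal, and simplicity of [L] has to be turned into
    irreducibility by a degree argument. *)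

Section ModuleNormalization.
Variables (K : pzRingType) (V : lmodType K).

Inductive lexp :=
  LVar of nat | LZero | LAdd of lexp & lexp | LOpp of lexp | LScale of K & lexp.

Fixpoint leval (env : seq V) (e : lexp) : V :=
  match e with
  | LVar i => env`_i
  | LZero => 0
  | LAdd e1 e2 => leval env e1 + leval env e2
  | LOpp e1 => - leval env e1
  | LScale c e1 => c *: leval env e1
  end.

(** Atoms are compared with [Nat.eqb], which [cbn] evaluates on numerals, so that only ring
    expressions remain. *)
Fixpoint lcoef (e : lexp) (i : nat) : K :=
  match e with
  | LVar j => if Nat.eqb i j then 1 else 0
  | LZero => 0
  | LAdd e1 e2 => lcoef e1 i + lcoef e2 i
  | LOpp e1 => - lcoef e1 i
  | LScale c e1 => c * lcoef e1 i
  end.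

Fixpoint lcoef_eq (e1 e2 : lexp) (n : nat) : Prop :=
  if n is n'.+1 then lcoef e1 n' = lcoef e2 n' /\ lcoef_eq e1 e2 n' else True.

Lemma leval_coef env e : leval env e = \sum_(i < size env) lcoef e i *: env`_i.
Proof.
elim: e => [j||e1 h1 e2 h2|e h|c e h] /=.
- case: (ltnP j (size env)) => [lt|ge].
    rewrite (bigD1 (Ordinal lt)) //= PeanoNat.Nat.eqb_refl scale1r big1 ?addr0 //.
    move=> i ne; case: PeanoNat.Nat.eqb_spec => [e|]; last by rewrite scale0r.
    by case/eqP: ne; apply: val_inj.
  rewrite nth_default // big1 // => i _.
  case: PeanoNat.Nat.eqb_spec => [e|]; last by rewrite scale0r.
  by have := ltn_ord i; rewrite e ltnNge ge.
- by rewrite big1 // => i _; rewrite scale0r.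
- by rewrite h1 h2 -big_split; apply: eq_bigr => i _; rewrite scalerDl.
- by rewrite h -sumrN; apply: eq_bigr => i _; rewrite scaleNr.
- by rewrite h scaler_sumr; apply: eq_bigr => i _; rewrite scalerA.
Qed.

Lemma leval_eq env e1 e2 : lcoef_eq e1 e2 (size env) -> leval env e1 = leval env e2.
Proof.
move=> h; rewrite !leval_coef; apply: eq_bigr => i _; congr (_ *: _).
elim: (size env) h i => [_ []//|n IH /= [h1 h2] i].
have := ltn_ord i; rewrite ltnS leq_eqVlt => /orP[/eqP -> //|lt].
exact: IH h2 (Ordinal lt).
Qed.

End ModuleNormalization.

Ltac lm_find x env :=
  lazymatch env with
  | x :: _ => constr:(0%N)
  | _ :: ?env' => let i := lm_find x env' in constr:(S i)
  end.
Ltac lm_mem x env :=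
  lazymatch env with
  | nil => constr:(false)
  | x :: _ => constr:(true)
  | _ :: ?env' => lm_mem x env'
  end.
Ltac lm_atoms t env :=
  lazymatch t with
  | (?a + ?b)%R => let env1 := lm_atoms a env in lm_atoms b env1
  | (- ?a)%R => lm_atoms a env
  | (?c *: ?a)%R => lm_atoms a env
  | 0%R => env
  | _ => let m := lm_mem t env in
         lazymatch m with true => env | false => constr:(t :: env) end
  end.
Ltac lm_reify K t env :=
  lazymatch t with
  | (?a + ?b)%R => let ea := lm_reify K a env in let eb := lm_reify K b env in
                   constr:(@LAdd K ea eb)
  | (- ?a)%R => let ea := lm_reify K a env in constr:(@LOpp K ea)
  | (?c *: ?a)%R => let ea := lm_reify K a env in constr:(@LScale K c ea)
  | 0%R => constr:(@LZero K)
  | _ => let i := lm_find t env in constr:(@LVar K i)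
  end.
(* reduces an identity in a [K]-module to the identities of the coefficients of
   its atoms *)
Ltac lmod_coef K V :=
  lazymatch goal with
  | |- ?a = ?b =>
    let env0 := lm_atoms a (@nil V) in
    let env := lm_atoms b env0 in
    let ea := lm_reify K a env in
    let eb := lm_reify K b env in
    refine (@leval_eq K V env ea eb _); cbn [size lcoef_eq lcoef Nat.eqb];
    repeat (split || exact I)
  end.
Ltac lmod_ring K V := lmod_coef K V; ring.

(** Deduces an identity from a given one in a form that [lmod_ring] can finish: in the remaining
    goal the atoms are independent. *)
Lemma eq_of_sub1 (V : zmodType) (x y a b : V) : a = b -> x - y = a - b -> x = y.
Proof. by move=> -> /eqP; rewrite subrr subr_eq0 => /eqP. Qed.
Lemma eq_of_sub2 (V : zmodType) (x y a b c d : V) :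
  a = b -> c = d -> x - y = (a - b) - (c - d) -> x = y.
Proof. by move=> -> ->; rewrite !subrr => /eqP; rewrite subr_eq0 => /eqP. Qed.

(** * Subspaces and subquotients *)

Section Subspaces.
Variable K : numFieldType.

Definition subspace (U : lmodType K) (S : U -> Prop) : Prop :=
  S 0 /\ forall c u v, S u -> S v -> S (c *: u + v).

Section Closure.
Variables (U : lmodType K) (S : U -> Prop) (hS : subspace S).

Lemma sub0 : S 0. Proof. by case: hS. Qed.
Lemma subZ c u : S u -> S (c *: u).
Proof. by move=> Su; rewrite -[_ *: _]addr0; apply: hS.2 => //; apply: sub0. Qed.
Lemma subD u v : S u -> S v -> S (u + v).
Proof. by move=> Su Sv; rewrite -[u]scale1r; apply: hS.2. Qed.
Lemma subN u : S u -> S (- u).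
Proof. by rewrite -scaleN1r; apply: subZ. Qed.
Lemma subB u v : S u -> S v -> S (u - v).
Proof. by move=> Su Sv; apply: subD => //; apply: subN. Qed.
Lemma subZI c u : c != 0 -> S (c *: u) -> S u.
Proof. by move=> c0 /(subZ c^-1); rewrite scalerA mulVf // scale1r. Qed.
Lemma subDr u v : S u -> S (u + v) -> S v.
Proof. by move=> Su Suv; rewrite -[v](addKr u); apply: subD => //; apply: subN. Qed.
Lemma sub_sum I (r : seq I) (P : pred I) (F : I -> U) :
  (forall i, P i -> S (F i)) -> S (\sum_(i <- r | P i) F i).
Proof. by move=> h; elim/big_ind: _ => //; [exact: sub0|exact: subD]. Qed.
Lemma sub_sum_seq (I : eqType) (r : seq I) (P : pred I) (F : I -> U) :
  (forall i, i \in r -> P i -> S (F i)) -> S (\sum_(i <- r | P i) F i).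
Proof.
move=> h; rewrite big_seq_cond; apply: sub_sum => i /andP[ir Pi]; exact: h.
Qed.

Lemma subspace_submod_closed : submod_closed (fun u : U => `[< S u >]).
Proof.
split=> [|c u v]; rewrite ?unfold_in /=; first exact/asboolP/sub0.
by move=> /asboolP Su /asboolP Sv; apply/asboolP/hS.2.
Qed.

End Closure.

Lemma submod_closed_subspace (U : lmodType K) (S : {pred U}) :
  submod_closed S -> subspace (fun u => u \in S).
Proof. by move=> [S0 Sl]; split=> // c u v Su Sv; apply: Sl. Qed.

Lemma subspace_zero (U : lmodType K) : subspace (fun u : U => u = 0).
Proof. by split=> // c u v -> ->; rewrite scaler0 addr0. Qed.

Lemma subspace_ker (U V : lmodType K) (T : {linear U -> V}) (S : V -> Prop) :
  subspace S -> subspace (fun u => S (T u)).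
Proof.
move=> hS; split; first by rewrite linear0; exact: sub0.
by move=> c u v Su Sv; rewrite linearP; apply: hS.2.
Qed.

(* Lagrange interpolation: applying [T - d] removes the eigenvalue [d]. *)
Lemma eigen_component (U : lmodType K) (T : {linear U -> U}) (S : U -> Prop)
    (hS : subspace S) (hT : forall u, S u -> S (T u))
    (I : eqType) (s : seq I) (u : I -> U) (c : I -> K) (c0 : K) :
  {in s, forall i, T (u i) = c i *: u i} -> S (\sum_(i <- s) u i) ->
  S (\sum_(i <- s | c i == c0) u i).
Proof.
pose ds := [seq d <- map c s | d != c0].
have : {in s, forall i, (c i == c0) || (c i \in ds) || (u i == 0)}.
  move=> i si; rewrite mem_filter; case: eqP => //= _.
  by rewrite map_f.
have : c0 \notin ds by rewrite mem_filter eqxx.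
elim: ds u => [|d ds IH] u hd hc hu hs.
  rewrite big_mkcond (eq_big_seq u) //= => i /hc.
  by rewrite in_nil orbF; case: eqP => //= _ /eqP.
move: hd; rewrite inE negb_or => /andP[ne hd].
have nz : c0 - d != 0 by rewrite subr_eq0.
pose u' i := (c0 - d)^-1 *: ((c i - d) *: u i).
have <- : \sum_(i <- s | c i == c0) u' i = \sum_(i <- s | c i == c0) u i.
  by apply: eq_bigr => i /eqP ci; rewrite /u' ci scalerA mulVf // scale1r.
apply: IH => //.
- move=> i si; case/orP: (hc i si) => [/orP[->//|]|/eqP u0].
    rewrite inE /u' => /orP[/eqP->|->]; rewrite ?orbT //.
    by rewrite subrr scale0r scaler0 eqxx orbT.
  by rewrite /u' u0 !scaler0 eqxx orbT.
- move=> i si; rewrite /u' !linearZ /= hu // !scalerA.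
- rewrite -scaler_sumr; apply: subZ => //.
  have -> : \sum_(i <- s) (c i - d) *: u i
      = T (\sum_(i <- s) u i) - d *: \sum_(i <- s) u i.
    rewrite linear_sum scaler_sumr -sumrB; apply: eq_big_seq => i si.
    by rewrite hu // scalerBl.
  by apply: subB => //; [apply: hT | apply: subZ].
Qed.

(** The eigenvector [w] is moved to the other side as one more summand [- w], indexed by [None]; a
    vanishing sum of eigenvectors has vanishing [c0]-component. *)
Lemma eigen_decomposition (U : lmodType K) (T : {linear U -> U})
    (I : eqType) (s : seq I) (u : I -> U) (c : I -> K) (c0 : K) (w : U) :
  {in s, forall i, T (u i) = c i *: u i} -> T w = c0 *: w ->
  w = \sum_(i <- s) u i -> w = \sum_(i <- s | c i == c0) u i.
Proof.
move=> hu hw ws.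
pose c' (o : option I) := oapp c c0 o; pose u' (o : option I) := oapp u (- w) o.
have H := @eigen_component U T (fun u => u = 0) (subspace_zero U) _ _
  (None :: map Some s) u' c' c0.
rewrite !big_cons !big_map /= eqxx in H.
apply/esym/eqP; rewrite -subr_eq0 addrC; apply/eqP/H.
- by move=> ? ->; rewrite linear0.
- move=> [i|]; rewrite inE //=; last by rewrite linearN hw scalerN.
  by rewrite mem_map => [si|? ? []//]; apply: hu.
- by rewrite -ws addNr.
Qed.
End Subspaces.

(** * Subquotients of a vector space, as types of canonical representatives *)

Section Subquotient.
Variables (K : numFieldType) (U : lmodType K) (A B : U -> Prop).
Hypotheses (hA : subspace A) (hB : subspace B).

(** The class is taken modulo the intersection of [A] and [B], which keeps the representative of a
    vector of [A] inside [A]. *)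
Definition sq_rep (u : U) : U := choose (fun w => `[< A (w - u) /\ B (w - u) >]) u.

Let AB_refl u : `[< A (u - u) /\ B (u - u) >].
Proof. by apply/asboolP; rewrite subrr; split; apply: sub0. Qed.

Lemma sq_repP u : A (sq_rep u - u) /\ B (sq_rep u - u).
Proof.
exact/asboolP/(@chooseP _ (fun w => `[< A (w - u) /\ B (w - u) >]) u (AB_refl u)).
Qed.

Lemma sq_rep_eq u v : A (u - v) -> B (u - v) -> sq_rep u = sq_rep v.
Proof.
move=> Auv Buv; rewrite /sq_rep.
have e : (fun w => `[< A (w - u) /\ B (w - u) >])
      =1 (fun w => `[< A (w - v) /\ B (w - v) >]).
  move=> w; apply: asbool_equiv_eq.
  have -> : w - v = (w - u) + (u - v) by rewrite addrA subrK.
  split=> [[a b]|[a b]]; first by split; apply: subD.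
  by split; [apply: subDr hA _ _ Auv _ | apply: subDr hB _ _ Buv _];
    rewrite addrC.
rewrite (eq_choose e); apply: choose_id => //.
by rewrite -e.
Qed.

Lemma sq_rep_idem u : sq_rep (sq_rep u) = sq_rep u.
Proof. by have [a b] := sq_repP u; apply: sq_rep_eq. Qed.

Lemma sq_rep_in u : A u -> A (sq_rep u).
Proof.
by move=> Au; have [a _] := sq_repP u; rewrite -[sq_rep u](subrK u); apply: subD.
Qed.

Definition sq_type (_ : subspace A) (_ : subspace B) :=
  {u : U | `[< A u >] && (sq_rep u == u)}.
End Subquotient.

Section SubquotientModule.
Variables (K : numFieldType) (U : lmodType K) (A B : U -> Prop).
Variables (hA : subspace A) (hB : subspace B).
Local Notation Q := (sq_type hA hB).

HB.instance Definition _ := Choice.on Q.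

Definition sq_val (q : Q) : U := sval q.

Lemma sq_valP q : A (sq_val q).
Proof. by case: q => u /= /andP[/asboolP]. Qed.

Lemma sq_val_rep q : sq_rep A B (sq_val q) = sq_val q.
Proof. by case: q => u /= /andP[_ /eqP]. Qed.

Lemma sq_cl_subproof (u : U) :
  let v := sq_rep A B (if `[< A u >] then u else 0) in
  `[< A v >] && (sq_rep A B v == v).
Proof.
rewrite /= (sq_rep_idem hA hB) eqxx andbT; apply/asboolP/(sq_rep_in hA hB).
by case: (asboolP (A u)) => //= _; exact: sub0 hA.
Qed.

(* junk value: [sq_cl u] is the class of [0] when [u] is not in [A] *)
Definition sq_cl (u : U) : Q :=
  exist (fun v => `[< A v >] && (sq_rep A B v == v)) _ (sq_cl_subproof u).

Lemma sq_cl_eq u v : A u -> A v -> (sq_cl u = sq_cl v) <-> B (u - v).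
Proof.
move=> Au Av; split=> [/(congr1 sq_val)|Buv]; last first.
  apply: val_inj => /=; rewrite !asboolT //.
  by apply: sq_rep_eq => //; apply: subB.
rewrite /sq_val /= !asboolT // => e.
have [_ b1] := sq_repP hA hB u; have [_ b2] := sq_repP hA hB v.
have -> : u - v = (sq_rep A B v - v) - (sq_rep A B u - u).
  by rewrite e opprB [RHS]addrC addrA subrK.
exact: subB.
Qed.

Lemma sq_valK q : sq_cl (sq_val q) = q.
Proof.
by apply: val_inj; rewrite /= asboolT ?sq_val_rep //; apply: sq_valP.
Qed.

Lemma sq_clK u : A u -> B (sq_val (sq_cl u) - u).
Proof. by move=> Au; rewrite /= asboolT //; case: (sq_repP hA hB u). Qed.

Lemma sq_ind (P : Q -> Prop) : (forall u, A u -> P (sq_cl u)) -> forall q, P q.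
Proof. by move=> h q; rewrite -[q]sq_valK; apply/h/sq_valP. Qed.

Definition sq_add (p q : Q) := sq_cl (sq_val p + sq_val q).
Definition sq_opp (p : Q) := sq_cl (- sq_val p).
Definition sq_scale c (p : Q) := sq_cl (c *: sq_val p).

Lemma sq_addE u v : A u -> A v -> sq_add (sq_cl u) (sq_cl v) = sq_cl (u + v).
Proof.
move=> Au Av; apply/sq_cl_eq; [|exact: subD|].
  by apply: subD => //; apply: sq_valP.
by rewrite opprD addrACA; apply: subD => //; apply: sq_clK.
Qed.

Lemma sq_oppE u : A u -> sq_opp (sq_cl u) = sq_cl (- u).
Proof.
move=> Au; apply/sq_cl_eq; [|exact: subN|].
  by apply: subN => //; apply: sq_valP.
by rewrite -opprD; apply: subN => //; apply: sq_clK.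
Qed.

Lemma sq_scaleE c u : A u -> sq_scale c (sq_cl u) = sq_cl (c *: u).
Proof.
move=> Au; apply/sq_cl_eq; [|exact: subZ|].
  by apply: subZ => //; apply: sq_valP.
by rewrite -scalerBr; apply: subZ => //; apply: sq_clK.
Qed.

Let ok u v : A u -> A v -> A (u + v). Proof. exact: subD. Qed.
Let okN u : A u -> A (- u). Proof. exact: subN. Qed.
Let okZ c u : A u -> A (c *: u). Proof. exact: subZ. Qed.

Fact sq_addA : associative sq_add.
Proof.
elim/sq_ind => u Au; elim/sq_ind => v Av; elim/sq_ind => w Aw.
by rewrite !sq_addE ?addrA //; apply: ok.
Qed.
Fact sq_addC : commutative sq_add.
Proof.
by elim/sq_ind => u Au; elim/sq_ind => v Av; rewrite !sq_addE // addrC.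
Qed.
Fact sq_add0 : left_id (sq_cl 0) sq_add.
Proof. by elim/sq_ind => u Au; rewrite sq_addE ?add0r //; apply: sub0. Qed.
Fact sq_addN : left_inverse (sq_cl 0) sq_opp sq_add.
Proof.
by elim/sq_ind => u Au; rewrite sq_oppE ?sq_addE ?addNr //; apply: okN.
Qed.
HB.instance Definition _ :=
  GRing.isZmodule.Build Q sq_addA sq_addC sq_add0 sq_addN.

Let sq_plusE u v : A u -> A v -> sq_cl u + sq_cl v = sq_cl (u + v).
Proof. exact: sq_addE. Qed.

Fact sq_scaleA c d q : sq_scale c (sq_scale d q) = sq_scale (c * d) q.
Proof.
by elim/sq_ind: q => u Au; rewrite !sq_scaleE ?scalerA //; apply: okZ.
Qed.
Fact sq_scale1 : left_id 1 sq_scale.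
Proof. by elim/sq_ind => u Au; rewrite sq_scaleE // scale1r. Qed.
Fact sq_scaleDr : right_distributive sq_scale +%R.
Proof.
move=> c; elim/sq_ind => u Au; elim/sq_ind => v Av.
by rewrite sq_plusE // !sq_scaleE ?sq_plusE ?scalerDr //; auto.
Qed.
Fact sq_scaleDl q : {morph sq_scale^~ q : c d / c + d}.
Proof.
elim/sq_ind: q => u Au c d /=; rewrite !sq_scaleE //.
by rewrite sq_plusE ?scalerDl; auto.
Qed.
HB.instance Definition _ := GRing.Zmodule_isLmodule.Build K Q
  sq_scaleA sq_scale1 sq_scaleDr sq_scaleDl.

Lemma sq_clP c u v : A u -> A v -> sq_cl (c *: u + v) = c *: sq_cl u + sq_cl v.
Proof.
move=> Au Av; have -> : c *: sq_cl u = sq_cl (c *: u) by apply: sq_scaleE.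
by rewrite sq_plusE //; apply: okZ.
Qed.
Lemma sq_cl0 : sq_cl 0 = 0. Proof. by []. Qed.
Lemma sq_cl_eq0 u : A u -> (sq_cl u = 0) <-> B u.
Proof. by move=> Au; rewrite -sq_cl0 sq_cl_eq ?subr0 //; apply: sub0. Qed.
Lemma sq_clD u v : A u -> A v -> sq_cl (u + v) = sq_cl u + sq_cl v.
Proof. by move=> Au Av; rewrite -[u]scale1r sq_clP // !scale1r. Qed.
Lemma sq_clZ c u : A u -> sq_cl (c *: u) = c *: sq_cl u.
Proof. by move=> Au; rewrite -[_ *: u]addr0 sq_clP ?addr0 //; apply: sub0. Qed.
Lemma sq_clB u v : A u -> A v -> sq_cl (u - v) = sq_cl u - sq_cl v.
Proof.
move=> Au Av; rewrite sq_clD //; last exact: okN.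
by rewrite -scaleN1r sq_clZ // scaleN1r.
Qed.
Lemma sq_cl_sum I (r : seq I) (P : pred I) (F : I -> U) :
  (forall i, A (F i)) ->
  sq_cl (\sum_(i <- r | P i) F i) = \sum_(i <- r | P i) sq_cl (F i).
Proof.
move=> h; elim: r => [|i r IH]; rewrite ?big_nil ?big_cons //.
by case: ifP => // Pi; rewrite sq_clD ?IH //; apply: sub_sum.
Qed.

Section Induced.
Variables (f : U -> U) (fA : forall u, A u -> A (f u)).
Variables (flin : forall c u v, f (c *: u + v) = c *: f u + f v).
Variables (fB : forall u, A u -> B u -> B (f u)).

Definition sq_map of (forall u, A u -> A (f u)) &
    (forall c u v, f (c *: u + v) = c *: f u + f v) &
    (forall u, A u -> B u -> B (f u)) :=
  fun q : Q => sq_cl (f (sq_val q)).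

Lemma sq_mapE u : A u -> sq_map fA flin fB (sq_cl u) = sq_cl (f u).
Proof.
move=> Au; apply/sq_cl_eq; [exact/fA/sq_valP|exact: fA|].
have -> : f (sq_val (sq_cl u)) - f u = f (sq_val (sq_cl u) - u).
  by rewrite [in RHS]addrC -[- u]scaleN1r flin scaleN1r addrC.
by apply: fB; [apply: subB => //; apply: sq_valP | apply: sq_clK].
Qed.

Fact sq_map_linear : linear (sq_map fA flin fB).
Proof.
move=> c; elim/sq_ind => u Au; elim/sq_ind => v Av.
rewrite -sq_clP // !sq_mapE ?flin ?sq_clP //; try exact: fA.
by apply: hA.2.
Qed.
HB.instance Definition _ :=
  GRing.isLinear.Build K Q Q *:%R (sq_map fA flin fB) sq_map_linear.
End Induced.
End SubquotientModule.

(** * Modules and their modes *)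

Section Preliminaries.
Variable K : numFieldType.

Lemma zbinom0r m : zbinom K m 0 = 1.
Proof. by rewrite /zbinom big_ord0 fact0 divr1. Qed.

Lemma zbinom1r m : zbinom K m 1 = m%:~R.
Proof. by rewrite /zbinom big_ord1 subr0 factS fact0 divr1. Qed.

Lemma zbinom0l j : zbinom K 0 j.+1 = 0.
Proof. by rewrite /zbinom big_ord_recl subrr mul0r mul0r. Qed.

Lemma sum_truncate (V : zmodType) (F : nat -> V) (N N' : nat) :
  (N <= N')%N -> (forall j, (N <= j)%N -> F j = 0) ->
  \sum_(j < N') F j = \sum_(j < N) F j.
Proof.
move=> le F0; rewrite -!(big_mkord xpredT) (big_cat_nat (n := N)) //=.
by rewrite [X in _ + X]big_nat [X in _ + X]big1 ?addr0 // => j /andP[/F0].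
Qed.

Lemma half_sum (V : lmodType K) (v : V) : v = 2^-1 *: (v + v).
Proof. by rewrite -mulr2n -scaler_nat scalerA mulVf ?scale1r // pnatr_eq0. Qed.

Definition par_part (M : superVec K) (p : bool) (v : M) : M :=
  2^-1 *: (v + (-1) ^+ p *: sv_par M v).

Lemma par_part_homog (M : superVec K) p (v : M) : homog p (par_part p v).
Proof.
rewrite /homog /par_part linearZ linearD linearZ /= sv_parK.
rewrite !scalerA [_ * 2^-1]mulrC -scalerA; congr (_ *: _).
by rewrite scalerDr scalerA -signr_addb addbb scale1r addrC.
Qed.

Lemma par_part_sum (M : superVec K) (v : M) : v = par_part false v + par_part true v.
Proof.
rewrite /par_part -scalerDr scale1r scaleN1r addrACA subrr addr0.
exact: half_sum.
Qed.

Lemma par_part_sub (M : superVec K) (S : M -> Prop) p v : subspace S ->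
  S v -> S (sv_par M v) -> S (par_part p v).
Proof. by move=> hS Sv Spv; apply: subZ => //; apply: subD => //; apply: subZ. Qed.

End Preliminaries.

(* [vmodule] without the grading by [half_nat]: localization makes degrees
   unbounded below and not semisimple. *)
Record wmod (K : numFieldType) (L : vsa K) := Wmod {
  wsp :> superVec K;
  wact : int -> L -> wsp -> wsp;
  wdeg : {linear wsp -> wsp};
  w_action : is_vertex_action (vac L) (@vprod K L) wact;
  w_deg_par : forall m, wdeg (sv_par wsp m) = sv_par wsp (wdeg m);
  w_deg_act : forall n (a : L) (m : wsp),
    wdeg (wact n a m) = wact n (vdeg a) m + wact n a (wdeg m)
                        - (n + 1)%:~R *: wact n a m
}.

Definition wmod_of (K : numFieldType) (L : vsa K) (M : vmodule L) : wmod L :=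
  Wmod (vm_action M) (hg_parity (vm_grading M)) (hg_action (vm_grading M)).

Section Modes.
Variables (K : numFieldType) (L : vsa K).
Implicit Types (W : wmod L) (a b : L) (m n l : int).

Definition md W n a (w : W) : W := wact n a w.
Arguments md : simpl never.

Fact md_linear W n a : linear (@md W n a).
Proof. exact: (va_linear_r (w_action W)). Qed.
HB.instance Definition _ W n a :=
  GRing.isLinear.Build K W W *:%R (@md W n a) (md_linear n a).

Section Basic.
Variable W : wmod L.
Implicit Types (w : W).

Lemma mdPl n c a b w : md n (c *: a + b) w = c *: md n a w + md n b w.
Proof. exact: (va_linear_l (w_action W)). Qed.
Lemma mdDl n a b w : md n (a + b) w = md n a w + md n b w.
Proof. by rewrite -[a]scale1r mdPl !scale1r. Qed.
Lemma md0l n w : md n 0 w = 0.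
Proof. by have := mdPl n (-1) 0 0 w; rewrite scaler0 addr0 scaleN1r addNr. Qed.
Lemma mdZl n c a w : md n (c *: a) w = c *: md n a w.
Proof. by rewrite -[c *: a]addr0 mdPl md0l addr0. Qed.
Lemma md_suml n I (r : seq I) (P : pred I) (F : I -> L) w :
  md n (\sum_(i <- r | P i) F i) w = \sum_(i <- r | P i) md n (F i) w.
Proof.
by elim/big_rec2: _ => [|i x y _ <-]; rewrite ?md0l // mdDl.
Qed.
Lemma mdNl n a w : md n (- a) w = - md n a w.
Proof. by rewrite -scaleN1r mdZl scaleN1r. Qed.
Lemma mdBl n a b w : md n (a - b) w = md n a w - md n b w.
Proof. by rewrite mdDl mdNl. Qed.

Lemma mdDr n a u w : md n a (u + w) = md n a u + md n a w. Proof. exact: linearD. Qed.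
Lemma mdBr n a u w : md n a (u - w) = md n a u - md n a w. Proof. exact: linearB. Qed.
Lemma mdNr n a w : md n a (- w) = - md n a w. Proof. exact: linearN. Qed.
Lemma mdZr n a c w : md n a (c *: w) = c *: md n a w. Proof. exact: linearZ. Qed.
Lemma md0r n a : md n a 0 = 0 :> W. Proof. exact: linear0. Qed.

Lemma md_par n a w : sv_par W (md n a w) = md n (sv_par L a) (sv_par W w).
Proof. exact: (va_parity (w_action W)). Qed.

Lemma md_vac n w : md n (vac L) w = if n == -1 then w else 0.
Proof. exact: (va_vacuum (w_action W)). Qed.

Lemma md_deg n a w :
  wdeg W (md n a w) = md n (vdeg a) w + md n a (wdeg W w) - (n + 1)%:~R *: md n a w.
Proof. exact: w_deg_act. Qed.

Lemma md_trunc a w : exists N : nat, forall n, N%:Z <= n -> md n a w = 0.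
Proof. exact: (va_truncation (w_action W)). Qed.

Lemma subspace_mode (S : W -> Prop) n w :
  subspace S -> subspace (fun a : L => S (md n a w)).
Proof.
move=> hS; split; first by rewrite md0l; exact: sub0.
by move=> c a b Sa Sb; rewrite mdPl; apply: hS.2.
Qed.

Lemma md_eigen n d d' a w : vdeg a = d *: a -> wdeg W w = d' *: w ->
  wdeg W (md n a w) = (d + d' - (n + 1)%:~R) *: md n a w.
Proof.
by move=> ha hw; rewrite md_deg ha hw mdZl linearZ /= scalerBl scalerDl.
Qed.

End Basic.

Lemma prod_trunc a b : exists N : nat, forall j : nat, (N <= j)%N -> vprod j%:Z a b = 0.
Proof.
have [N h] := va_truncation (vsa_action L) a b.
by exists N => j le; apply: h; rewrite lez_nat.
Qed.

Definition adjoint_w : wmod L := wmod_of (adjoint_module L).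

Section Borcherds.
Variable W : wmod L.
Implicit Types (w : W).

(** Borcherds' identity at [l = 0], where the coefficients [zbinom K 0 j] kill all but the first
    term on the right. *)
Lemma md_comm p q a b (N : nat) : homog p a -> homog q b ->
  (forall j : nat, (N <= j)%N -> vprod j%:Z a b = 0) -> forall m n w,
  md m a (md n b w) - (-1) ^+ (p && q) *: md n b (md m a w)
  = \sum_(j < N) zbinom K m j *: md (m + n - j%:Z) (vprod j%:Z a b) w.
Proof.
move=> ha hb hN m n w.
have [N0 H] := va_borcherds (w_action W) ha hb w 0 m n.
have := H (maxn N0 N).+1 (leqW (leq_maxl _ _)).
pose F (j : nat) := zbinom K m j *: md (m + n - j%:Z) (vprod j%:Z a b) w.
rewrite (eq_bigr (fun j : 'I_(maxn N0 N).+1 => F j)) => [|j _]; last by rewrite add0r.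
rewrite (@sum_truncate _ F N) => [|| j /hN h]; first last.
- by rewrite /F h md0l scaler0.
- exact: leqW (leq_maxr _ _).
rewrite [X in _ = X]big_ord_recl [X in _ = _ + X]big1 => [|j _]; last first.
  by rewrite zbinom0l mulr0 scale0r.
by rewrite ?addr0 zbinom0r expr0 mulr1 scale1r ?subr0 ?addr0 expr0z mul1r => ->.
Qed.

Lemma md_assoc p q a b (N : nat) l n w : homog p a -> homog q b ->
  (forall j : nat, (N <= j)%N -> md (n + j%:Z) b w = 0) ->
  (forall j : nat, (N <= j)%N -> md j%:Z a w = 0) ->
  md n (vprod l a b) w = \sum_(j < N) ((-1) ^+ j * zbinom K l j) *:
    (md (l - j%:Z) a (md (n + j%:Z) b w)
     - ((-1) ^ l * (-1) ^+ (p && q)) *: md (n + l - j%:Z) b (md j%:Z a w)).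
Proof.
move=> ha hb hN1 hN2.
have [N0 H] := va_borcherds (w_action W) ha hb w l 0 n.
have := H (maxn N0 N).+1 (leqW (leq_maxl _ _)).
rewrite big_ord_recl [X in _ + X = _]big1 => [|j _]; last first.
  by rewrite zbinom0l scale0r.
rewrite zbinom0r scale1r ?addr0 ?subr0 add0r => e; rewrite [LHS]e {e}.
pose F (j : nat) := ((-1) ^+ j * zbinom K l j) *:
    (md (l - j%:Z) a (md (n + j%:Z) b w)
     - ((-1) ^ l * (-1) ^+ (p && q)) *: md (n + l - j%:Z) b (md j%:Z a w)).
rewrite -(@sum_truncate _ F N (maxn N0 N).+1) => [|| j hj]; first last.
- by rewrite /F hN1 // hN2 // [md _ a 0]linear0 [md _ b 0]linear0 scaler0 subr0 scaler0.
- exact: leqW (leq_maxr _ _).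
by apply: eq_bigr => j _; rewrite /F !add0r.
Qed.

Lemma md_trunc2 a b n w : exists N : nat,
  (forall j : nat, (N <= j)%N -> md (n + j%:Z) b w = 0) /\
  (forall j : nat, (N <= j)%N -> md j%:Z a w = 0).
Proof.
have [N1 h1] := md_trunc a w; have [N2 h2] := md_trunc b w.
exists (maxn N1 (N2 + `|n|)) => //; split => j; rewrite geq_max => /andP[l1 l2].
  by apply: h2; lia.
by apply: h1; rewrite lez_nat.
Qed.

(* an even element commutes without sign, so no homogeneity of [a] is needed *)
Lemma md_comm_even b a (N : nat) : homog false b ->
  (forall j : nat, (N <= j)%N -> vprod j%:Z b a = 0) -> forall m n w,
  md m b (md n a w) - md n a (md m b w)
  = \sum_(j < N) zbinom K m j *: md (m + n - j%:Z) (vprod j%:Z b a) w.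
Proof.
move=> hb hN m n w.
have hpar q (j : nat) : vprod j%:Z b (par_part q a) = par_part q (vprod j%:Z b a).
  rewrite /par_part -[vprod _ b _]/(@md adjoint_w _ _ _) linearZ linearD linearZ /=.
  by have := md_par (W := adjoint_w) j%:Z b a; rewrite /= hb expr0 scale1r => ->.
have hN' q (j : nat) : (N <= j)%N -> vprod j%:Z b (par_part q a) = 0.
  by move=> /hN h; rewrite hpar /par_part h linear0 scaler0 addr0 scaler0.
have H q := md_comm hb (par_part_homog q a) (hN' q) m n w.
have := congr2 +%R (H false) (H true); rewrite /= !expr0 !scale1r.
rewrite addrACA -opprD -!linearD -!mdDl -par_part_sum => ->.
rewrite -big_split; apply: eq_bigr => j _ /=.
by rewrite -scalerDr -mdDl !hpar -par_part_sum.
Qed.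

End Borcherds.

Section Submodules.
Variable W : wmod L.
Implicit Types (S : W -> Prop).

Record wsub S : Prop := {
  ws_lin : subspace S;
  ws_act : forall n a w, S w -> S (md n a w);
  ws_par : forall w, S w -> S (sv_par W w);
  ws_deg : forall w, S w -> S (wdeg W w)
}.

Definition wirr : Prop :=
  (exists w : W, w != 0) /\
  forall S, wsub S -> (exists w, S w /\ w != 0) -> forall w, S w.

Definition gen (X : W -> Prop) (w : W) : Prop :=
  forall S, wsub S -> (forall x, X x -> S x) -> S w.

Lemma gen_sub X : wsub (gen X).
Proof.
split=> [|n a w Sw S hS h|w Sw S hS h|w Sw S hS h].
- split=> [S hS _|c u v Su Sv S hS h]; first exact: sub0 (ws_lin hS).
  exact: (ws_lin hS).2 (Su S hS h) (Sv S hS h).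
- exact: ws_act (Sw S hS h).
- exact: ws_par (Sw S hS h).
- exact: ws_deg (Sw S hS h).
Qed.
Lemma gen_in (X : W -> Prop) x : X x -> gen X x.
Proof. by move=> Xx S _; apply. Qed.
Lemma wsub_zero : wsub (fun w => w = 0).
Proof. by split=> [|n a w ->|w ->|w ->]; rewrite ?linear0 //; apply: subspace_zero. Qed.

Lemma mode_assoc_sub S p q a b : subspace S -> homog p a -> homog q b ->
  (forall n w, S w -> S (md n a w)) -> (forall n w, S w -> S (md n b w)) ->
  forall l n w, S w -> S (md n (vprod l a b) w).
Proof.
move=> hS ha hb Sa Sb l n w Sw; have [N [h1 h2]] := md_trunc2 a b n w.
rewrite (md_assoc _ ha hb h1 h2); apply: sub_sum => // j _.
by apply: subZ => //; apply: subB => //; [|apply: subZ => //];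
  [apply/Sa/Sb | apply/Sb/Sa].
Qed.

(* [p] behaves like the vacuum modulo the submodule [S] *)
Definition vacuum_like S (p : W) := forall b (n : nat), S (md n%:Z b p).

(** In the associativity formula, every term other than [a_(n) b_(-1) x] applies a nonnegative mode
    to [x] and so lies in [S]. Modulo [S], the map [b |-> b_(-1) x] thus commutes with modes. *)
Lemma vacuum_like_assoc S p x : subspace S -> (forall n a w, S w -> S (md n a w)) ->
  vacuum_like S x -> forall a b n, homog p a ->
  S (md (-1) (vprod n a b) x - md n a (md (-1) b x)).
Proof.
move=> hS Sact vx a b n ha.

have key q' b' : homog q' b' ->
    S (md (-1) (vprod n a b') x - md n a (md (-1) b' x)).
  move=> hb; have [N [h1 h2]] := md_trunc2 a b' (-1) x.
  have h1' j : (N.+1 <= j)%N -> md (-1 + j%:Z) b' x = 0 by move/ltnW/h1.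
  have h2' j : (N.+1 <= j)%N -> md j%:Z a x = 0 by move/ltnW/h2.
  rewrite (md_assoc _ ha hb h1' h2') big_ord_recl /=.
  rewrite expr0 zbinom0r mulr1 scale1r ?addr0 ?subr0.
  rewrite addrAC; apply: subD => //.
    by rewrite addrAC subrr add0r; apply/(subN hS)/(subZ hS)/Sact; apply: vx.
  apply: sub_sum => // j _; apply: subZ => //.
  apply: subB => //; first apply: Sact.
    have -> : -1 + (bump 0 j)%:Z = j%:Z by rewrite /bump add1n -addn1 PoszD addrCA addNr addr0.
    exact: vx.
  by apply: subZ => //; apply/Sact/vx.
rewrite (par_part_sum b) -[vprod n a _]/(@md adjoint_w n a _) linearD /=.
rewrite mdDl mdDl linearD /= opprD addrACA; apply: subD => //.
  exact: key (par_part_homog _ _).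
exact: key (par_part_homog _ _).
Qed.

End Submodules.
End Modes.

(** The given summands of [v] need not lie in [S], but the sum of those with a common eigenvalue
    does, by [eigen_component]; hence they are regrouped by eigenvalue. *)
Lemma semisimple_sub (K : numFieldType) (U : lmodType K) (T : {linear U -> U})
    (P : K -> Prop) (S : U -> Prop) (v : U) :
  subspace S -> (forall u, S u -> S (T u)) -> semisimple_on T P -> S v ->
  exists r : seq (K * U),
    (forall x, x \in r -> [/\ P x.1, S x.2 & T x.2 = x.1 *: x.2]) /\
    v = \sum_(x <- r) x.2.
Proof.
move=> hS hT ss Sv; have [s [vs hs]] := ss v.
have : forall u, exists c, u \in s -> P c /\ T u = c *: u.
  move=> u; have [us|nus] := boolP (u \in s); last by exists 0.
  by have [c hc] := hs u us; exists c.
move=> /choice[c hc].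
pose g c0 := \sum_(u <- s | c u == c0) u.
exists [seq (c0, g c0) | c0 <- undup (map c s)]; split=> [x|].
  case/mapP => c0; rewrite mem_undup => /mapP[u us ->] -> /=; split.
  - by have [] := hc u us.
  - apply: (eigen_component hS hT (u := id)); first by move=> w /hc[].
    by rewrite -vs.
  - rewrite linear_sum /g scaler_sumr; rewrite big_seq_cond [RHS]big_seq_cond.
    apply: eq_bigr => w /andP[ws /eqP <-]; by have [] := hc w ws.
rewrite big_map /= /g vs (exchange_big_dep xpredT) //=.
apply: eq_big_seq => u us.
rewrite (eq_bigl (pred1 (c u))) => [|d]; last by rewrite /= eq_sym.
rewrite -big_filter filter_pred1_uniq ?undup_uniq ?mem_undup ?map_f //.
by rewrite big_seq1.
Qed.

Section VacuumDegree.
Variables (K : numFieldType) (L : vsa K).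

Lemma vac_creation' (a : L) : md (W := adjoint_w L) (-1) a (vac L) = a.
Proof. exact: vac_creation. Qed.

Lemma vdeg_vac : vdeg (vac L) = 0.
Proof.
have := md_deg (W := adjoint_w L) (-1) (vac L) (vac L).
rewrite !vac_creation' addNr scale0r subr0 md_vac eqxx /=.
by move=> /esym/eqP; rewrite -subr_eq0 addrK => /eqP.
Qed.

Lemma sv_par_vac : sv_par L (vac L) = vac L.
Proof. by have := vac_even L; rewrite /homog expr0 scale1r. Qed.
End VacuumDegree.

(** * From submodules of the adjoint module to ideals *)

Section Ideal.
Variables (K : numFieldType) (L : vsa K) (S : L -> Prop).
Hypothesis hS : wsub (W := adjoint_w L) S.
Local Notation A := (adjoint_w L).
Local Notation md := (md (W := adjoint_w L)).

(** Since [s_(-1-j) 1] is the [j]-th divided power of translation applied to [s], this is the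
    closure of [S] under translation, under which an ideal must be stable. *)
Definition right_closure (v : L) : Prop :=
  forall T : L -> Prop, subspace T -> (forall s n, S s -> T (md n s (vac L))) -> T v.

Let I := right_closure.

Lemma right_closure_subspace : subspace I.
Proof.
split=> [T hT _|c u v Iu Iv T hT h]; first exact: sub0 hT.
exact: hT.2 (Iu T hT h) (Iv T hT h).
Qed.

Lemma right_closure_gen s n : S s -> I (md n s (vac L)).
Proof. by move=> Ss T _; apply. Qed.

(* skew symmetry: Borcherds' identity at [m = -1, n = 0] on the vacuum *)
Lemma right_closure_skew s l a : S s -> I (md l s a).
Proof.
have hI := right_closure_subspace.
have key p q t b : homog p t -> homog q b -> S t -> I (md l t b).
  move=> ht hb St.
  have [N0 H] := va_borcherds (vsa_action L) hb ht (vac L) l (-1) 0.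
  have := H N0.+1 (leqnSn _); rewrite [X in _ = X -> _]big_ord_recl.
  have z (x : L) (j : nat) : vprod j%:Z x (vac L) = 0 by exact: vac_regular.
  rewrite [X in _ = _ + X -> _]big1 => [|j _]; last first.
    rewrite add0r z.
    have -> : -1 + (lift ord0 j : nat)%:Z = j%:Z.
      by rewrite /= /bump; lia.
    rewrite z [vprod _ _ 0](linear0 (md _ _)) [vprod _ _ 0](linear0 (md _ _)).
    by rewrite scaler0 subr0 scaler0.
  rewrite expr0 zbinom0r mulr1 scale1r ?addr0 ?add0r z.
  rewrite [vprod _ b 0](linear0 (md _ _)) sub0r.
  rewrite [vprod (-1) b _]vac_creation' => e.
  have nz : (-1) ^ l * (-1) ^+ (q && p) != 0 :> K.
    by rewrite mulf_neq0 ?signr_eq0 // expfz_neq0 // oppr_eq0 oner_eq0.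
  apply: (subZI hI nz); rewrite -[_ *: _]opprK; apply: (subN hI).
  rewrite -[- _]e; apply: (sub_sum hI) => j _; apply: (subZ hI).
  exact: (right_closure_gen (-1 - j%:Z) (ws_act hS (l + j%:Z) b St)).
move=> Ss; rewrite (par_part_sum s) (par_part_sum a) mdDl !linearD /=.
have hs p : S (par_part (M := L) p s).
  exact: (par_part_sub p (ws_lin hS) Ss (ws_par hS Ss)).
by apply: (subD hI); apply: (subD hI);
  exact: key (par_part_homog _ _) (par_part_homog _ _) (hs _).
Qed.

Lemma right_closure_ideal : is_graded_ideal (fun v => `[< I v >]).
Proof.
have hI := right_closure_subspace.
have hs p s : S s -> S (par_part (M := L) p s).
  by move=> Ss; exact: (par_part_sub p (ws_lin hS) Ss (ws_par hS Ss)).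
split=> [|n a v /asboolP Iv|n a v /asboolP Iv|v /asboolP Iv|v /asboolP Iv].
  exact: subspace_submod_closed hI.
all: apply/asboolP.
- apply: (Iv (fun v => I (md n a v))) => {v Iv}[|s m Ss].
    exact: subspace_ker (md n a) _ hI.
  have key p q t b : homog p b -> homog q t -> S t -> I (md n b (md m t (vac L))).
    move=> hb ht St; have [N hN] := prod_trunc b t.
    have := md_comm (W := A) hb ht hN n m (vac L).
    move/eqP; rewrite subr_eq => /eqP ->; apply: (subD hI).
      apply: (sub_sum hI) => j _; apply: (subZ hI).
      exact: (right_closure_gen _ (ws_act hS j%:Z b St)).
    exact: (subZ hI _ (right_closure_skew _ _ St)).
  rewrite (par_part_sum s) (par_part_sum a) !(mdDl, linearD) /=.
  by apply: (subD hI); apply: (subD hI);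
    exact: key (par_part_homog _ _) (par_part_homog _ _) (hs _ _ Ss).
- apply: (Iv (fun v => I (md n v a))) => {v Iv}[|s m Ss].
    exact: (subspace_mode (W := A) n a hI).
  have key p t : homog p t -> S t -> I (md n (md m t (vac L)) a).
    move=> ht St.
    have [N [h1 h2]] := md_trunc2 (W := A) t (vac L) n a.
    rewrite (md_assoc m ht (vac_even L) h1 h2); apply: (sub_sum hI) => j _.
    apply: (subZ hI); apply: (subB hI); first exact: right_closure_skew.
    apply: (subZ hI); rewrite md_vac; case: ifP => _; last exact: sub0 hI.
    exact: right_closure_skew.
  rewrite (par_part_sum s) !(mdDl, linearD) /=.
  by apply: (subD hI); exact: key (par_part_homog _ _) (hs _ _ Ss).
- apply: (Iv (fun v => I (sv_par L v))) => {v Iv}[|s m Ss].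
    exact: subspace_ker hI.
  rewrite [sv_par L _](md_par (W := A)) /= sv_par_vac.
  exact: (right_closure_gen _ (ws_par hS Ss)).
- apply: (Iv (fun v => I (vdeg v))) => {v Iv}[|s m Ss].
    exact: subspace_ker hI.
  have -> := md_deg (W := A) m s (vac L).
  rewrite [wdeg A (vac L)]vdeg_vac linear0 addr0.
  apply: (subB hI); first exact: (right_closure_gen _ (ws_deg hS Ss)).
  exact: (subZ hI _ (right_closure_gen _ Ss)).
Qed.

Lemma half_nat_ge0 (c : K) : half_nat c -> 0 <= c.
Proof. by move=> [j ->]; rewrite divr_ge0. Qed.

(** Translation raises the degree and all degrees are nonnegative, so in degree 0 the closure adds
    nothing to [S]. The predicate [T] records a decomposition into degree eigenvectors whose terms
    of degree 0 lie in [S]. *)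
Lemma right_closure_vac : I (vac L) -> S (vac L).
Proof.
pose T (v : L) := exists r : seq (K * L), v = \sum_(x <- r) x.2 /\
  forall x, x \in r -> vdeg x.2 = x.1 *: x.2 /\ (x.1 = 0 -> S x.2).
have Slin := ws_lin hS.
move=> /(_ T) [||r [e hr]].
- split=> [|c u v [r [-> hr]] [r' [-> hr']]]; first by exists [::]; rewrite big_nil.
  exists ([seq (x.1, c *: x.2) | x <- r] ++ r'); rewrite big_cat big_map /= scaler_sumr.
  split=> // x; rewrite mem_cat => /orP[/mapP[y yr ->]|/hr'] //=.
  have [h1 h2] := hr y yr; split; last by move=> /h2; apply: (subZ Slin).
  by rewrite linearZ /= h1 !scalerA mulrC.
- move=> s n Ss.
  have [r [hr ->]] := semisimple_sub Slin (ws_deg hS) (hg_semisimple (vsa_grading L)) Ss.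
  exists [seq (x.1 - (n + 1)%:~R, md n x.2 (vac L)) | x <- r].
  rewrite big_map md_suml; split=> // x /mapP[y yr ->] /=.
  have [c0 Sy hy] := hr y yr; split.
    rewrite [LHS](md_eigen (W := A) n (d' := 0) hy) ?addr0 //.
    by rewrite [LHS]vdeg_vac scale0r.
  (* Degree 0 forces [n + 1 >= 0]: for [n >= 0] the mode applied to the vacuum is 0, and [n = -1]
     gives back the vector of [S]. *)
  move=> /eqP; rewrite subr_eq0 => /eqP cn.
  have : 0 <= (n + 1)%:~R :> K by rewrite -cn half_nat_ge0.
  rewrite ler0z; case: n {cn} => [n|[|n]] // _.
    by rewrite vac_regular; exact: sub0 Slin.
  by rewrite vac_creation.
rewrite (eigen_decomposition (T := vdeg) (c := fst) (u := snd) (c0 := 0) _ _ e).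
- by rewrite big_seq_cond; apply: sub_sum => // x /andP[/hr[_ h] /eqP]; exact: h.
- by move=> x /hr[].
- by rewrite scale0r vdeg_vac.
Qed.

Lemma graded_simple_vac : graded_simple L -> (exists s, S s /\ s != 0) -> S (vac L).
Proof.
move=> [_ hL] [s [Ss s0]]; apply: right_closure_vac; apply/asboolP.
apply: (hL _ right_closure_ideal); exists s; split=> //.
by rewrite unfold_in; apply/asboolP; rewrite -[s]vac_creation'; exact: right_closure_gen.
Qed.

End Ideal.

Lemma graded_simple_irr (K : numFieldType) (L : vsa K) :
  graded_simple L -> wirr (adjoint_w L).
Proof.
move=> hL; split=> [|S hS hne w]; first exact: hL.1.
rewrite -[w]vac_creation'; apply: ws_act => //.
exact: graded_simple_vac hL hne.
Qed.

(** * Currents *)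

Record osp_currents (K : numFieldType) (k : K) (L : vsa K) (J : osp -> L) : Prop := {
  oc_parity : forall a, homog (osp_odd a) (J a);
  oc_degree : forall a, vdeg (J a) = J a;
  oc_bracket : forall a b,
    vprod 0 (J a) (J b) = (osp_bracket a b).1%:~R *: J (osp_bracket a b).2;
  oc_level : forall a b,
    vprod 1 (J a) (J b) = ((osp_form a b)%:~R * k) *: vac L;
  oc_regular : forall a b (n : nat), vprod n.+2%:Z (J a) (J b) = 0
}.

Definition generates (K : numFieldType) (L : vsa K) (J : osp -> L) : Prop :=
  forall S : L -> Prop, subspace S -> S (vac L) ->
    (forall a n v, S v -> S (vprod n (J a) v)) -> forall v, S v.

Section Currents.
Variables (K : numFieldType) (k : K) (L : vsa K) (J : osp -> L).
Hypothesis hJ : osp_currents k J.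

Lemma current_comm (W : wmod L) a b m n (w : W) :
  md m (J a) (md n (J b) w) - (-1) ^+ (osp_odd a && osp_odd b) *: md n (J b) (md m (J a) w)
  = (osp_bracket a b).1%:~R *: md (m + n) (J (osp_bracket a b).2) w
    + (if m + n == 0 then m%:~R * (osp_form a b)%:~R * k else 0) *: w.
Proof.
have h (j : nat) : (2 <= j)%N -> vprod j%:Z (J a) (J b) = 0.
  by case: j => [|[|j]] // _; apply: oc_regular hJ _ _ _.
rewrite (md_comm (oc_parity hJ a) (oc_parity hJ b) h).
have e (F : nat -> W) : \sum_(j < 2) F j = F 0%N + F 1%N.
  by rewrite !big_ord_recl big_ord0 addr0.
rewrite [LHS](e (fun j => zbinom K m j *: md (m + n - j%:Z) (vprod j%:Z (J a) (J b)) w)).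
rewrite zbinom0r scale1r subr0.
rewrite (oc_bracket hJ) mdZl; congr (_ + _).
rewrite zbinom1r (oc_level hJ) mdZl md_vac scalerA mulrA.
by rewrite -subr_eq0 opprK subrK; case: ifP => // _; rewrite scaler0 scale0r.
Qed.

Lemma current_par (W : wmod L) a n (w : W) :
  sv_par W (md n (J a) w) = (-1) ^+ osp_odd a *: md n (J a) (sv_par W w).
Proof. by rewrite md_par (oc_parity hJ) mdZl. Qed.

Lemma current_deg (W : wmod L) a n (w : W) :
  wdeg W (md n (J a) w) = md n (J a) (wdeg W w) - n%:~R *: md n (J a) w.
Proof.
rewrite md_deg (oc_degree hJ) intrD scalerDl scale1r opprD addrA.
by rewrite [X in X - _ - _]addrC addrAC addrK.
Qed.

Hypothesis hgen : generates J.

(** Borcherds' identity speaks of homogeneous vectors. The induction therefore carries [P] for a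
    vector together with its parity image, from which both homogeneous parts satisfy [P]. *)
Lemma current_ind (P : L -> Prop) : subspace P -> P (vac L) ->
  (forall a l q b, homog q b -> P b -> P (vprod l (J a) b)) -> forall b, P b.
Proof.
move=> hP Pv Ps b.
have hG : subspace (fun b => P b /\ P (sv_par L b)).
  split=> [|c u v [h1 h2] [h3 h4]]; first by rewrite linear0; split; apply: sub0 hP.
  by rewrite linearP; split; apply: hP.2.
have step a l u : P u -> P (sv_par L u) -> P (vprod l (J a) u).
  move=> h1 h2; rewrite (par_part_sum u) [vprod _ _ _](linearD (md (W := adjoint_w L) l (J a))).
  by apply: (subD hP); apply: Ps (par_part_homog _ _) _; exact: par_part_sub.
have [] // := hgen hG _ _ b; first by rewrite sv_par_vac.
move=> a n v [h1 h2]; split; first exact: step.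
rewrite [sv_par L _](current_par (W := adjoint_w L)); apply: (subZ hP).
by apply: step => //; rewrite sv_parK.
Qed.

Lemma current_closed (W : wmod L) (S : W -> Prop) : subspace S ->
  (forall a n w, S w -> S (md n (J a) w)) -> forall b n w, S w -> S (md n b w).
Proof.
move=> hS h; apply: current_ind.
- split=> [n w _|c u v hu hv n w Sw]; first by rewrite md0l; exact: sub0 hS.
  by rewrite mdPl; apply: hS.2; auto.
- by move=> n w Sw; rewrite md_vac; case: ifP => // _; exact: sub0 hS.
- by move=> a l q b hb Pb n w; exact: (mode_assoc_sub hS (oc_parity hJ a) hb (h a) Pb).
Qed.

Lemma current_vacuum_like (W : wmod L) (S : W -> Prop) x : subspace S ->
  (forall n a w, S w -> S (md n a w)) ->
  (forall a (n : nat), S (md n%:Z (J a) x)) -> vacuum_like S x.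
Proof.
move=> hS hact h; apply: current_ind.
- split=> [n|c u v hu hv n]; first by rewrite md0l; exact: sub0 hS.
  by rewrite mdPl; apply: hS.2; auto.
- by move=> n; rewrite md_vac; exact: sub0 hS.
- move=> a l q b hb Pb n; have [N [h1 h2]] := md_trunc2 (J a) b n%:Z x.
  rewrite (md_assoc _ (oc_parity hJ a) hb h1 h2); apply: (sub_sum hS) => j _.
  apply: (subZ hS); apply: (subB hS); first by apply/hact/Pb.
  by apply: (subZ hS); apply/hact/h.
Qed.

Lemma vacuum_like_span (W : wmod L) (S : W -> Prop) x : wsub S ->
  (forall a (n : nat), S (md n%:Z (J a) x)) ->
  forall n b c, S (md (-1) (vprod n b c) x - md n b (md (-1) c x)).
Proof.
move=> hS h n b c; have hv := current_vacuum_like (ws_lin hS) (ws_act hS) h.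
have key p := vacuum_like_assoc (ws_lin hS) (ws_act hS) hv c n (par_part_homog (M := L) p b).
have := subD (ws_lin hS) (key false) (key true).
rewrite addrACA -opprD -!mdDl -par_part_sum.
have -> : vprod n (par_part false b) c + vprod n (par_part true b) c = vprod n b c.
  by rewrite {3}(par_part_sum b) [RHS](mdDl (W := adjoint_w L)).
by [].
Qed.

End Currents.

(** * The currents generate the universal vertex superalgebra and its quotients *)

Section Generation.
Variables (K : numFieldType) (k : K) (V : vsa K) (J : osp -> V).
Hypothesis hV : is_universal_affine k J.

Lemma universal_currents : osp_currents k J.
Proof. by case: hV. Qed.

Let G (v : V) : Prop := forall T : V -> Prop, subspace T -> T (vac V) ->
  (forall a n v, T v -> T (vprod n (J a) v)) -> T v.
Local Notation A := (adjoint_w V).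

Let hG : subspace G.
Proof.
split=> [T hT _ _|c u v Gu Gv T hT h1 h2]; first exact: sub0 hT.
exact: hT.2 (Gu T hT h1 h2) (Gv T hT h1 h2).
Qed.
Let Gop a n v : G v -> G (md (W := A) n (J a) v).
Proof. by move=> Gv T hT h1 h2; exact: (h2 a n v (Gv T hT h1 h2)). Qed.
Let Gpar v : G v -> G (sv_par V v).
Proof.
move=> Gv; apply: (Gv (fun v => G (sv_par V v))) => [||a n u Gu].
- exact: subspace_ker hG.
- by rewrite sv_par_vac.
rewrite [sv_par V _](current_par universal_currents (W := A)).
by apply: (subZ hG); apply: Gop.
Qed.

Let Z (v : V) : Prop := v = 0.
Let hZ : subspace Z := subspace_zero V.
Let Q := sq_type hG hZ.
Let parZ v : G v -> Z v -> Z (sv_par V v).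
Proof. by rewrite /Z => _ ->; rewrite linear0. Qed.
Let opZ a n v : G v -> Z v -> Z (md (W := A) n (J a) v).
Proof. by rewrite /Z => _ ->; rewrite linear0. Qed.
Let parP c u v : sv_par V (c *: u + v) = c *: sv_par V u + sv_par V v.
Proof. exact: linearP. Qed.
Let opP a n c u v : md (W := A) n (J a) (c *: u + v)
  = c *: md (W := A) n (J a) u + md (W := A) n (J a) v.
Proof. exact: linearP. Qed.
Let qpar : {linear Q -> Q} := @sq_map _ _ _ _ hG hZ _ Gpar parP parZ.
Let qop a n : {linear Q -> Q} :=
  @sq_map _ _ _ _ hG hZ _ (@Gop a n) (@opP a n) (@opZ a n).

Let qparK : involutive qpar.
Proof.
elim/sq_ind => u Gu; rewrite /qpar /= sq_mapE // sq_mapE ?sv_parK //; exact: Gpar.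
Qed.
Let QS := SuperVec qparK.
Let cl (u : V) : QS := sq_cl hG hZ u.
Let vl (q : QS) : V := sq_val q.
Let qparE u : G u -> sv_par QS (cl u) = cl (sv_par V u).
Proof. exact: sq_mapE. Qed.
Let qopE a n u : G u -> qop a n (cl u) = cl (md (W := A) n (J a) u).
Proof. exact: sq_mapE. Qed.
Let clP c u v : G u -> G v -> cl (c *: u + v) = c *: cl u + cl v.
Proof. exact: sq_clP. Qed.
Let clK u : G u -> vl (cl u) = u.
Proof. by move=> Gu; have /eqP := sq_clK hG hZ Gu; rewrite subr_eq0 => /eqP. Qed.
Let Q_ind (P : QS -> Prop) : (forall u, G u -> P (cl u)) -> forall q, P q.
Proof. exact: sq_ind. Qed.
Let vl_inj (q q' : QS) : vl q = vl q' -> q = q'.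
Proof. exact: val_inj. Qed.
Let vl_linear : linear vl.
Proof.
move=> c; elim/Q_ind => u Gu; elim/Q_ind => u' Gu'.
by rewrite -clP // !clK //; apply: hG.2.
Qed.
Let vlin : {linear QS -> V} :=
  HB.pack vl (GRing.isLinear.Build K QS V *:%R _ vl_linear).
Let vl_par q : vl (sv_par QS q) = sv_par V (vl q).
Proof. by elim/Q_ind: q => u Gu; rewrite qparE // !clK //; exact: Gpar. Qed.
Let vl_op a n q : vl (qop a n q) = md (W := A) n (J a) (vl q).
Proof. by elim/Q_ind: q => u Gu; rewrite qopE // !clK //; exact: Gop. Qed.

(** The subspace [G] generated by the currents from the vacuum is itself a level [k] representation,
    with the vacuum killed by nonnegative modes. Universality maps [V] to it; followed by the
    inclusion into [V], this map is the identity by uniqueness, so [G] is all of [V]. *)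
Lemma universal_generates : generates J.
Proof.
move=> S hS Sv Sop v.
suff : G v by move=> /(_ S); apply.
have vZ c (p : QS) : vl (c *: p) = c *: vl p.
  have v0 : vl 0 = 0 by exact: clK (sub0 hG).
  by have := vl_linear c p 0; rewrite v0 !addr0.
have Qrep : is_affine_rep k (W := QS) qop.
  split=> [a n q|a b m n q]; apply: vl_inj.
    by rewrite vl_par vl_op (current_par universal_currents (W := A)) -vl_par -vl_op vZ.
  have H := current_comm universal_currents (W := A) a b m n (vl q).
  rewrite -!vl_op in H.
  have vB (p p' : QS) : vl (p - p') = vl p - vl p' by exact: (linearB vlin).
  have vD (p p' : QS) : vl (p + p') = vl p + vl p' by exact: (linearD vlin).

  by rewrite vB vD !vZ.
have := ua_induced hV Qrep (w := cl (vac V)).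
case=> [||phi [[h1 h2 h3] _]].
- by rewrite /homog expr0 scale1r qparE // sv_par_vac.
- move=> a n; rewrite qopE //.
  have -> : md (W := A) n%:Z (J a) (vac V) = 0 by exact: vac_regular.
  exact: sq_cl0.
pose vop a n : {linear A -> A} := md (W := A) n (J a).
have Vrep : is_affine_rep k (W := V) vop.
  split=> [a n w|a b m n w]; first exact: (current_par universal_currents (W := A)).
  exact: (current_comm universal_currents (W := A)).
have [||phi' [_ uniq]] := ua_induced hV Vrep (w := vac V).
- exact: vac_even.
- by move=> a n; apply: vac_regular.
have e1 := uniq (vlin \o phi) _ v; have e2 := uniq idfun _ v.
have -> : v = vl (phi v).
  rewrite -[LHS]/(idfun v) e2 -?e1 //.
  split=> [|u|a n u] /=; first by rewrite h1 [LHS]clK.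
    by rewrite h2 [LHS]vl_par.
  by rewrite h3 [LHS]vl_op.
exact: sq_valP.
Qed.

Lemma quotient_currents (L : vsa K) (pi : {linear V -> L}) : is_vsa_hom pi ->
  osp_currents k (fun a => pi (J a)).
Proof.
move=> h; have hc := universal_currents; split=> [a|a|a b|a b|a b n].
- by rewrite /homog -(vh_parity h) (oc_parity hc) linearZ.
- by rewrite -(vh_degree h) (oc_degree hc).
- by rewrite -(vh_prod h) (oc_bracket hc) linearZ.
- by rewrite -(vh_prod h) (oc_level hc) linearZ /= (vh_vac h).
- by rewrite -(vh_prod h) (oc_regular hc) linear0.
Qed.

Lemma quotient_generates (L : vsa K) (pi : {linear V -> L}) : is_vsa_hom pi ->
  (forall l, exists v, pi v = l) -> generates (fun a => pi (J a)).
Proof.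
move=> h hs S hS Sv Sop l; have [v <-] := hs l.
apply: (universal_generates (S := fun v => S (pi v))) => {v}.
- exact: subspace_ker.
- by rewrite (vh_vac h).
- by move=> a n v Sv'; rewrite (vh_prod h); apply: Sop.
Qed.

End Generation.

(** * Subquotients of modules *)

Section SubquotientModule.
Variables (K : numFieldType) (L : vsa K).
Variables (U : superVec K) (act : int -> L -> U -> U) (deg : {linear U -> U}).
Variables (A B : U -> Prop) (hA : subspace A) (hB : subspace B).
Hypotheses
  (actl : forall n c a b u, act n (c *: a + b) u = c *: act n a u + act n b u)
  (actr : forall n a c u v, act n a (c *: u + v) = c *: act n a u + act n a v)
  (act_par : forall n a u, sv_par U (act n a u) = act n (sv_par L a) (sv_par U u))
  (act_vac : forall n u, act n (vac L) u = if n == -1 then u else 0)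
  (act_deg : forall n a u, deg (act n a u)
     = act n (vdeg a) u + act n a (deg u) - (n + 1)%:~R *: act n a u)
  (deg_par : forall u, deg (sv_par U u) = sv_par U (deg u))
  (Aact : forall n a u, A u -> A (act n a u))
  (Apar : forall u, A u -> A (sv_par U u))
  (Adeg : forall u, A u -> A (deg u))
  (Bact : forall n a u, A u -> B u -> B (act n a u))
  (Bpar : forall u, A u -> B u -> B (sv_par U u))
  (Bdeg : forall u, A u -> B u -> B (deg u))
  (act_trunc : forall a u, A u ->
     exists N : nat, forall n : int, N%:Z <= n -> B (act n a u))
  (act_borcherds : forall (p q : bool) (a b : L), homog p a -> homog q b ->
    forall (c : U) (l m n : int), A c -> exists N0 : nat, forall N : nat, (N0 <= N)%N ->
    B (\sum_(j < N) zbinom K m j *: act (m + n - j%:Z) (vprod (l + j%:Z) a b) c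
     - \sum_(j < N) ((-1) ^+ j * zbinom K l j) *:
      (act (m + l - j%:Z) a (act (n + j%:Z) b c)
       - ((-1) ^ l * (-1) ^+ (p && q)) *:
           act (n + l - j%:Z) b (act (m + j%:Z) a c)))).

Let Q := sq_type hA hB.
Let parP c u v : sv_par U (c *: u + v) = c *: sv_par U u + sv_par U v.
Proof. exact: linearP. Qed.
Let degP c u v : deg (c *: u + v) = c *: deg u + deg v.
Proof. exact: linearP. Qed.
Let qpar : {linear Q -> Q} := @sq_map _ _ _ _ hA hB _ Apar parP Bpar.
Let qdeg : {linear Q -> Q} := @sq_map _ _ _ _ hA hB _ Adeg degP Bdeg.
Let qact n a : {linear Q -> Q} :=
  @sq_map _ _ _ _ hA hB _ (@Aact n a) (@actr n a) (@Bact n a).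
Let cl (u : U) : Q := sq_cl hA hB u.
Let qparE u : A u -> qpar (cl u) = cl (sv_par U u). Proof. exact: sq_mapE. Qed.
Let qdegE u : A u -> qdeg (cl u) = cl (deg u). Proof. exact: sq_mapE. Qed.
Let qactE n a u : A u -> qact n a (cl u) = cl (act n a u). Proof. exact: sq_mapE. Qed.

Let qparK : involutive qpar.
Proof.
by elim/sq_ind => u Au; rewrite -/(cl u) !qparE ?sv_parK //; apply: Apar.
Qed.

Definition sq_super : superVec K := SuperVec qparK.

Let sparE u : A u -> sv_par sq_super (cl u) = cl (sv_par U u).
Proof. exact: sq_mapE. Qed.
Let clZ c u : A u -> cl (c *: u) = c *: cl u. Proof. exact: sq_clZ. Qed.
Let clD u v : A u -> A v -> cl (u + v) = cl u + cl v. Proof. exact: sq_clD. Qed.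
Let clB u v : A u -> A v -> cl (u - v) = cl u - cl v. Proof. exact: sq_clB. Qed.
Let clP c u v : A u -> A v -> cl (c *: u + v) = c *: cl u + cl v.
Proof. exact: sq_clP. Qed.
Let cl0 u : A u -> B u -> cl u = 0. Proof. by move=> Au /(sq_cl_eq0 hA hB Au). Qed.
Let cl_sum (N : nat) (F : 'I_N -> U) : (forall i, A (F i)) ->
  cl (\sum_(i < N) F i) = \sum_(i < N) cl (F i).
Proof. exact: sq_cl_sum. Qed.

Let sq_action : is_vertex_action (M := sq_super) (vac L) (@vprod K L) qact.
Proof.
split=> [n|n a|n a|a|n|].
- elim/sq_ind => u Au; rewrite -/(cl u) => c a b.
  by rewrite !qactE // actl clP //; apply: Aact.
- exact: linearP.
- elim/sq_ind => u Au; rewrite -/(cl u) qactE // !sparE //; last exact: Aact.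
  by rewrite qactE ?act_par //; apply: Apar.
- elim/sq_ind => u Au; rewrite -/(cl u); have [N hN] := act_trunc a Au.
  by exists N => n /hN h; rewrite qactE //; apply: cl0 => //; apply: Aact.
- elim/sq_ind => u Au; rewrite -/(cl u) qactE // act_vac.
  by case: ifP => // _; exact: sq_cl0.
- move=> p q a b ha hb; elim/sq_ind => c Ac l m n; rewrite -/(cl c).
  have [N0 H] := act_borcherds ha hb l m n Ac.
  have A2 n1 n2 a1 a2 : A (act n1 a1 (act n2 a2 c)) by do 2!apply: Aact.
  have AB j : A (act (m + l - j%:Z) a (act (n + j%:Z) b c)
       - ((-1) ^ l * (-1) ^+ (p && q)) *: act (n + l - j%:Z) b (act (m + j%:Z) a c)).
    by apply: (subB hA) => //; apply: (subZ hA).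
  exists N0 => N /H h.
  transitivity (cl (\sum_(j < N) zbinom K m j *: act (m + n - j%:Z) (vprod (l + j%:Z) a b) c)).
    rewrite cl_sum => [|j]; last by apply: (subZ hA); apply: Aact.
    by apply: eq_bigr => j _; rewrite clZ ?qactE //; apply: Aact.
  transitivity (cl (\sum_(j < N) ((-1) ^+ j * zbinom K l j) *:
      (act (m + l - j%:Z) a (act (n + j%:Z) b c)
       - ((-1) ^ l * (-1) ^+ (p && q)) *: act (n + l - j%:Z) b (act (m + j%:Z) a c)))).
    apply/(sq_cl_eq hA hB) => //; apply: (sub_sum hA) => j _; apply: (subZ hA) => //.
    exact: Aact.
  rewrite cl_sum => [|j]; last exact: (subZ hA).
  apply: eq_bigr => j _; rewrite clZ // clB // ?clZ //; last exact: (subZ hA).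
  by rewrite !qactE //; apply: Aact.
Qed.

Let sq_deg_par (m : sq_super) : qdeg (sv_par sq_super m) = sv_par sq_super (qdeg m).
Proof.
elim/sq_ind: m => u Au; rewrite -/(cl u) sparE //.
rewrite [LHS]qdegE ?deg_par; last exact: Apar.
by rewrite [qdeg _]qdegE // [RHS]sparE //; apply: Adeg.
Qed.

Let sq_deg_act n (a : L) (m : Q) :
  qdeg (qact n a m) = qact n (vdeg a) m + qact n a (qdeg m) - (n + 1)%:~R *: qact n a m.
Proof.
elim/sq_ind: m => u Au; rewrite -/(cl u) (qdegE Au) (qactE n (vdeg a) Au).
rewrite (qactE n a Au) (qactE n a (Adeg Au)) (qdegE (Aact n a Au)) act_deg.
have [A1 A2] : A (act n a u) /\ A (act n a (deg u)).
  by split; [exact: Aact | exact/Aact/Adeg].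
have A3 : A (act n (vdeg a) u) by exact: Aact.
by rewrite -(clZ _ A1) -(clD A3 A2) -(clB (subD hA A3 A2) (subZ hA _ A1)).
Qed.

(** Truncation and Borcherds' identity are assumed on [A] and modulo [B], which is the sense in
    which the sequences used for localization satisfy them. *)
Definition sq_wmod : wmod L :=
  Wmod (wsp := sq_super) (wact := qact) (wdeg := qdeg) sq_action sq_deg_par sq_deg_act.

Definition sqw_cl (u : U) : sq_wmod := cl u.

Lemma sqw_actE n a u : A u -> md n a (sqw_cl u) = sqw_cl (act n a u).
Proof. exact: qactE. Qed.
Lemma sqw_parE u : A u -> sv_par sq_wmod (sqw_cl u) = sqw_cl (sv_par U u).
Proof. exact: qparE. Qed.
Lemma sqw_degE u : A u -> wdeg sq_wmod (sqw_cl u) = sqw_cl (deg u).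
Proof. exact: qdegE. Qed.
End SubquotientModule.

Section SubQuot.
Variables (K : numFieldType) (L : vsa K) (W : wmod L).
Variables (A B : W -> Prop) (hA : wsub A) (hB : wsub B).

Let mdPr n (a : L) c (u v : W) : md n a (c *: u + v) = c *: md n a u + md n a v.
Proof. exact: linearP. Qed.
Let trunc (a : L) (u : W) : A u ->
  exists N : nat, forall n : int, N%:Z <= n -> B (md n a u).
Proof.
move=> _; have [N hN] := md_trunc a u.
by exists N => n /hN ->; exact: sub0 (ws_lin hB).
Qed.
Let borch (p q : bool) (a b : L) : homog p a -> homog q b ->
    forall (c : W) (l m n : int), A c -> exists N0 : nat, forall N : nat, (N0 <= N)%N ->
    B (\sum_(j < N) zbinom K m j *: md (m + n - j%:Z) (vprod (l + j%:Z) a b) c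
     - \sum_(j < N) ((-1) ^+ j * zbinom K l j) *:
      (md (m + l - j%:Z) a (md (n + j%:Z) b c)
       - ((-1) ^ l * (-1) ^+ (p && q)) *:
           md (n + l - j%:Z) b (md (m + j%:Z) a c))).
Proof.
move=> ha hb c l m n _; have [N0 H] := va_borcherds (w_action W) ha hb c l m n.
by exists N0 => N /H; rewrite /md => ->; rewrite subrr; exact: sub0 (ws_lin hB).
Qed.

Definition subquot : wmod L :=
  @sq_wmod K L W (@md K L W) (wdeg W) A B (ws_lin hA) (ws_lin hB)
   (@mdPl K L W) mdPr (@md_par K L W) (@md_vac K L W) (@md_deg K L W) (@w_deg_par K L W)
   (ws_act hA) (ws_par hA) (ws_deg hA)
   (fun n a u _ => @ws_act _ _ _ _ hB n a u) (fun u _ => @ws_par _ _ _ _ hB u)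
   (fun u _ => @ws_deg _ _ _ _ hB u) trunc borch.

Definition sub_cl (u : W) : subquot := sq_cl (ws_lin hA) (ws_lin hB) u.
Definition sub_rep (q : subquot) : W := sq_val q.

Lemma sub_actE n a u : A u -> md n a (sub_cl u) = sub_cl (md n a u).
Proof. exact: sqw_actE. Qed.
Lemma sub_parE u : A u -> sv_par subquot (sub_cl u) = sub_cl (sv_par W u).
Proof. exact: sqw_parE. Qed.
Lemma sub_degE u : A u -> wdeg subquot (sub_cl u) = sub_cl (wdeg W u).
Proof. exact: sqw_degE. Qed.
Lemma sub_clP c u v : A u -> A v -> sub_cl (c *: u + v) = c *: sub_cl u + sub_cl v.
Proof. exact: sq_clP. Qed.
Lemma sub_cl_eq0 u : A u -> (sub_cl u = 0) <-> B u.
Proof. exact: sq_cl_eq0. Qed.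
Lemma sub_ind (P : subquot -> Prop) : (forall u, A u -> P (sub_cl u)) -> forall q, P q.
Proof. exact: sq_ind. Qed.

Definition pull (S : subquot -> Prop) (u : W) : Prop := A u /\ S (sub_cl u).

Lemma pull_sub S : wsub S -> wsub (pull S).
Proof.
move=> hS; have hA' := ws_lin hA; split=> [|n a w|w|w].
- split=> [|c u v [Au Su] [Av Sv]].
    by split; [exact: sub0 hA'|rewrite /sub_cl sq_cl0; exact: sub0 (ws_lin hS)].
  by split; [apply: hA'.2|rewrite sub_clP //; apply: (ws_lin hS).2].
- move=> [Aw Sw]; split; first exact: ws_act hA _ _ _ Aw.
  by rewrite -sub_actE //; apply: ws_act.
- move=> [Aw Sw]; split; first exact: ws_par hA _ Aw.
  by rewrite -sub_parE //; apply: ws_par.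
- move=> [Aw Sw]; split; first exact: ws_deg hA _ Aw.
  by rewrite -sub_degE //; apply: ws_deg.
Qed.

End SubQuot.

(** * Twisted localization *)

Section Nilpotency.
Variables (K : numFieldType) (L : vsa K) (b : L).
Hypothesis hb : homog false b.
Local Notation A := (adjoint_w L).

(** Localization requires [ad b_(q)] to be locally nilpotent. By the commutator formula each
    commutator with [b_(q)] replaces [a] by vectors [b_(j) a] with [j >= 0], so [i] iterated
    commutators vanish. *)
Fixpoint nil_order (i : nat) (a : L) : Prop :=
  if i is i'.+1 then forall j : nat, nil_order i' (vprod j%:Z b a) else a = 0.

Lemma nil_subspace i : subspace (nil_order i).
Proof.
elim: i => [|i IH]; first exact: subspace_zero.
split=> [j|c u v hu hv j /=].
  by rewrite [vprod _ _ _](linear0 (md (W := A) j%:Z b)); exact: sub0 IH.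
rewrite [vprod _ _ _](linearP (md (W := A) j%:Z b)).
by apply: IH.2; [exact: hu | exact: hv].
Qed.

Lemma nil_orderS i a : nil_order i a -> nil_order i.+1 a.
Proof.
elim: i a => [a -> j|i IH a h j]; last exact/IH/h.
by rewrite [vprod _ _ _](linear0 (md (W := A) j%:Z b)).
Qed.

Lemma nil_order_leq i j a : (i <= j)%N -> nil_order i a -> nil_order j a.
Proof.
move=> /subnK <-; elim: (j - i)%N => // n IH h; rewrite addSn; exact/nil_orderS/IH.
Qed.

(** Leibniz rule: a nonnegative mode of [b] on [c_(n) a] acts either on [a] or, through the
    commutator, on [c]. In both cases [i + i'] drops. *)
Lemma nil_order_prod i i' c a n : nil_order i c -> nil_order i' a ->
  nil_order (i + i') (vprod n c a).
Proof.
move: {2}(i + i')%N (leqnn (i + i')) => s; elim: s i i' c a n => [|s IH] i i' c a n.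
  rewrite leqn0 addn_eq0 => /andP[/eqP -> /eqP ->] /= -> _.
  exact: (md0l (W := A)).
case: i => [_ /= -> _|i le].
  by rewrite [vprod n _ _](md0l (W := A)); exact: (sub0 (nil_subspace (0 + i')%N)).
case: i' le => [_ _ /= ->|i' le].
  rewrite [vprod n _ _](linear0 (md (W := A) n c)); exact: (sub0 (nil_subspace (i.+1 + 0)%N)).
move=> hc ha j; have hs := nil_subspace (i + i'.+1).
have [N hN] := prod_trunc b c.
have := md_comm_even (W := A) hb hN j%:Z n a.
move/eqP; rewrite subr_eq => /eqP e'; rewrite [vprod _ _ _]e'.
apply: (subD hs); last first.
  by have := IH i.+1 i' c _ n _ hc (ha j); rewrite addSnnS; apply; lia.
apply: (sub_sum hs) => l _; apply: (subZ hs).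
by apply: IH (hc l) ha; lia.
Qed.

Lemma nil_order_all (J : osp -> L) k : osp_currents k J -> generates J ->
  (forall a, exists i, nil_order i (J a)) -> forall a, exists i, nil_order i a.
Proof.
move=> hJ hg h; apply: (current_ind hJ hg).
- split=> [|c u v [i hu] [j hv]]; first by exists 0%N.
  exists (maxn i j); apply: (nil_subspace _).2.
    exact: nil_order_leq (leq_maxl _ _) hu.
  exact: nil_order_leq (leq_maxr _ _) hv.
- by exists 1%N => j; exact: vac_regular.
- by move=> a l _ c _ [j hc]; have [i hi] := h a; exists (i + j)%N; apply: nil_order_prod.
Qed.

End Nilpotency.

Section Localization.
Variables (K : numFieldType) (L : vsa K) (W : wmod L).
Variables (b : L) (q : int) (d mu : K).
Hypothesis hb : homog false b.
Hypothesis hdeg : vdeg b = (d + (q + 1)%:~R) *: b.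
Hypothesis hnil : forall a, exists i, nil_order b i a.

Local Notation E := (md (W := W) q b).

Lemma loc_par (w : W) : sv_par W (E w) = E (sv_par W w).
Proof. by rewrite md_par hb expr0 scale1r. Qed.

Lemma loc_deg (w : W) : wdeg W (E w) = E (wdeg W w) + d *: E w.
Proof.
by rewrite md_deg hdeg mdZl; lmod_ring K W.
Qed.

Lemma loc_comm a : exists N : nat, forall n (w : W),
  E (md n a w) - md n a (E w)
  = \sum_(j < N) zbinom K q j *: md (q + n - j%:Z) (vprod j%:Z b a) w.
Proof. by have [N hN] := prod_trunc b a; exists N => n w; apply: md_comm_even. Qed.

Definition seqU := (nat -> W)%type.
HB.instance Definition _ := GRing.Lmodule.on seqU.
Implicit Types F G : seqU.

Definition seq_par F : seqU := fun m => sv_par W (F m).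
Fact seq_par_linear : linear seq_par.
Proof. by move=> c F G; apply/funext => m; rewrite /seq_par linearP. Qed.
HB.instance Definition _ := GRing.isLinear.Build K seqU seqU *:%R seq_par seq_par_linear.
Fact seq_parK : involutive seq_par.
Proof. by move=> F; apply/funext => m; exact: sv_parK. Qed.
Definition seq_super : superVec K := SuperVec seq_parK.

Definition seq_act n a F : seqU := fun m => md n a (F m).
(* [E ^+ m] has degree [m * d]; subtracting it makes [m |-> E ^+ m w] behave like [w] *)
Definition seq_deg F : seqU := fun m => wdeg W (F m) - (m%:R * d) *: F m.
Fact seq_deg_linear : linear seq_deg.
Proof.
move=> c F G; apply/funext => m; rewrite /seq_deg /=.
have -> : (c *: F + G) m = c *: F m + G m by [].
rewrite linearP scalerDr opprD addrACA; congr (_ + _).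
by rewrite [in RHS]/GRing.scale /= scalerBr !scalerA (mulrC c).
Qed.
HB.instance Definition _ := GRing.isLinear.Build K seqU seqU *:%R seq_deg seq_deg_linear.

Definition shift F : seqU := fun m => F m.+1.
Definition diff F : seqU := fun m => F m.+1 - E (F m).
Definition mulm F : seqU := fun m => m%:R *: F m.

(** For [F m = E^m p(m)], [diff F m] is [E^(m+1)] applied to the forward difference of [p] at [m].
    So this says that [p] is, from [m0] on, polynomial of degree less than [i], without mentioning
    an inverse of [E]. *)
Fixpoint pol (i m0 : nat) F : Prop :=
  if i is i'.+1 then pol i' m0 (diff F) else forall m, (m0 <= m)%N -> F m = 0.

Lemma diffP c F G : diff (c *: F + G) = c *: diff F + diff G.
Proof.
apply/funext => m; rewrite /diff.
have -> n : (c *: F + G) n = c *: F n + G n by [].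
by rewrite linearP opprD addrACA -scalerBr.
Qed.
Lemma diff0 : diff 0 = 0.
Proof. by apply/funext => m; rewrite /diff linear0 subrr. Qed.

Lemma pol_subspace i m0 : subspace (pol i m0).
Proof.
elim: i => [|i IH].
  split=> // c F G hF hG m le.
  have -> : (c *: F + G) m = c *: F m + G m by [].
  by rewrite hF // hG // scaler0 addr0.
split=> [|c F G hF hG /=]; first by rewrite /= diff0; exact: sub0 IH.
by rewrite diffP; apply: IH.2.
Qed.

Lemma polS i m0 F : pol i m0 F -> pol i.+1 m0 F.
Proof.
elim: i F => [|i IH] F /= h; last exact: IH.
by move=> m le; rewrite /diff (h _ le) (h _ (leqW le)) linear0 subrr.
Qed.

Lemma pol_leq i j m0 m1 F : (i <= j)%N -> (m0 <= m1)%N -> pol i m0 F -> pol j m1 F.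
Proof.
move=> /subnK <- le h; elim: (j - i)%N => [|n IH]; last by rewrite addSn; exact: polS.
rewrite add0n; elim: i F h => [|i IH] F /= h; last exact: IH.
by move=> m lm; apply/h/(leq_trans le).
Qed.

Lemma pol_shift i m0 F : pol i m0 F -> pol i m0 (shift F).
Proof.
elim: i F => [|i IH] F /= h; first by move=> m le; apply/h/leqW.
exact: IH h.
Qed.

Lemma diff_mulm F : diff (mulm F) = mulm (diff F) + shift F.
Proof.
apply/funext => m; rewrite /diff /mulm.
have -> (X Y : seqU) : (X + Y) m = X m + Y m by [].
rewrite linearZ /= -natr1 scalerDl scale1r /shift scalerBr.
by rewrite addrAC.
Qed.

Lemma pol_mulm i m0 F : pol i m0 F -> pol i.+1 m0 (mulm F).
Proof.
elim: i F => [|i IH] F h.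
  by apply: polS => m le /=; rewrite /mulm h // scaler0.
have hs := pol_subspace i.+1 m0.
rewrite -[pol _ _ _]/(pol i.+1 m0 (diff (mulm F))) diff_mulm.
by apply: (subD hs); [exact: IH | exact: pol_shift].
Qed.

Lemma pol_map i m0 F (T : seqU -> seqU) : (forall F, diff (T F) = T (diff F)) ->
  (forall F, (forall m, (m0 <= m)%N -> F m = 0) -> forall m, (m0 <= m)%N -> T F m = 0) ->
  pol i m0 F -> pol i m0 (T F).
Proof.
move=> hT h0; elim: i F => [|i IH] F h; first exact: h0.
by rewrite /= hT; apply: IH.
Qed.

Definition seqE F : seqU := fun m => E (F m).

Lemma pol_E i m0 F : pol i m0 F -> pol i m0 (seqE F).
Proof.
apply: pol_map => {}F; first by apply/funext => m; rewrite /diff /seqE -linearB.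
by move=> h m /h; rewrite /seqE => ->; rewrite linear0.
Qed.

Lemma pol_par i m0 F : pol i m0 F -> pol i m0 (seq_par F).
Proof.
apply: pol_map => {}F.
  by apply/funext => m; rewrite /diff /seq_par -loc_par -linearB.
by move=> h m /h; rewrite /seq_par => ->; rewrite linear0.
Qed.

Lemma pol_deg i m0 F : pol i m0 F -> pol i m0 (seq_deg F).
Proof.
elim: i F => [|i IH] F h.
  by move=> m le; rewrite /seq_deg h // linear0 scaler0 subrr.
have e : diff (seq_deg F) = seq_deg (diff F) - d *: diff F.
  apply/funext => m; rewrite /diff /seq_deg.
  have -> (X Y : seqU) c : (X - c *: Y) m = X m - c *: Y m by [].
  rewrite !linearB /= loc_deg [E (_ *: F m)]linearZ /= -natr1.
  set a := wdeg W (F m.+1); lmod_ring K W.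
rewrite /= e; have hs := pol_subspace i m0.
by apply: (subB hs); [exact: IH | exact: subZ].
Qed.

Lemma diff_act n a F (N : nat) :
  (forall n (w : W), E (md n a w) - md n a (E w)
     = \sum_(j < N) zbinom K q j *: md (q + n - j%:Z) (vprod j%:Z b a) w) ->
  diff (seq_act n a F) = seq_act n a (diff F)
    - \sum_(j < N) zbinom K q j *: seq_act (q + n - j%:Z) (vprod j%:Z b a) F.
Proof.
move=> h; apply/funext => m; rewrite /diff /seq_act.
have -> (X Y : seqU) : (X - Y) m = X m - Y m by [].
rewrite linearB /= fct_sumE.
have -> : \sum_(i < N) (zbinom K q i *: seq_act (q + n - i%:Z) (vprod i%:Z b a) F) m
  = E (md n a (F m)) - md n a (E (F m)) by rewrite h.
lmod_ring K W.
Qed.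

(** By [diff_act], taking a difference either lowers the degree of [F] or replaces [a] by vectors
    [b_(j) a] of smaller nilpotency order. *)
Lemma pol_act i i' m0 a n F : nil_order b i a -> pol i' m0 F -> pol (i + i') m0 (seq_act n a F).
Proof.
move: {2}(i + i')%N (leqnn (i + i')) => s.
elim: s i i' a n F => [|s IH] i i' a n F.
  rewrite leqn0 addn_eq0 => /andP[/eqP -> /eqP ->] /= -> _ m _.
  by rewrite /seq_act md0l.
case: i => [_ /= -> _|i le].
  rewrite (_ : seq_act n 0 F = 0); first exact: (sub0 (pol_subspace (0 + i') m0)).
  by apply/funext => m; rewrite /seq_act md0l.
have [N hN] := loc_comm a.
case: i' le => [_ ha h|i' le ha h].
  apply: (pol_leq (i := 0) (m0 := m0)) => // m lm.
  by rewrite /seq_act h // linear0.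
rewrite addSn /= (diff_act n F hN); have hs := pol_subspace (i + i'.+1) m0.
apply: (subB hs).
  by have := IH i.+1 i' a n (diff F) _ ha h; rewrite addSnnS; apply; lia.
by apply: (sub_sum hs) => j _; apply: (subZ hs); apply: IH (ha j) h; lia.
Qed.

(** The bound has to be uniform in [m]. Induction on [i + i'] provides bounds for [diff F] and for
    the finitely many vectors [b_(j) a]; vanishing then spreads upwards from [m0] through
    [F (m+1) = diff F m + E (F m)]. *)
Lemma pol_trunc i i' m0 a F : nil_order b i a -> pol i' m0 F ->
  exists N : nat, forall n, N%:Z <= n -> forall m, (m0 <= m)%N -> md n a (F m) = 0.
Proof.
move: {2}(i + i')%N (leqnn (i + i')) => s.
elim: s i i' a F => [|s IH] i i' a F.
  rewrite leqn0 addn_eq0 => /andP[/eqP -> /eqP ->] /= -> _.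
  by exists 0%N => n _ m _; rewrite md0l.
case: i => [_ /= -> _|i le]; first by exists 0%N => n _ m _; rewrite md0l.
case: i' le => [_ ha h|i' le ha h].
  by exists 0%N => n _ m lm; rewrite h // linear0.
have [J0 hJ] := loc_comm a.
have [N1 h1] : exists N : nat, forall n, N%:Z <= n -> forall m, (m0 <= m)%N ->
    md n a (diff F m) = 0 by apply: (IH i.+1 i' a (diff F)) => //; lia.
have : forall j : nat, exists N : nat, forall n, N%:Z <= n -> forall m, (m0 <= m)%N ->
    md n (vprod j%:Z b a) (F m) = 0.
  by move=> j; apply: IH (ha j) h; lia.
move=> /choice[N2 h2].
have [N3 h3] := md_trunc a (F m0).
pose N4 := \max_(j < J0) N2 j.
(* The commutator terms carry the modes [q + n - j] with [j < J0], which must exceed every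
   [N2 j]. *)
exists (maxn (maxn N1 N3) (N4 + J0 + `|q|)) => n; rewrite lez_nat || move=> hn m.
move=> le0; have hb1 : N1%:Z <= n by lia.
have hb3 : N3%:Z <= n by lia.
elim: m le0 => [|m IHm].
  by rewrite leqn0 => /eqP e; rewrite -{1}e in h3 *; apply: h3.
rewrite leq_eqVlt => /orP[/eqP <-|]; first exact: h3.
rewrite ltnS => lm.
have -> : F m.+1 = diff F m + E (F m) by rewrite /diff subrK.
rewrite linearD /= h1 // add0r.
have := hJ n (F m); rewrite IHm // linear0 sub0r => /eqP.
rewrite eqr_oppLR => /eqP ->; rewrite big1 ?oppr0 // => j _.
rewrite h2 ?scaler0 //.
have : (N2 j <= N4)%N by exact: (leq_bigmax j).
by have := ltn_ord j; lia.
Qed.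

(* Think of [F] in [locA] as [F m = E^m p(m)], for large [m], with [p] a
   polynomial with values in the localization [W[E^-1]]; [locB] says [p mu = 0].
   The class of [F] is [p mu], on which [a] acts by [E^-mu a E^mu]. *)
Definition locA F : Prop := exists i m0, pol i m0 F.

Definition ev (P : nat -> Prop) : Prop := exists m0, forall m, (m0 <= m)%N -> P m.

Definition locB F : Prop := exists2 G : seqU, locA G & ev (fun m => F m = (m%:R - mu) *: G m).

Lemma locA_subspace : subspace locA.
Proof.
split=> [|c F G [i [m hF]] [j [n hG]]].
  by exists 0%N, 0%N.
exists (maxn i j), (maxn m n); apply: (pol_subspace _ _).2.
  exact: pol_leq (leq_maxl _ _) (leq_maxl _ _) hF.
exact: pol_leq (leq_maxr _ _) (leq_maxr _ _) hG.
Qed.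

Lemma ev_and P Q : ev P -> ev Q -> ev (fun m => P m /\ Q m).
Proof.
move=> [m h] [n h']; exists (maxn m n) => i; rewrite geq_max => /andP[l l'].
by split; auto.
Qed.

Lemma locB_subspace : subspace locB.
Proof.
split=> [|c F G [F' hF eF] [G' hG eG]].
  by exists 0; [exact: sub0 locA_subspace | exists 0%N => m _; rewrite [RHS]scaler0].
exists (c *: F' + G'); first exact: locA_subspace.2.
have [m0 h] := ev_and eF eG; exists m0 => m /h[e1 e2].
have -> (X Y : seqU) : (c *: X + Y) m = c *: X m + Y m by [].
have -> (X Y : seqU) : (c *: X + Y) m = c *: X m + Y m by [].
rewrite e1 e2; lmod_ring K W.
Qed.

Lemma locB_ev0 F : ev (fun m => F m = 0) -> locB F.
Proof.
move=> [m0 h]; exists 0; first exact: sub0 locA_subspace.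
by exists m0 => m /h ->; rewrite [RHS]scaler0.
Qed.

Lemma locA_act n a F : locA F -> locA (seq_act n a F).
Proof.
move=> [i [m0 h]]; have [j hj] := hnil a.
by exists (j + i)%N, m0; apply: pol_act.
Qed.
Lemma locA_par F : locA F -> locA (seq_par F).
Proof. by move=> [i [m0 h]]; exists i, m0; apply: pol_par. Qed.
Lemma locA_deg F : locA F -> locA (seq_deg F).
Proof. by move=> [i [m0 h]]; exists i, m0; apply: pol_deg. Qed.
Lemma locA_E F : locA F -> locA (seqE F).
Proof. by move=> [i [m0 h]]; exists i, m0; apply: pol_E. Qed.
Lemma locA_mulm F : locA F -> locA (mulm F).
Proof. by move=> [i [m0 h]]; exists i.+1, m0; apply: pol_mulm. Qed.

Lemma locB_map (T : seqU -> seqU) F : (forall G, locA G -> locA (T G)) ->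
  (forall F G, ev (fun m => F m = (m%:R - mu) *: G m) ->
     ev (fun m => T F m = (m%:R - mu) *: T G m)) ->
  locB F -> locB (T F).
Proof. by move=> hA h [G AG e]; exists (T G); [exact: hA | exact: h]. Qed.

Lemma locB_act n a F : locA F -> locB F -> locB (seq_act n a F).
Proof.
move=> _; apply: locB_map => [G|G H [m0 h]]; first exact: locA_act.
by exists m0 => m /h e; rewrite /seq_act e linearZ.
Qed.
Lemma locB_par F : locA F -> locB F -> locB (seq_par F).
Proof.
move=> _; apply: locB_map => [G|G H [m0 h]]; first exact: locA_par.
by exists m0 => m /h e; rewrite /seq_par e linearZ.
Qed.
Lemma locB_deg F : locA F -> locB F -> locB (seq_deg F).
Proof.
move=> _; apply: locB_map => [G|G H [m0 h]]; first exact: locA_deg.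
exists m0 => m /h e; rewrite /seq_deg e linearZ /=; lmod_ring K W.
Qed.

Lemma seq_actl n c a a' F : seq_act n (c *: a + a') F = c *: seq_act n a F + seq_act n a' F.
Proof. by apply/funext => m; exact: mdPl. Qed.
Lemma seq_actr n a c F G : seq_act n a (c *: F + G) = c *: seq_act n a F + seq_act n a G.
Proof. by apply/funext => m; exact: linearP. Qed.
Lemma seq_act_par n a F : seq_par (seq_act n a F) = seq_act n (sv_par L a) (seq_par F).
Proof. by apply/funext => m; exact: md_par. Qed.
Lemma seq_act_vac n F : seq_act n (vac L) F = if n == -1 then F else 0.
Proof. by apply/funext => m; rewrite /seq_act md_vac; case: ifP. Qed.
Lemma seq_act_deg n a F : seq_deg (seq_act n a F)
  = seq_act n (vdeg a) F + seq_act n a (seq_deg F) - (n + 1)%:~R *: seq_act n a F.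
Proof.
apply/funext => m; rewrite /seq_deg /seq_act.
have -> (X Y Z : seqU) c : (X + Y - c *: Z) m = X m + Y m - c *: Z m by [].
rewrite md_deg [md n a (_ - _)]linearB /= [md n a (_ *: _)]linearZ /=; lmod_ring K W.
Qed.
Lemma seq_deg_par F : seq_deg (seq_par F) = seq_par (seq_deg F).
Proof.
apply/funext => m; rewrite /seq_deg /seq_par w_deg_par [in RHS]linearB /=.
by rewrite [sv_par W (_ *: _)]linearZ.
Qed.
Lemma seq_trunc a F : locA F ->
  exists N : nat, forall n : int, N%:Z <= n -> locB (seq_act n a F).
Proof.
move=> [i [m0 h]]; have [j hj] := hnil a; have [N hN] := pol_trunc hj h.
by exists N => n /hN e; apply: locB_ev0; exists m0.
Qed.

(** The identity holds at each index of the sequence, but with a range of summation depending on the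
    index; [pol_trunc] makes one range serve all large indices. *)
Lemma seq_borcherds (p p' : bool) (a a' : L) : homog p a -> homog p' a' ->
    forall F (l m n : int), locA F -> exists N0 : nat, forall N : nat, (N0 <= N)%N ->
    locB (\sum_(j < N) zbinom K m j *: seq_act (m + n - j%:Z) (vprod (l + j%:Z) a a') F
     - \sum_(j < N) ((-1) ^+ j * zbinom K l j) *:
      (seq_act (m + l - j%:Z) a (seq_act (n + j%:Z) a' F)
       - ((-1) ^ l * (-1) ^+ (p && p')) *:
           seq_act (n + l - j%:Z) a' (seq_act (m + j%:Z) a F))).
Proof.
move=> ha ha' F l m n [i [m0 h]].
have [j1 hj1] := hnil a; have [j2 hj2] := hnil a'.
have [N1 t1] := pol_trunc hj1 h; have [N2 t2] := pol_trunc hj2 h.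
have [N3 t3] := va_truncation (vsa_action L) a a'.
exists (maxn (N3 + `|l|) (maxn (N1 + `|m|) (N2 + `|n|))) => N le.
apply: locB_ev0; exists m0 => s ls.
have -> (X Y : seqU) : (X - Y) s = X s - Y s by [].
rewrite !fct_sumE.
have [N0 H] := va_borcherds (w_action W) ha ha' (F s) l m n.
have := H _ (leq_maxl N0 N).
pose G1 (j : nat) : W := zbinom K m j *: wact (m + n - j%:Z) (vprod (l + j%:Z) a a') (F s).
pose G2 (j : nat) : W := ((-1) ^+ j * zbinom K l j) *:
      (wact (m + l - j%:Z) a (wact (n + j%:Z) a' (F s))
       - ((-1) ^ l * (-1) ^+ (p && p')) *:
           wact (n + l - j%:Z) a' (wact (m + j%:Z) a (F s))).
have e1 : \sum_(j < maxn N0 N) G1 j = \sum_(j < N) G1 j.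
  apply: sum_truncate; first exact: leq_maxr.
  move=> j lj; rewrite /G1 t3; last by lia.
  by rewrite [wact _ _ _]md0l scaler0.
have e2 : \sum_(j < maxn N0 N) G2 j = \sum_(j < N) G2 j.
  apply: sum_truncate; first exact: leq_maxr.
  move=> j lj; rewrite /G2.
  have -> : wact (n + j%:Z) a' (F s) = 0 by apply: t2 => //; lia.
  have -> : wact (m + j%:Z) a (F s) = 0 by apply: t1 => //; lia.
  by rewrite [wact _ a 0](linear0 (md _ _)) [wact _ a' 0](linear0 (md _ _)) scaler0 subr0 scaler0.
by move=> e; rewrite -[X in X - _]e1 -[X in _ - X]e2 e subrr.
Qed.

Definition loc : wmod L :=
  @sq_wmod K L seq_super seq_act seq_deg locA locB locA_subspace locB_subspace
    seq_actl seq_actr seq_act_par seq_act_vac seq_act_deg seq_deg_par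
    locA_act locA_par locA_deg locB_act locB_par locB_deg seq_trunc seq_borcherds.

Definition loc_cl (F : seqU) : loc := sq_cl locA_subspace locB_subspace F.

Lemma loc_actE n a F : locA F -> md n a (loc_cl F) = loc_cl (seq_act n a F).
Proof. exact: sqw_actE. Qed.
Lemma loc_parE F : locA F -> sv_par loc (loc_cl F) = loc_cl (seq_par F).
Proof. exact: sqw_parE. Qed.
Lemma loc_degE F : locA F -> wdeg loc (loc_cl F) = loc_cl (seq_deg F).
Proof. exact: sqw_degE. Qed.
Lemma loc_clP c F G : locA F -> locA G -> loc_cl (c *: F + G) = c *: loc_cl F + loc_cl G.
Proof. exact: sq_clP. Qed.
Lemma loc_cl_eq0 F : locA F -> (loc_cl F = 0) <-> locB F.
Proof. exact: sq_cl_eq0. Qed.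
Lemma loc_ind (P : loc -> Prop) : (forall F, locA F -> P (loc_cl F)) -> forall x, P x.
Proof. exact: sq_ind. Qed.

End Localization.

(** * Torsion modulo a submodule *)

Section Saturation.
Variables (K : numFieldType) (L : vsa K) (b : L) (q : int) (d : K).
Hypothesis hb : homog false b.
Hypothesis hdeg : vdeg b = (d + (q + 1)%:~R) *: b.
Hypothesis hnil : forall a, exists i, nil_order b i a.
Variable W : wmod L.
Local Notation E := (md (W := W) q b).

Definition saturation (S : W -> Prop) (x : W) : Prop := exists i, S (iter i E x).

Lemma iter_lin i c (x y : W) : iter i E (c *: x + y) = c *: iter i E x + iter i E y.
Proof. by elim: i => //= i ->; rewrite linearP. Qed.
Lemma iter_0 i : iter i E 0 = 0.
Proof. by elim: i => //= i ->; rewrite linear0. Qed.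
Lemma iterZ i c (x : W) : iter i E (c *: x) = c *: iter i E x.
Proof. by have := iter_lin i c x 0; rewrite iter_0 !addr0. Qed.
Lemma iterDl i (x y : W) : iter i E (x + y) = iter i E x + iter i E y.
Proof. by have := iter_lin i 1 x y; rewrite !scale1r. Qed.
Lemma iter_sum i (N : nat) (F : 'I_N -> W) :
  iter i E (\sum_(j < N) F j) = \sum_(j < N) iter i E (F j).
Proof.
by elim/big_rec2: _ => [|j x y _ <-]; rewrite ?iter_0 ?iterDl.
Qed.
Lemma iter_par i (x : W) : iter i E (sv_par W x) = sv_par W (iter i E x).
Proof. by elim: i => //= i ->; rewrite loc_par. Qed.
Lemma iter_deg i (x : W) : wdeg W (iter i E x) = iter i E (wdeg W x) + (i%:R * d) *: iter i E x.
Proof.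
elim: i => [|i IH]; first by rewrite mul0r scale0r addr0.
rewrite !iterS (loc_deg hdeg) IH linearD /= [E (_ *: _)]linearZ /= -natr1.
lmod_ring K W.
Qed.

(** Moving one [E] past [a_(n)] either uses up one of the [i] powers that bring [x] into [S], or
    lowers the nilpotency order of [a]. *)
Lemma iter_act (S : W -> Prop) i j a n x : wsub S -> nil_order b j a ->
  S (iter i E x) -> S (iter (i + j) E (md n a x)).
Proof.
move=> hS; move: {2}(i + j)%N (leqnn (i + j)) => s.
have hl := ws_lin hS; have hI m y : S y -> S (iter m E y).
  by move=> Sy; elim: m => //= m; apply: (ws_act hS).
elim: s i j a n x => [|s IH] i j a n x.
  rewrite leqn0 addn_eq0 => /andP[/eqP -> /eqP ->] /= -> _.
  by rewrite md0l; exact: sub0 hl.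
case: j => [_ /= -> _|j le ha].
  by rewrite md0l iter_0; exact: sub0 hl.
case: i le => [_|i le] hx; first by apply/hI/(ws_act hS).
have [N hN] := loc_comm W q hb a.
rewrite addSn iterSr.
have -> : E (md n a x) = md n a (E x)
    + \sum_(l < N) zbinom K q l *: md (q + n - l%:Z) (vprod l%:Z b a) x.
  by rewrite -hN addrC subrK.
rewrite iterDl; apply: (subD hl).
  by apply: IH => //; rewrite -iterSr.
rewrite iter_sum; apply: (sub_sum hl) => l _; rewrite iterZ; apply: (subZ hl).
have := IH i.+1 j _ (q + n - l%:Z) x _ (ha l) hx.
by rewrite addSn addnS; apply; lia.
Qed.

Lemma saturation_sub S : wsub S -> wsub (saturation S).
Proof.
move=> hS; have hl := ws_lin hS; split=> [|n a x [i h]|x [i h]|x [i h]].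
- split=> [|c x y [i hx] [j hy]]; first by exists 0%N; exact: sub0 hl.
  exists (i + j)%N; rewrite iter_lin; apply: hl.2.
    by rewrite addnC iterD; elim: j {hy} => //= j; apply: (ws_act hS).
  by rewrite iterD; elim: i {hx} => //= i; apply: (ws_act hS).
- by have [j hj] := hnil a; exists (i + j)%N; apply: iter_act.
- by exists i; rewrite iter_par; apply: (ws_par hS).
- exists i; have := ws_deg hS h; rewrite iter_deg => h2.
  by apply: (subDr hl (subZ hl (i%:R * d) h)); rewrite addrC.
Qed.

Lemma saturation_sat (S : W -> Prop) x : saturation S (E x) -> saturation S x.
Proof. by move=> [i h]; exists i.+1; rewrite iterSr. Qed.

Lemma iter_inj_of (x : W) i : (forall y, E y = 0 -> y = 0) -> iter i E x = 0 -> x = 0.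
Proof. by move=> inj; elim: i => //= i IH /inj. Qed.

End Saturation.

(** * The map from a module to its twisted localization *)

Section LocTheory.
Variables (K : numFieldType) (L : vsa K) (W : wmod L).
Variables (b : L) (q : int) (d mu : K).
Hypothesis hb : homog false b.
Hypothesis hdeg : vdeg b = (d + (q + 1)%:~R) *: b.
Hypothesis hnil : forall a, exists i, nil_order b i a.

Local Notation E := (md (W := W) q b).
Local Notation Q := (@loc K L W b q d mu hb hdeg hnil).
Local Notation EQ := (md (W := Q) q b).
Local Notation cl := (@loc_cl K L W b q d mu hb hdeg hnil).
Local Notation locA := (@locA K L W b q).
Local Notation locB := (@locB K L W b q mu).
Local Notation delta := (@diff K L W b q).
Local Notation pol := (@pol K L W b q).
Local Notation mulw := (@mulm K L W).
Local Notation seqop := (@seqE K L W b q).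
Implicit Types F G : seqU W.

Let hA := locA_subspace W b q.

Lemma loc_cl0 : cl 0 = 0.
Proof. by apply/loc_cl_eq0; [exact: sub0 hA | exact: sub0 (locB_subspace W b q mu)]. Qed.
Lemma loc_clZ c F : locA F -> cl (c *: F) = c *: cl F.
Proof.
move=> AF; rewrite -[c *: F]addr0 loc_clP ?loc_cl0 ?addr0 //; exact: sub0 hA.
Qed.

Definition pows (w : W) : seqU W := fun m => iter m E w.

Lemma pows_diff w : delta (pows w) = 0.
Proof. by apply/funext => m; rewrite /diff /pows iterS subrr. Qed.

Lemma pows_pol w : pol 1 0 (pows w).
Proof. by rewrite /= pows_diff. Qed.

Lemma pows_A w : locA (pows w).
Proof. by exists 1%N, 0%N; apply: pows_pol. Qed.

(** The class of the constant polynomial [w]. In general it is not a module map: modes on the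
    localization are conjugated by [E^mu]. *)
Definition loc_in w : Q := cl (pows w).

Lemma loc_inP c u v : loc_in (c *: u + v) = c *: loc_in u + loc_in v.
Proof.
rewrite /loc_in -loc_clP; try exact: pows_A.
by congr (cl _); apply/funext => m; rewrite /pows iter_lin.
Qed.
Lemma loc_in0 : loc_in 0 = 0.
Proof.
apply/loc_cl_eq0; first exact: pows_A.
by apply: locB_ev0; exists 0%N => m _; rewrite /pows iter_0.
Qed.
Lemma loc_inZ c u : loc_in (c *: u) = c *: loc_in u.
Proof. by have := loc_inP c u 0; rewrite loc_in0 !addr0. Qed.

Lemma cl_E F : locA F -> EQ (cl F) = cl (seqop F).
Proof. exact: loc_actE. Qed.

Lemma cl_mulm F : locA F -> cl (mulw F) = mu *: cl F.
Proof.
move=> AF; apply/eqP; rewrite -subr_eq0; apply/eqP.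
have AmF := locA_mulm AF.
have -> : cl (mulw F) - mu *: cl F = cl ((- mu) *: F + mulw F).
  by rewrite loc_clP // scaleNr addrC.
apply/loc_cl_eq0; first exact: hA.2.
exists F => //; exists 0%N => m _.
have -> : (- mu *: F + mulw F) m = (- mu) *: F m + m%:R *: F m by [].
lmod_ring K W.
Qed.

Lemma cl_ev F G : locA F -> locA G -> ev (fun m => F m = G m) -> cl F = cl G.
Proof.
move=> AF AG [m0 h]; apply/eqP; rewrite -subr_eq0; apply/eqP.
have -> : cl F - cl G = cl ((- 1) *: G + F) by rewrite loc_clP // scaleN1r addrC.
apply/loc_cl_eq0; first exact: hA.2.
apply: locB_ev0; exists m0 => m /h e.
have -> : (-1 *: G + F) m = (-1) *: G m + F m by [].
by rewrite e scaleN1r addNr.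
Qed.

Lemma loc_in_E w : loc_in (E w) = EQ (loc_in w).
Proof.
rewrite /loc_in cl_E; last exact: pows_A.
by congr (cl _); apply/funext => m; rewrite /pows /seqE -iterS iterSr.
Qed.
Lemma loc_in_par w : sv_par Q (loc_in w) = loc_in (sv_par W w).
Proof.
rewrite /loc_in loc_parE; last exact: pows_A.
by congr (cl _); apply/funext => m; rewrite /pows /seq_par iter_par.
Qed.
Lemma loc_in_deg w : wdeg Q (loc_in w) = loc_in (wdeg W w).
Proof.
rewrite /loc_in loc_degE; last exact: pows_A.
congr (cl _); apply/funext => m; rewrite /pows /seq_deg (iter_deg hdeg).
by rewrite addrK.
Qed.

Lemma pol_ev i m0 F G : (forall m, (m0 <= m)%N -> F m = G m) -> pol i m0 F -> pol i m0 G.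
Proof.
elim: i F G => [|i IH] F G h /= hF; first by move=> m lm; rewrite -h // hF.
by apply: IH hF => m lm; rewrite /diff !h // leqW.
Qed.

(** Division by [E] is reduced to the difference: if [diff G = E H] for large indices, then
    [G (m+1) = E (G m + H m)]. *)
Lemma E_surj i m0 G : pol i m0 G -> exists2 G', locA G' & ev (fun m => G m = E (G' m)).
Proof.
elim: i G => [|i IH] G hG.
  exists 0; first exact: sub0 hA.
  by exists m0 => m lm; rewrite hG // [RHS]linear0.
have [H' [j [m1 hH]] [m2 eH]] := IH _ hG.
pose F : seqU W := G + H'.
pose G' : seqU W := fun m => F m.-1.
have AF : locA F.
  by apply: (subD hA); [exists i.+1, m0 | exists j, m1].
exists G'; last first.
  exists m2.+1 => -[//|m]; rewrite ltnS => lm; rewrite /G' /=.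
  have -> : F m = G m + H' m by [].
  by rewrite linearD /= -eH // /diff addrC subrK.
have [l [m3 hF]] := AF; exists l, m3.+1; rewrite {}/G'.
clearbody F; elim: l F hF {AF} => [|l IHl] F hF; first by case=> // m lm; exact: hF.
by rewrite /=; apply: (pol_ev (F := fun m => delta F m.-1)); [case | exact: IHl].
Qed.

Hypothesis Einj : forall w, E w = 0 -> w = 0.

(** For a polynomial of degree [r], comparing leading coefficients in this equation gives
    [c + 1 + r = 0], which is impossible. Here the equation is differenced: [diff G] satisfies it
    with [c + 1], so it vanishes by induction on the degree, and then [G] does. *)
Lemma twisted_zero i m0 G (c : nat) : pol i m0 G ->
  (forall m, (m0 <= m)%N -> c.+1%:R *: E (G m) = - (m%:R + c.+1%:R - mu) *: delta G m) ->
  forall m, (m0 <= m)%N -> G m = 0.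
Proof.
elim: i G c => [|i IH] G c // hG e m lm; apply/Einj.
have G1 : forall m, (m0 <= m)%N -> delta G m = 0.
  apply: (IH _ c.+1 hG) => n ln.
  have e1 := e _ (leqW ln); have e2 := congr1 E (e _ ln).
  rewrite !linearZ /= in e2.
  have x1 : G n.+1 = delta G n + E (G n) by rewrite /diff subrK.
  have x2 : delta G n.+1 = delta (delta G) n + E (delta G n) by rewrite [delta (delta G) n]/diff subrK.
  move: e1; rewrite x1 x2 [E (_ + E (G n))]linearD /= -!natr1 in e2 *.
  move: (E (delta G n)) (E (E (G n))) (delta (delta G) n) e2 => X Y Z e2 e3.
  apply: (eq_of_sub2 e3 e2); lmod_ring K W.
have := e _ lm; rewrite G1 // scaler0 => /eqP.
by rewrite scaler_eq0 pnatr_eq0 => /eqP.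
Qed.

(** A nonzero constant is not divisible by [m - mu]: differencing [F m = (m - mu) G m] gives the
    equation of [twisted_zero] with [c = 0]. *)
Lemma locB_const m0 F : pol 1 m0 F -> locB F -> ev (fun m => F m = 0).
Proof.
move=> hF [G [i [m1 hG]] [m2 e]].
pose M := maxn m0 (maxn m1 m2).
have G0 : forall m, (M <= m)%N -> G m = 0.
  apply: (@twisted_zero i M G 0); first by apply: pol_leq hG => //; rewrite /M; lia.
  move=> m lm; have := hF m _; rewrite /diff => /(_ _).
  rewrite e ?e; try by rewrite /M in lm; lia.
  rewrite linearZ /= => h.
  have {}h : (m.+1%:R - mu) *: G m.+1 - (m%:R - mu) *: E (G m) = 0.
    by apply: h; rewrite /M in lm; lia.
  rewrite -/(diff b q G m) in h *.
  apply/eqP; rewrite -subr_eq0; apply/eqP; rewrite -[RHS]h -natr1 /diff.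
  lmod_ring K W.
exists M => m lm; rewrite e ?G0 ?scaler0 //; rewrite /M in lm; lia.
Qed.

Lemma loc_in_inj w : loc_in w = 0 -> w = 0.
Proof.
move=> /(loc_cl_eq0 mu hb hdeg hnil (pows_A w)) /(locB_const (pows_pol w)) [m0 h].
exact: (iter_inj_of Einj (h m0 (leqnn _))).
Qed.

Lemma loc_Einj (x : Q) : EQ x = 0 -> x = 0.
Proof.
elim/loc_ind: x => F AF; rewrite -/(cl F) cl_E //.
move=> /(loc_cl_eq0 mu hb hdeg hnil (locA_E AF)) [G [i [m0 hG]] [m1 e]].
have [G' AG' [m2 e']] := E_surj hG.
apply/loc_cl_eq0 => //; exists G' => //; exists (maxn m1 m2) => m.
rewrite geq_max => /andP[l1 l2]; apply/eqP; rewrite -subr_eq0; apply/eqP/Einj.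
by rewrite linearB linearZ /= -e' // -e // subrr.
Qed.

(** On polynomials, and up to one factor [E], this is [c p(m) - (m - nu) (p(m+1) - p(m))]. When [c]
    is the degree of [p] the leading terms cancel; at [nu = mu] the class is [c] times [E] of the
    class of [F]. Applying [E] thus allows a representative of smaller degree. *)
Definition twist (c nu : K) F : seqU W :=
  c *: seqop F - (mulw (delta F) - nu *: delta F).

Lemma twistE c nu F m : twist c nu F m = c *: E (F m) - (m%:R - nu) *: delta F m.
Proof.
rewrite /twist.
have -> (X Y Z : seqU W) : (c *: X - (Y - nu *: Z)) m = c *: X m - (Y m - nu *: Z m) by [].
by rewrite /mulm scalerBl.
Qed.

Lemma diff_twist c nu F : delta (twist c nu F) = twist (c - 1) (nu - 1) (delta F).
Proof.
apply/funext => m; rewrite {1}/diff !twistE /diff -natr1.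
have EB u v : E (u - v) = E u - E v by exact: linearB.
have EZ e u : E (e *: u) = e *: E u by exact: linearZ.
rewrite !(EB, EZ); lmod_ring K W.
Qed.

Lemma pol_twist n nu m0 F : pol n.+2 m0 F -> pol n.+1 m0 (twist n.+1%:R nu F).
Proof.
elim: n nu F => [|n IH] nu F h.
  rewrite [pol 1 _ _]/(pol 0 m0 (delta _)) diff_twist => m lm.
  by rewrite twistE subrr scale0r h // scaler0 subrr.
rewrite [pol n.+2 _ _]/(pol n.+1 m0 (delta _)) diff_twist -natr1 addrK.
exact: IH.
Qed.

Lemma twist_A c nu F : locA F -> locA (twist c nu F).
Proof.
move=> AF; have AD : locA (delta F).
  by have [i [m0 h]] := AF; exists i, m0; apply: (polS h).
apply: (subB hA); first exact/(subZ hA)/locA_E.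
by apply: (subB hA); [exact: locA_mulm | exact: (subZ hA)].
Qed.

Lemma cl_twist c F : locA F -> cl (twist c mu F) = c *: EQ (cl F).
Proof.
move=> AF; have AD : locA (delta F).
  by have [i [m0 h]] := AF; exists i, m0; apply: (polS h).
have -> : twist c mu F = c *: seqop F + (-1 *: mulw (delta F) + mu *: delta F).
  rewrite /twist scaleN1r; lmod_ring K (seqU W).
have AmD := locA_mulm AD; have AE := locA_E AF.
rewrite loc_clP //; last by apply: hA.2 => //; apply: (subZ hA).
rewrite loc_clP //; last exact: (subZ hA).
by rewrite cl_mulm // loc_clZ // scaleN1r addNr addr0 -cl_E.
Qed.

(** Each [twist] spends one application of [E] to lower the degree of a representative, until it is
    constant. *)
Lemma loc_repr (x : Q) : exists j w, iter j EQ x = loc_in w.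
Proof.
elim/loc_ind: x => F [i [m0 h]]; rewrite -/(cl F).
have AF : locA F by exists i, m0.
elim: i F h AF => [|[|i] IH] F h AF.
- exists 0%N, 0; rewrite loc_in0; apply/loc_cl_eq0 => //.
  by apply: locB_ev0; exists m0.
- have e n : iter n EQ (cl F) = cl (fun m => iter n E (F m)) /\
      locA (fun m => iter n E (F m)).
    elim: n => [|n [IHn An]]; first by [].
    rewrite iterS IHn; split; last exact: (locA_E An).
    by rewrite [LHS](cl_E An).
  (* From [m0] on [F m = E^(m - m0) (F m0)], so [E^m0] clears the denominator. *)
  exists m0, (F m0); rewrite (e m0).1; apply: cl_ev; first exact: (e m0).2.
    exact: pows_A.
  exists m0 => m lm; rewrite /pows -(subnK lm) addnC iterD; congr (iter m0 E _).
  elim: (m - m0)%N => [|n IHn]; first by rewrite addn0.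
  rewrite addnS iterS -IHn; apply/eqP; rewrite -subr_eq0; apply/eqP.
  by apply: (h (m0 + n)%N); rewrite leq_addr.
- have nz : i.+1%:R != 0 :> K by rewrite pnatr_eq0.
  have hs := pol_subspace W b q i.+1 m0.
  have [||j [w e]] := IH (i.+1%:R^-1 *: twist i.+1%:R mu F).
  + exact/(subZ hs)/pol_twist.
  + by apply/(subZ hA)/twist_A.
  exists j.+1, w; rewrite iterSr -e; congr (iter _ _ _).
  rewrite loc_clZ; last exact: twist_A.
  by rewrite cl_twist // scalerA mulVf // scale1r.
Qed.

Lemma loc_Esurj (x : Q) : exists y, EQ y = x.
Proof.
elim/loc_ind: x => F [i [m0 h]]; have [G AG [m1 e]] := E_surj h.
exists (cl G); rewrite cl_E //; apply: cl_ev; [exact: locA_E | by exists i, m0 |].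
by exists m1 => m lm; rewrite e.
Qed.

(* at [mu = 0] the class of a polynomial sequence is its value at [0] *)
Lemma loc_eval0 i F : mu = 0 -> pol i.+1 0 F -> cl F = loc_in (F 0%N).
Proof.
move=> mu0; elim: i F => [|i IH] F h.
  congr (cl _); apply/funext; elim=> // m IHm; rewrite /pows iterS -/(pows _ m) -IHm.
  by apply/eqP; rewrite -subr_eq0; apply/eqP; apply: h.
have AF : locA F by exists i.+2, 0%N.
have nz : i.+1%:R != 0 :> K by rewrite pnatr_eq0.
apply/eqP; rewrite -subr_eq0; apply/eqP/loc_Einj.
rewrite mdBr -loc_in_E; apply: (scalerI nz).
rewrite scaler0 scalerBr -cl_twist // -loc_inZ (IH _ (pol_twist _ h)) twistE.
have -> : (0%:R - mu) = 0 by rewrite mu0 subr0.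
by rewrite scale0r subr0 subrr.
Qed.

Lemma loc_in_hom0 n a w : mu = 0 -> md n a (loc_in w) = loc_in (md n a w).
Proof.
move=> mu0; have [i hi] := hnil a.
rewrite [LHS]loc_actE; last exact: pows_A.
have h : pol i.+1 0 (seq_act n a (pows w)).
  by have := pol_act hb n hi (pows_pol w); rewrite addn1.
exact: loc_eval0 mu0 h.
Qed.

(** * Preimages of saturated submodules of the localization *)

Section Hat.
Variable S : Q -> Prop.
Hypotheses (hS : wsub S) (sat : forall x, S (EQ x) -> S x).

Let hat (w : W) := S (loc_in w).

Lemma hat_subspace : subspace hat.
Proof.
split=> [|c u v hu hv]; first by rewrite /hat loc_in0; exact: sub0 (ws_lin hS).
by rewrite /hat loc_inP; apply: (ws_lin hS).2.
Qed.

Lemma hat_E w : hat w -> hat (E w).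
Proof. by rewrite /hat loc_in_E; apply: (ws_act hS). Qed.

(** Newton coefficients at 0: the [j]-th iterate of [diff] at 0 is [E^j] applied to the [j]-th
    forward difference of [p]. By Newton's formula they determine [p mu] up to powers of [E], and
    saturation removes these. *)
Fixpoint taylor (i : nat) F : Prop :=
  hat (F 0%N) /\ if i is i'.+1 then taylor i' (delta F) else True.

Lemma taylor_twist i c nu F : taylor i.+1 F -> taylor i (twist c nu F).
Proof.
have hh := hat_subspace.
elim: i c nu F => [|i IH] c nu F [h0 [h1 h2]].
  split=> //; rewrite twistE sub0r scaleNr opprK.
  by apply: (subD hh); apply: (subZ hh) => //; apply: hat_E.
split; last by rewrite diff_twist; apply: IH.
rewrite twistE sub0r scaleNr opprK.
by apply: (subD hh); apply: (subZ hh) => //; apply: hat_E.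
Qed.

Lemma taylor_in i F : pol i.+1 0 F -> taylor i F -> S (cl F).
Proof.
elim: i F => [|i IH] F h t.
  have -> : F = pows (F 0%N).
    apply/funext; elim=> // m IHm; rewrite /pows iterS -/(pows _ m) -IHm.
    by apply/eqP; rewrite -subr_eq0; apply/eqP; apply: h.
  by case: t.
have nz : i.+1%:R != 0 :> K by rewrite pnatr_eq0.
apply: sat; apply: (subZI (ws_lin hS) nz); rewrite -cl_twist; last by exists i.+2, 0%N.
by apply: IH; [exact: pol_twist | exact: taylor_twist].
Qed.

Lemma taylor_subspace i : subspace (taylor i).
Proof.
have hh := hat_subspace.
elim: i => [|i IH]; split=> [|c F G hF hG].
- by split=> //; exact: sub0 hh.
- by case: hF => hF _; case: hG => hG _; split=> //; apply: hh.2.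
- by split; [exact: sub0 hh | rewrite diff0; exact: sub0 IH].
- case: hF => hF hF'; case: hG => hG hG'.
  by split; [apply: hh.2 | rewrite diffP; apply: IH.2].
Qed.

Lemma taylor_act i a : nil_order b i a -> (forall j a n w, (j <= i)%N ->
    nil_order b j a -> hat w -> hat (md n a w)) ->
  forall l n w, hat w -> taylor l (seq_act n a (pows w)).
Proof.
elim: i a => [|i IH] a ha hi l n w hw; have ht := taylor_subspace.
  have -> : seq_act n a (pows w) = 0 by apply/funext => m; rewrite /seq_act ha md0l.
  exact: sub0 (ht l).
case: l => [|l]; first by split=> //; apply: hi ha hw.
split; first by apply: hi ha hw.
have [N hN] := loc_comm W q hb a.
rewrite (diff_act n _ hN) pows_diff.
apply: (subB (ht l)).
  have -> : seq_act n a 0 = 0 :> seqU W by apply/funext => m; rewrite /seq_act linear0.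
  exact: sub0 (ht l).
apply: (sub_sum (ht l)) => j _; apply: (subZ (ht l)); apply: IH => //.
by move=> j' a' n' w' lj; apply: hi; rewrite ltnW.
Qed.

(** The sequence [R] is [a_(n) E^m w - E^m a_(n) w]. It vanishes at 0, and its other Newton
    coefficients involve only vectors [b_(j) a] of smaller order, so by induction its class is in
    [S]. The class of [a_(n) E^m w] is [a_(n) (loc_in w)], also in [S]; subtracting leaves
    [loc_in (a_(n) w)]. *)
Lemma hat_act i a n w : nil_order b i a -> hat w -> hat (md n a w).
Proof.
elim: i {-2}i (leqnn i) a n w => [|s IH] i.
  rewrite leqn0 => /eqP -> a n w /= -> _; rewrite md0l; exact: sub0 hat_subspace.
rewrite leq_eqVlt => /orP[/eqP -> {i}|]; last by rewrite ltnS; apply: IH.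
move=> a n w ha hw; have ht := taylor_subspace.
pose R : seqU W := seq_act n a (pows w) - pows (md n a w).
have hP := pol_subspace W b q s.+2 0.
have pG : pol s.+2 0 (seq_act n a (pows w)).
  by have := pol_act hb n ha (pows_pol w); rewrite addn1.
have pR : pol s.+2 0 R.
  by apply: (subB hP) => //; apply: pol_leq (pows_pol _).
have tR : taylor s.+1 R.
  split.
    have -> : R 0%N = 0 by rewrite [LHS]subrr.
    exact: sub0 hat_subspace.
  have -> : delta R = delta (seq_act n a (pows w)).
    rewrite /R addrC -scaleN1r diffP pows_diff.
    by rewrite scaler0 add0r.
  have [N hN] := loc_comm W q hb a.
  rewrite (diff_act n _ hN) pows_diff; apply: (subB (ht s)).
    have -> : seq_act n a 0 = 0 :> seqU W by apply/funext => m; rewrite /seq_act linear0.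
    exact: sub0 (ht s).
  apply: (sub_sum (ht s)) => j _; apply: (subZ (ht s)); apply: taylor_act => //.
  by move=> j' a' n' w' lj; apply: IH.
have SR := taylor_in pR tR.
have SG : S (cl (seq_act n a (pows w))).
  by rewrite -loc_actE; [exact: (ws_act hS) | exact: pows_A].
rewrite /hat /loc_in.
have e : pows (md n a w) = (-1) *: R + seq_act n a (pows w).
  by rewrite /R scaleN1r opprB subrK.
rewrite e loc_clP; first exact: (ws_lin hS).2.
  by exists s.+2, 0%N.
by exists s.+2, 0%N.
Qed.

Lemma hat_sub : wsub hat.
Proof.
split=> [|n a w hw|w hw|w hw]; first exact: hat_subspace.
- by have [i hi] := hnil a; apply: hat_act hi hw.
- by rewrite /hat -loc_in_par; apply: (ws_par hS).
- by rewrite /hat -loc_in_deg; apply: (ws_deg hS).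
Qed.
End Hat.

End LocTheory.

(** * Commutation relations of osp(1|2) *)

Definition osp_code (a : osp) : nat :=
  match a with e_ => 0 | f_ => 1 | h_ => 2 | x_ => 3 | y_ => 4 end%N.
Definition osp_decode (n : nat) : osp :=
  match n with 0 => e_ | 1 => f_ | 2 => h_ | 3 => x_ | _ => y_ end%N.
Lemma osp_codeK : cancel osp_code osp_decode. Proof. by case. Qed.
HB.instance Definition _ := Equality.copy osp (can_type osp_codeK).

Definition osp_weight (a : osp) : int :=
  match a with e_ => 2 | f_ => - 2%:Z | h_ => 0 | x_ => 1 | y_ => - 1%:Z end.

Section Relations.
Variables (K : numFieldType) (k : K) (L : vsa K) (J : osp -> L).
Hypothesis hJ : osp_currents k J.
Variable W : wmod L.
Local Notation op a n := (md (W := W) n (J a)).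
Implicit Types (w : W) (m n : int).

Lemma current_swap a b m n w : op a m (op b n w) =
  (osp_bracket a b).1%:~R *: op (osp_bracket a b).2 (m + n) w
  + (if m + n == 0 then m%:~R * (osp_form a b)%:~R * k else 0) *: w
  + (-1) ^+ (osp_odd a && osp_odd b) *: op b n (op a m w).
Proof. by rewrite -(current_comm hJ) subrK. Qed.

Local Ltac swap_tac :=
  rewrite current_swap /= ?(mulr0z, mulr0, mul0r, if_same, expr0, expr1); lmod_ring K W.

Lemma swap_xx m n w : op x_ m (op x_ n w) = 2 *: op e_ (m + n) w - op x_ n (op x_ m w).
Proof. swap_tac. Qed.
Lemma swap_xy m n w : m + n != 0 ->
  op x_ m (op y_ n w) = op h_ (m + n) w - op y_ n (op x_ m w).
Proof. by move=> /negPf ne; rewrite current_swap /= ne; lmod_ring K W. Qed.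
Lemma swap_x0y0 w : op x_ 0 (op y_ 0 w) = op h_ 0 w - op y_ 0 (op x_ 0 w).
Proof. by rewrite current_swap addr0 /= !mul0r; lmod_ring K W. Qed.
Lemma swap_yy m n w : op y_ m (op y_ n w) = - (2 *: op f_ (m + n) w) - op y_ n (op y_ m w).
Proof. swap_tac. Qed.
Lemma swap_ye m n w : op y_ m (op e_ n w) = op x_ (m + n) w + op e_ n (op y_ m w).
Proof. swap_tac. Qed.
Lemma swap_xe m n w : op x_ m (op e_ n w) = op e_ n (op x_ m w).
Proof. swap_tac. Qed.
Lemma swap_f1e w : op f_ 1 (op e_ (-1) w) = k *: w - op h_ 0 w + op e_ (-1) (op f_ 1 w).
Proof.
rewrite current_swap /=; have -> : (1 - 1 : int) = 0 by [].
by rewrite expr0; lmod_ring K W.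
Qed.
Lemma swap_fx m n w : op f_ m (op x_ n w) = op x_ n (op f_ m w) - op y_ (m + n) w.
Proof. swap_tac. Qed.
Lemma swap_fy m n w : op f_ m (op y_ n w) = op y_ n (op f_ m w).
Proof. swap_tac. Qed.
Lemma swap_f0 a n w : op f_ 0 (op a n w) =
  (osp_bracket f_ a).1%:~R *: op (osp_bracket f_ a).2 n w + op a n (op f_ 0 w).
Proof. by rewrite current_swap !mul0r if_same add0r; lmod_ring K W. Qed.

Lemma weight_act a n w :
  op h_ 0 (op a n w) = (osp_weight a)%:~R *: op a n w + op a n (op h_ 0 w).
Proof.
rewrite current_swap !mul0r if_same scale0r addr0 add0r expr0 scale1r.
by case: a => //=; rewrite !scale0r.
Qed.

Lemma two_neq0 : 2 != 0 :> K. Proof. by rewrite pnatr_eq0. Qed.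

Lemma e_from_x w : (forall n : nat, op x_ n w = 0) -> forall n : nat, op e_ n w = 0.
Proof.
move=> h n; have h0 : op x_ 0 w = 0 := h 0%N.
have := swap_xx 0 n w; rewrite add0r h0 h [op x_ 0 0]linear0 [op x_ _ 0]linear0 subr0.
by move=> /esym/eqP; rewrite scaler_eq0 (negPf two_neq0) => /eqP.
Qed.

(** The remaining positive modes, those of [e], of [h], and [f(n)] with [n > 1], are brackets of the
    listed modes of [x] and [y]. *)
Definition singular w : Prop :=
  [/\ forall n : nat, op x_ n w = 0, forall n : nat, op y_ n.+1 w = 0 & op f_ 1 w = 0].

Lemma singular_pos w : singular w -> forall a (n : nat), op a n.+1 w = 0.
Proof.
move=> [hx hy hf] a n; have he := e_from_x hx.
have h0 : op x_ 0 w = 0 := hx 0%N; have h1 : op y_ 1 w = 0 := hy 0%N.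
case: a => //.
- case: n => [//|n]; have := swap_yy 1 n.+1 w.
  rewrite h1 hy [op y_ 1 0]linear0 [op y_ _ 0]linear0 subr0 => /esym/eqP.
  by rewrite oppr_eq0 scaler_eq0 (negPf two_neq0) => /eqP.
- have := @swap_xy 0 n.+1 w isT; rewrite h0 hy add0r [op y_ _ 0]linear0 subr0 => <-.
  exact: linear0.
Qed.

Definition vacuum_current w : Prop :=
  (forall n : nat, op x_ n w = 0) /\ (forall n : nat, op y_ n w = 0).

Lemma vacuum_current_all w : vacuum_current w -> forall a (n : nat), op a n w = 0.
Proof.
move=> [hx hy] a n; have he := e_from_x hx.
have h0 : op x_ 0 w = 0 := hx 0%N; have h1 : op y_ 0 w = 0 := hy 0%N.
case: a => //.
- have := swap_yy 0 n w.
  rewrite h1 hy add0r [op y_ 0 0]linear0 [op y_ _ 0]linear0 subr0 => /esym/eqP.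
  by rewrite oppr_eq0 scaler_eq0 (negPf two_neq0) => /eqP.
- case: n => [|n].
    have := swap_x0y0 w; rewrite h0 h1 [op y_ _ 0]linear0 subr0 => <-; exact: linear0.
  have := @swap_xy 0 n.+1 w isT; rewrite h0 hy add0r [op y_ _ 0]linear0 subr0 => <-.
  exact: linear0.
Qed.

Lemma f0_yy w : op f_ 0 w = - op y_ 0 (op y_ 0 w).
Proof.
have h := swap_yy 0 0 w; rewrite addr0 in h; apply: (scalerI two_neq0).
by apply: (eq_of_sub1 h); lmod_ring K W.
Qed.

Lemma f0_iter i w : iter i (op f_ 0) w = (-1) ^+ i *: iter i.*2 (op y_ 0) w.
Proof.
elim: i => [|i IH]; first by rewrite scale1r.
by rewrite iterS IH doubleS !iterS linearZ /= f0_yy exprS mulN1r scaleNr scalerN.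
Qed.

(** The modes [e(-1)], [f(1)] and their bracket [h(0) - k] span a copy of sl2, in which [w] is
    annihilated by [f(1)]. *)
Lemma singular_f1_pow w t (m : nat) : op f_ 1 w = 0 -> op h_ 0 w = t *: w ->
  op f_ 1 (iter m.+1 (op e_ (-1)) w) = (m.+1%:R * (k - t - m%:R)) *: iter m (op e_ (-1)) w.
Proof.
move=> hf ht.
have hh (n : nat) : op h_ 0 (iter n (op e_ (-1)) w) = (t + 2 * n%:R) *: iter n (op e_ (-1)) w.
  elim: n => [|n IH]; first by rewrite mulr0 addr0 [LHS]ht.
  rewrite !iterS weight_act IH [op e_ _ (_ *: _)]linearZ /= -natr1; lmod_ring K W.
elim: m => [|m IH].
  rewrite iterS swap_f1e hf [op e_ _ 0]linear0 /= ht; lmod_ring K W.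
rewrite iterS swap_f1e IH [op e_ _ (_ *: _)]linearZ /= -iterS hh -!natr1.
lmod_ring K W.
Qed.

Lemma x_pow_e i n w : op x_ n (iter i (op e_ (-1)) w) = iter i (op e_ (-1)) (op x_ n w).
Proof. by elim: i => //= i IH; rewrite swap_xe IH. Qed.

Lemma y_pow_e (i : nat) n w : op y_ n (iter i.+1 (op e_ (-1)) w) =
  iter i.+1 (op e_ (-1)) (op y_ n w) + i.+1%:R *: iter i (op e_ (-1)) (op x_ (n - 1) w).
Proof.
elim: i => [|i IH]; first by rewrite /= swap_ye scale1r addrC.
rewrite iterS swap_ye x_pow_e IH [op e_ _ (_ + _)]linearD /= [op e_ _ (_ *: _)]linearZ /=.
by rewrite -natr1; lmod_ring K W.
Qed.

End Relations.

(** * Highest weight modules *)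

(* the letter [(a, n)] stands for the mode [a(-n-1)] *)
Definition word := seq (osp * nat).
Definition word_degree (wd : word) : nat := \sum_(x <- wd) x.2.+1.
Definition word_weight (wd : word) : int := \sum_(x <- wd) osp_weight x.1.

Lemma word_degree_cons x wd : word_degree (x :: wd) = (x.2.+1 + word_degree wd)%N.
Proof. exact: big_cons. Qed.
Lemma word_weight_cons x wd : word_weight (x :: wd) = osp_weight x.1 + word_weight wd.
Proof. exact: big_cons. Qed.

Lemma word_weight_le wd : word_weight wd <= (2 * word_degree wd)%N%:Z.
Proof.
elim: wd => [|[a n] wd IH]; first by rewrite /word_weight /word_degree !big_nil.
by rewrite word_weight_cons word_degree_cons; case: a => /=; lia.
Qed.

Lemma word_degree0 wd : word_degree wd = 0%N -> wd = [::].
Proof. by case: wd => // x wd; rewrite word_degree_cons. Qed.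

Section Monomials.
Variables (K : numFieldType) (k : K) (L : vsa K) (J : osp -> L).
Hypothesis hJ : osp_currents k J.
Hypothesis hgen : generates J.
Variable W : wmod L.
Local Notation op a n := (md (W := W) n (J a)).
Implicit Types (w : W) (m n : int).

Fixpoint mono (wd : word) w : W :=
  if wd is x :: wd' then op x.1 (- x.2.+1%:Z) (mono wd' w) else w.

Lemma mono_lin wd c u v : mono wd (c *: u + v) = c *: mono wd u + mono wd v.
Proof. by elim: wd => //= x wd ->; rewrite linearP. Qed.
Lemma mono_0 wd : mono wd 0 = 0.
Proof. by elim: wd => //= x wd ->; rewrite linear0. Qed.
Lemma mono_Z wd c u : mono wd (c *: u) = c *: mono wd u.
Proof. by have := mono_lin wd c u 0; rewrite mono_0 !addr0. Qed.
Lemma mono_sum wd (N : nat) (F : 'I_N -> W) :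
  mono wd (\sum_(i < N) F i) = \sum_(i < N) mono wd (F i).
Proof.
elim/big_rec2: _ => [|i x y _ <-]; first exact: mono_0.
by rewrite -[F i]scale1r mono_lin !scale1r.
Qed.

Lemma mono_par wd w : exists p : bool, sv_par W (mono wd w) = (-1) ^+ p *: mono wd (sv_par W w).
Proof.
elim: wd => [|x wd [p IH]] /=; first by exists false; rewrite scale1r.
exists (osp_odd x.1 (+) p); rewrite (current_par hJ) IH linearZ /= scalerA.
by rewrite signr_addb.
Qed.

Lemma mono_deg wd w d : wdeg W w = d *: w ->
  wdeg W (mono wd w) = (d + (word_degree wd)%:R) *: mono wd w.
Proof.
move=> h; elim: wd => [|x wd IH] /=; first by rewrite /word_degree big_nil addr0.
rewrite (current_deg hJ) IH linearZ /= word_degree_cons natrD mulrNz.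
lmod_ring K W.
Qed.

Lemma mono_weight wd w t : op h_ 0 w = t *: w ->
  op h_ 0 (mono wd w) = (t + (word_weight wd)%:~R) *: mono wd w.
Proof.
move=> h; elim: wd => [|x wd IH] /=; first by rewrite /word_weight big_nil addr0.
rewrite (weight_act hJ) IH linearZ /= word_weight_cons intrD.
lmod_ring K W.
Qed.

Definition mspan (T : W -> Prop) w : Prop :=
  exists s : seq (word * W), (forall x, x \in s -> T x.2) /\ w = \sum_(x <- s) mono x.1 x.2.

Section Span.
Variable T : W -> Prop.
Hypotheses (hT : subspace T) (hT0 : forall a w, T w -> T (op a 0 w)).
Hypothesis hTpos : forall a (n : nat) w, T w -> op a n.+1 w = 0.

Lemma mspan_mono wd w : T w -> mspan T (mono wd w).
Proof.
by move=> Tw; exists [:: (wd, w)]; rewrite big_seq1; split=> // x; rewrite inE => /eqP ->.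
Qed.

Lemma mspan_subspace : subspace (mspan T).
Proof.
split=> [|c u v [s [hs ->]] [r [hr ->]]]; first by exists [::]; rewrite big_nil.
exists ([seq (x.1, c *: x.2) | x <- s] ++ r); rewrite big_cat big_map /= scaler_sumr.
split=> [x|]; last by congr (_ + _); apply: eq_bigr => x _; rewrite mono_Z.
rewrite mem_cat => /orP[/mapP[y /hs Ty ->]|/hr] //=; exact: subZ.
Qed.

Lemma mspan_neg a (n : nat) w : mspan T w -> mspan T (op a (- n.+1%:Z) w).
Proof.
move=> [s [hs ->]]; rewrite linear_sum; apply: (sub_sum_seq mspan_subspace) => x xs _.
exact: (mspan_mono ((a, n) :: x.1) (hs x xs)).
Qed.

(** A nonnegative mode is commuted through the word until it reaches [T]. Words are not sorted, so a
    negative mode is simply prefixed. *)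
Lemma mspan_mode a n w : mspan T w -> mspan T (op a n w).
Proof.
have hS := mspan_subspace.
have key wd : forall a n t, T t -> mspan T (op a n (mono wd t)).
  elim: wd => [|[b m] wd IH] {}a {}n t Tt.
    case: n => [[|n]|n] /=; first exact: (mspan_mono [::] (hT0 _ _)).
      by rewrite hTpos //; exact: sub0 hS.
    by rewrite NegzE; exact: (mspan_mono [:: (a, n)] Tt).
  case: n => [n|n]; last by rewrite NegzE; apply/mspan_neg/mspan_mono.
  rewrite /= (current_swap hJ); apply: (subD hS); first apply: (subD hS).
  - by apply/(subZ hS)/IH.
  - by apply: (subZ hS); apply: mspan_mono.
  - by apply: (subZ hS); apply/mspan_neg/IH.
move=> [s [hs ->]]; rewrite linear_sum; apply: (sub_sum_seq hS) => x xs _.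
exact/key/hs.
Qed.

Hypothesis hTpar : forall w, T w -> T (sv_par W w).
Hypothesis hTdeg : exists d, forall w, T w -> wdeg W w = d *: w.

Lemma mspan_sub : wsub (mspan T).
Proof.
have hS := mspan_subspace.
split=> //.
- by move=> n a w; apply: (current_closed hJ hgen hS) => *; apply: mspan_mode.
- move=> w [s [hs ->]]; rewrite linear_sum; apply: (sub_sum_seq hS) => x xs _.
  have [p ->] := mono_par x.1 x.2; apply: (subZ hS).
  exact/mspan_mono/hTpar/hs.
- have [d hd] := hTdeg.
  move=> w [s [hs ->]]; rewrite linear_sum; apply: (sub_sum_seq hS) => x xs _.
  rewrite (mono_deg _ (hd _ (hs x xs))); apply: (subZ hS).
  exact/mspan_mono/hs.
Qed.
End Span.

(** Powers of [y(0)] alone span the top component, because [f(0) = - y(0)^2]. *)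
Definition top (v : W) (w : W) : Prop :=
  exists (n : nat) (c : 'I_n -> K), w = \sum_(i < n) c i *: iter i (op y_ 0) v.

Lemma top_pow v i : top v (iter i (op y_ 0) v).
Proof.
exists i.+1, (fun j => if j == ord_max then 1 else 0).
rewrite big_ord_recr /= eqxx scale1r big1 ?add0r // => j _.
by rewrite ifF ?scale0r //; apply/eqP => /(congr1 val) /= e; have := ltn_ord j; rewrite e ltnn.
Qed.

Lemma top_subspace v : subspace (top v).
Proof.
split=> [|c u w [n [a ->]] [m [b ->]]].
  by exists 0%N, (fun _ => 0); rewrite big_ord0.
pose ext (n : nat) (a : 'I_n -> K) (i : nat) : K := if insub i is Some j then a j else 0.
have extE (n' : nat) (a' : 'I_n' -> K) (N : nat) : (n' <= N)%N ->
    \sum_(i < n') a' i *: iter i (op y_ 0) v = \sum_(i < N) ext n' a' i *: iter i (op y_ 0) v.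
  move=> le; rewrite (@sum_truncate _ (fun i => ext n' a' i *: iter i (op y_ 0) v) n' N) //.
    by apply: eq_bigr => i _; rewrite /ext valK.
  by move=> j lj; rewrite /ext insubF ?scale0r // ltnNge lj.
exists (maxn n m), (fun i => c * ext n a i + ext m b i).
rewrite (extE n a (maxn n m)) ?leq_maxl // (extE m b (maxn n m)) ?leq_maxr //.
rewrite scaler_sumr -big_split; apply: eq_bigr => i _ /=.
by rewrite scalerDl scalerA.
Qed.

Lemma top_gen v (S : W -> Prop) : subspace S -> (forall i, S (iter i (op y_ 0) v)) ->
  forall w, top v w -> S w.
Proof.
move=> hS h w [n [c ->]]; apply: (sub_sum hS) => i _; exact: (subZ hS).
Qed.

Section HighestWeight.
Variables (v : W) (t d : K) (p : bool).
Hypotheses (hv : singular J v) (ht : op h_ 0 v = t *: v) (hd : wdeg W v = d *: v).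
Hypothesis hp : homog p v.

Lemma ypow_weight i : op h_ 0 (iter i (op y_ 0) v) = (t - i%:R) *: iter i (op y_ 0) v.
Proof.
elim: i => [|i IH]; first by rewrite subr0.
rewrite iterS (weight_act hJ) IH linearZ /= -natr1; lmod_ring K W.
Qed.

Lemma ypow_deg i : wdeg W (iter i (op y_ 0) v) = d *: iter i (op y_ 0) v.
Proof. by elim: i => //= i IH; rewrite (current_deg hJ) IH scale0r subr0 linearZ. Qed.

Lemma ypow_homog i : sv_par W (iter i (op y_ 0) v) = (-1) ^+ (odd i (+) p) *: iter i (op y_ 0) v.
Proof.
elim: i => [|i IH]; first exact: hp.
by rewrite iterS (current_par hJ) IH linearZ scalerA -signr_addb addbA.
Qed.

Lemma ypow_pos a (n : nat) i : op a n.+1 (iter i (op y_ 0) v) = 0.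
Proof.
elim: i a n => [|i IH] a n; first exact: (singular_pos hJ hv a n).
rewrite iterS (current_swap hJ) addr0 IH scaler0 add0r IH linear0 scaler0 addr0.
by rewrite scale0r.
Qed.

Fixpoint xcoef (i : nat) : K := if i is i'.+1 then (t - i%:R) - xcoef i' else t.

Lemma x_ypow i : op x_ 0 (iter i.+1 (op y_ 0) v) = xcoef i *: iter i (op y_ 0) v.
Proof.
have hx : op x_ 0 v = 0 by case: hv => /(_ 0%N).
elim: i => [|i IH].
  by rewrite /= (swap_x0y0 hJ) hx linear0 subr0.
rewrite iterS (swap_x0y0 hJ) IH ypow_weight linearZ /= -iterS; lmod_ring K W.
Qed.

(** Neither family vanishes at [t = -1]; this keeps every [y(0)^i v] nonzero and makes the top
    component irreducible. *)
Lemma xcoefE j : xcoef j.*2 = t - j%:R /\ xcoef j.*2.+1 = - j.+1%:R.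
Proof.
have step i : xcoef i.+1 = t - i.+1%:R - xcoef i by [].
elim: j => [|j [h1 h2]].
  by split; [rewrite subr0 | rewrite double0 step; rewrite /=; ring].
rewrite doubleS; have e : xcoef j.*2.+2 = t - j.+1%:R.
  by rewrite step h2 -!natr1 -mul2n natrM; ring.
by split=> //; rewrite step e -!natr1 -mul2n natrM; ring.
Qed.

Lemma top_x w : top v w -> top v (op x_ 0 w).
Proof.
have hs := top_subspace v.
apply: (top_gen (S := fun w => top v (op x_ 0 w))); first exact: subspace_ker.
case=> [|i]; last by rewrite x_ypow; apply/(subZ hs)/top_pow.
by case: hv => /(_ 0%N) e _ _; rewrite [op x_ 0 _]e; exact: sub0 hs.
Qed.

Lemma top_y w : top v w -> top v (op y_ 0 w).
Proof.
have hs := top_subspace v.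
apply: (top_gen (S := fun w => top v (op y_ 0 w))); first exact: subspace_ker.
by move=> i; apply: (top_pow v i.+1).
Qed.

Lemma zero_modes (S : W -> Prop) : subspace S -> (forall w, S w -> S (op x_ 0 w)) ->
  (forall w, S w -> S (op y_ 0 w)) -> forall a w, S w -> S (op a 0 w).
Proof.
move=> hS hx hy a w Sw; case: a; auto.
- have := swap_xx hJ 0 0 w; rewrite addr0 => e.
  apply: (subZI hS (two_neq0 K)).
  have -> : 2 *: op e_ 0 w = op x_ 0 (op x_ 0 w) + op x_ 0 (op x_ 0 w).
    by rewrite {1}e subrK.
  by apply: (subD hS); auto.
- by rewrite (f0_yy hJ); apply: (subN hS); auto.
- have := swap_x0y0 hJ w => e.
  have -> : op h_ 0 w = op x_ 0 (op y_ 0 w) + op y_ 0 (op x_ 0 w) by rewrite e subrK.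
  by apply: (subD hS); auto.
Qed.

Lemma top_zero a w : top v w -> top v (op a 0 w).
Proof. by apply: zero_modes; [exact: top_subspace|exact: top_x|exact: top_y]. Qed.

Lemma top_pos a (n : nat) w : top v w -> op a n.+1 w = 0.
Proof.
move=> h; apply: (top_gen (S := fun w => op a n.+1 w = 0) _ _ h) => [|i].
  exact: subspace_ker (op a n.+1) _ (subspace_zero W).
exact: ypow_pos.
Qed.

Lemma top_par w : top v w -> top v (sv_par W w).
Proof.
have hs := top_subspace v.
apply: (top_gen (S := fun w => top v (sv_par W w))); first exact: subspace_ker.
by move=> i; rewrite ypow_homog; apply/(subZ hs)/top_pow.
Qed.

Lemma top_deg w : top v w -> wdeg W w = d *: w.
Proof.
apply: (top_gen (S := fun w => wdeg W w = d *: w)); last exact: ypow_deg.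
split=> [|c a b ha hb]; first by rewrite linear0 scaler0.
by rewrite linearP ha hb scalerDr !scalerA mulrC.
Qed.

Lemma hw_mspan w : gen (fun x => x = v) w -> mspan (top v) w.
Proof.
have hs : wsub (mspan (top v)).
  apply: mspan_sub; [exact: top_subspace|exact: top_zero|exact: top_pos|exact: top_par|].
  by exists d => ?; exact: top_deg.
by move=> /(_ _ hs); apply => _ ->; exact: (mspan_mono [::] (top_pow v 0)).
Qed.

Definition hw_vec (x : (word * nat)) : W := mono x.1 (iter x.2 (op y_ 0) v).

Lemma hw_vec_deg x : wdeg W (hw_vec x) = (d + (word_degree x.1)%:R) *: hw_vec x.
Proof. exact/mono_deg/ypow_deg. Qed.
Lemma hw_vec_weight x :
  op h_ 0 (hw_vec x) = (t - x.2%:R + (word_weight x.1)%:~R) *: hw_vec x.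
Proof. exact/mono_weight/ypow_weight. Qed.

Hypothesis hcyc : forall w, gen (fun x => x = v) w.

Lemma hw_span w : exists s : seq ((word * nat) * K), w = \sum_(x <- s) x.2 *: hw_vec x.1.
Proof.
have hS : subspace (fun w => exists s : seq ((word * nat) * K), w = \sum_(x <- s) x.2 *: hw_vec x.1).
  split=> [|c a b [s ->] [r ->]]; first by exists [::]; rewrite big_nil.
  exists ([seq (x.1, c * x.2) | x <- s] ++ r); rewrite big_cat big_map /= scaler_sumr.
  by congr (_ + _); apply: eq_bigr => x _; rewrite scalerA.
have [s [hs ->]] := hw_mspan (hcyc w).
apply: (sub_sum_seq hS) => x xs _; have [n [c ->]] := hs x xs.
rewrite mono_sum; apply: (sub_sum hS) => i _; rewrite mono_Z; apply: (subZ hS).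
by exists [:: ((x.1, nat_of_ord i), 1)]; rewrite big_seq1 scale1r.
Qed.

Lemma hw_span_deg w e : wdeg W w = e *: w ->
  exists s : seq ((word * nat) * K), w = \sum_(x <- s) x.2 *: hw_vec x.1 /\
    forall x, x \in s -> d + (word_degree x.1.1)%:R = e.
Proof.
have [s hs] := hw_span w => he.
exists [seq x <- s | d + (word_degree x.1.1)%:R == e]; split; last first.
  by move=> x; rewrite mem_filter => /andP[/eqP].
rewrite big_filter; apply: (eigen_decomposition (T := wdeg W)
  (c := fun x : (word * nat) * K => d + (word_degree x.1.1)%:R) _ he hs).
by move=> x _; rewrite linearZ /= hw_vec_deg !scalerA mulrC.
Qed.

Lemma hw_span_weight w e mu : wdeg W w = e *: w -> op h_ 0 w = mu *: w ->
  exists s : seq ((word * nat) * K), w = \sum_(x <- s) x.2 *: hw_vec x.1 /\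
    forall x, x \in s -> d + (word_degree x.1.1)%:R = e /\
      t - x.1.2%:R + (word_weight x.1.1)%:~R = mu.
Proof.
move=> he hm; have [s [hs hse]] := hw_span_deg he.
exists [seq x <- s | t - x.1.2%:R + (word_weight x.1.1)%:~R == mu]; split; last first.
  by move=> x; rewrite mem_filter => /andP[/eqP h2 /hse h1].
rewrite big_filter; apply: (eigen_decomposition (T := op h_ 0)
  (c := fun x : (word * nat) * K => t - x.1.2%:R + (word_weight x.1.1)%:~R) _ hm hs).
by move=> x _; rewrite linearZ /= hw_vec_weight !scalerA mulrC.
Qed.

Lemma hw_top w : wdeg W w = d *: w -> top v w.
Proof.
move=> he; have [s [-> hs]] := hw_span_deg he.
apply: (sub_sum_seq (top_subspace v)) => x /hs /eqP; rewrite -subr_eq0 addrAC subrr add0r.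
rewrite pnatr_eq0 => /eqP /word_degree0 e _; apply: (subZ (top_subspace v)).
by rewrite /hw_vec e; apply: top_pow.
Qed.

(** The degree forces the empty word, after which the weight forces the zeroth power of [y(0)]. *)
Lemma hw_top_weight w : wdeg W w = d *: w -> op h_ 0 w = t *: w -> exists c, w = c *: v.
Proof.
move=> he hm; have [s [-> hs]] := hw_span_weight he hm.
exists (\sum_(x <- s) x.2); rewrite scaler_suml; apply: eq_big_seq => x /hs[].
move=> /eqP; rewrite -subr_eq0 addrAC subrr add0r pnatr_eq0 => /eqP /word_degree0 e.
rewrite e /word_weight big_nil addr0 => /eqP; rewrite -subr_eq0 addrAC subrr add0r.
rewrite oppr_eq0 pnatr_eq0 => /eqP e2.
by rewrite /hw_vec e e2.
Qed.

End HighestWeight.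
End Monomials.

(** * Homomorphisms *)

Section Homs.
Variables (K : numFieldType) (L : vsa K).

Record whom (W W' : wmod L) (f : W -> W') : Prop := {
  wh_lin : linear f;
  wh_act : forall n (a : L) w, f (md n a w) = md n a (f w);
  wh_par : forall w, f (sv_par W w) = sv_par W' (f w);
  wh_deg : forall w, f (wdeg W w) = wdeg W' (f w)
}.

Section Hom.
Variables (W W' : wmod L) (f : W -> W') (hf : whom f).

Lemma whom0 : f 0 = 0.
Proof. by have := wh_lin hf (-1) 0 0; rewrite scaler0 addr0 scaleN1r addNr. Qed.
Lemma whomZ c w : f (c *: w) = c *: f w.
Proof. by have := wh_lin hf c w 0; rewrite whom0 !addr0. Qed.
Lemma whomD u w : f (u + w) = f u + f w.
Proof. by have := wh_lin hf 1 u w; rewrite !scale1r. Qed.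
Lemma whomB u w : f (u - w) = f u - f w.
Proof. by rewrite whomD -scaleN1r whomZ scaleN1r. Qed.
Lemma whom_inj : (forall w, f w = 0 -> w = 0) -> injective f.
Proof.
by move=> h u w e; apply/eqP; rewrite -subr_eq0; apply/eqP/h; rewrite whomB e subrr.
Qed.
Lemma whom_iter i n a w : f (iter i (md n a) w) = iter i (md n a) (f w).
Proof. by elim: i => //= i <-; rewrite (wh_act hf). Qed.

Lemma preim_sub S : wsub S -> wsub (fun w => S (f w)).
Proof.
move=> hS; split=> [|n a w|w|w].
- split=> [|c u v hu hv]; first by rewrite whom0; exact: sub0 (ws_lin hS).
  by rewrite (wh_lin hf); apply: (ws_lin hS).2.
- by rewrite (wh_act hf); apply: (ws_act hS).
- by rewrite (wh_par hf); apply: (ws_par hS).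
- by rewrite (wh_deg hf); apply: (ws_deg hS).
Qed.

Lemma image_sub S : wsub S -> wsub (fun w' => exists2 w, S w & f w = w').
Proof.
move=> hS; have hl := ws_lin hS; split=> [|n a w' [w Sw <-]|w' [w Sw <-]|w' [w Sw <-]].
- split=> [|c u v [u' Su <-] [v' Sv <-]]; first by exists 0; [exact: sub0 hl|exact: whom0].
  by exists (c *: u' + v'); [apply: hl.2|rewrite (wh_lin hf)].
- by exists (md n a w); [apply: (ws_act hS)|rewrite (wh_act hf)].
- by exists (sv_par W w); [apply: (ws_par hS)|rewrite (wh_par hf)].
- by exists (wdeg W w); [apply: (ws_deg hS)|rewrite (wh_deg hf)].
Qed.

Lemma gen_image x w : gen (fun y => y = x) w -> gen (fun y => y = f x) (f w).
Proof.
move=> h; apply: (h (fun w => gen (fun y => y = f x) (f w))).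
  exact/preim_sub/gen_sub.
by move=> _ ->; apply: gen_in.
Qed.

Lemma singular_image (J : osp -> L) w : singular J w -> singular J (f w).
Proof.
by move=> [h1 h2 h3]; split=> [n|n|]; rewrite -(wh_act hf) ?h1 ?h2 ?h3; exact: whom0.
Qed.
Lemma singular_reflect (J : osp -> L) w : injective f -> singular J (f w) -> singular J w.
Proof.
move=> inj [h1 h2 h3].
by split=> [n|n|]; apply: inj; rewrite (wh_act hf) ?h1 ?h2 ?h3 whom0.
Qed.

End Hom.

Lemma wsub_all (W : wmod L) : wsub (fun _ : W => True).
Proof. by []. Qed.

Section Sub.
Variables (W : wmod L) (A : W -> Prop) (hA : wsub A).

Definition sub_mod : wmod L := subquot hA (wsub_zero W).
Definition sub_incl (q : sub_mod) : W := sub_rep q.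
Definition sub_elt (u : W) : sub_mod := sub_cl hA (wsub_zero W) u.

Lemma sub_eltK u : A u -> sub_incl (sub_elt u) = u.
Proof.
move=> Au; have /eqP := sq_clK (ws_lin hA) (ws_lin (wsub_zero W)) Au.
by rewrite subr_eq0 => /eqP.
Qed.
Lemma sub_mod_ind (P : sub_mod -> Prop) : (forall u, A u -> P (sub_elt u)) -> forall q, P q.
Proof. exact: sub_ind. Qed.

Lemma sub_incl_hom : whom sub_incl.
Proof.
split=> [c|n a||].
- elim/sub_mod_ind => u Au; elim/sub_mod_ind => v Av.
  rewrite -[_ + _](sub_clP hA (wsub_zero W) c Au Av) !sub_eltK //.
  exact: (ws_lin hA).2.
- elim/sub_mod_ind => u Au; rewrite (sub_actE _ _ n a Au) !sub_eltK //.
  exact: (ws_act hA).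
- elim/sub_mod_ind => u Au; rewrite (sub_parE hA (wsub_zero W) Au) !sub_eltK //.
  exact: (ws_par hA).
- elim/sub_mod_ind => u Au; rewrite (sub_degE hA (wsub_zero W) Au) !sub_eltK //.
  exact: (ws_deg hA).
Qed.

Lemma sub_incl_inj : injective sub_incl.
Proof. exact: val_inj. Qed.
Lemma sub_inclP q : A (sub_incl q).
Proof. exact: sq_valP. Qed.

Lemma sub_elt_gen x : A x -> (forall w, A w -> gen (fun y => y = x) w) ->
  forall q : sub_mod, gen (fun y => y = sub_elt x) q.
Proof.
move=> Ax h q S hS hx.
have [] := h _ (sub_inclP q) (pull S) (pull_sub hS).
  by move=> _ ->; split=> //; apply: hx.
have e : sub_elt (sub_incl q) = q := sq_valK q.
by rewrite -/(sub_elt _) e.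
Qed.
End Sub.

Section Quot.
Variables (W : wmod L) (B : W -> Prop) (hB : wsub B).

Definition quot_mod : wmod L := subquot (wsub_all W) hB.
Definition quot_pr (u : W) : quot_mod := sub_cl (wsub_all W) hB u.

Lemma quot_pr_hom : whom quot_pr.
Proof.
split=> [c u v|n a w|w|w].
- exact: sub_clP.
- by rewrite /quot_pr (sub_actE (wsub_all W) hB n a (u := w) I).
- exact/esym/(sub_parE (wsub_all W) hB (u := w) I).
- exact/esym/(sub_degE (wsub_all W) hB (u := w) I).
Qed.
Lemma quot_pr_eq0 u : (quot_pr u = 0) <-> B u.
Proof. exact: sub_cl_eq0. Qed.
Lemma quot_pr_surj q : exists u, quot_pr u = q.
Proof. by elim/sub_ind: q => u _; exists u. Qed.
End Quot.

End Homs.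

(** * Injective modes, and singular vectors under twisting *)

Section TorsionFree.
Variables (K : numFieldType) (k : K) (L : vsa K) (J : osp -> L).
Hypothesis hJ : osp_currents k J.
Hypothesis hgen : generates J.

Lemma current_even_e : homog false (J e_). Proof. exact: oc_parity hJ e_. Qed.
Lemma current_even_f : homog false (J f_). Proof. exact: oc_parity hJ f_. Qed.

Let nil_step b a i :
  nil_order (J b) i ((osp_bracket b a).1%:~R *: J (osp_bracket b a).2) ->
  nil_order (J b) i ((osp_form b a)%:~R *: vac L) -> nil_order (J b) i.+1 (J a).
Proof.
move=> h1 h2 [|[|j]] /=.
- by rewrite (oc_bracket hJ).
- by rewrite (oc_level hJ) mulrC -scalerA; apply: (subZ (nil_subspace _ i)).
- by rewrite (oc_regular hJ); exact: sub0 (nil_subspace _ i).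
Qed.

Let nil_vac b i c : nil_order (J b) i.+1 (c *: vac L).
Proof.
apply: (subZ (nil_subspace _ i.+1)).
by apply: (nil_order_leq (i := 1)) => // j; apply: vac_regular.
Qed.

Lemma nil_e a : exists i, nil_order (J e_) i a.
Proof.
apply: (nil_order_all current_even_e hJ hgen) => {}a.
have hZ i c b : nil_order (J e_) i (J b) -> nil_order (J e_) i (c *: J b).
  exact: (subZ (nil_subspace _ i)).
have he : nil_order (J e_) 1 (J e_) by apply: nil_step; rewrite /= ?scale0r.
have hx : nil_order (J e_) 1 (J x_) by apply: nil_step; rewrite /= ?scale0r.
have hh : nil_order (J e_) 2 (J h_) by apply: nil_step; [exact: hZ|exact: nil_vac].
have hy : nil_order (J e_) 2 (J y_) by apply: nil_step; [exact: hZ|exact: nil_vac].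
have hf : nil_order (J e_) 3 (J f_) by apply: nil_step; [exact: hZ|exact: nil_vac].
by case: a; eexists; eassumption.
Qed.

Lemma nil_f a : exists i, nil_order (J f_) i a.
Proof.
apply: (nil_order_all current_even_f hJ hgen) => {}a.
have hZ i c b : nil_order (J f_) i (J b) -> nil_order (J f_) i (c *: J b).
  exact: (subZ (nil_subspace _ i)).
have hf : nil_order (J f_) 1 (J f_) by apply: nil_step; rewrite /= ?scale0r.
have hy : nil_order (J f_) 1 (J y_) by apply: nil_step; rewrite /= ?scale0r.
have hh : nil_order (J f_) 2 (J h_) by apply: nil_step; [exact: hZ|exact: nil_vac].
have hx : nil_order (J f_) 2 (J x_) by apply: nil_step; [exact: hZ|exact: nil_vac].
have he : nil_order (J f_) 3 (J e_) by apply: nil_step; [exact: hZ|exact: nil_vac].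
by case: a; eexists; eassumption.
Qed.

Lemma deg_e : vdeg (J e_) = (1 + (-1 + 1)%:~R) *: J e_.
Proof. by rewrite addNr addr0 scale1r (oc_degree hJ). Qed.
Lemma deg_f : vdeg (J f_) = (0 + (0 + 1)%:~R) *: J f_.
Proof. by rewrite !add0r scale1r (oc_degree hJ). Qed.

(** Torsion vectors form a submodule, the saturation of 0. If nonzero it would contain [v], and some
    power of the mode would kill [v]. *)
Lemma torsion_free (b : L) q d (W : wmod L) (v : W) : homog false b ->
  vdeg b = (d + (q + 1)%:~R) *: b -> (forall a, exists i, nil_order b i a) ->
  wirr W -> (forall i, iter i (md q b) v != 0) ->
  forall w : W, md q b w = 0 -> w = 0.
Proof.
move=> hb hd hn [_ hW] hv w e; apply: contrapT => /eqP w0.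
have hS := saturation_sub hb hd hn (wsub_zero W).
have [|i /eqP] := hW _ hS _ v; last by rewrite (negPf (hv i)).
by exists w; split=> //; exists 1%N.
Qed.

(** [f(1)] climbs back down the string of [e(-1)] through [v], with factors invertible by
    non-resonance. *)
Lemma f1_descent (W : wmod L) (S : W -> Prop) (v : W) t i :
  (forall n a w, S w -> S (md n a w)) -> subspace S ->
  md 1 (J f_) v = 0 -> md 0 (J h_) v = t *: v -> (forall m : nat, k - t - m%:R != 0) ->
  S (iter i (md (-1) (J e_)) v) -> S v.
Proof.
move=> ha hS hf ht nz; elim: i => //= i IH h; apply: IH.
have := ha 1 (J f_) _ h; rewrite -iterS (singular_f1_pow hJ i hf ht).
by apply: (subZI hS); rewrite mulf_neq0 ?nz // pnatr_eq0.
Qed.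

Lemma f1_pow_neq0 (W : wmod L) (v : W) t i : v != 0 ->
  md 1 (J f_) v = 0 -> md 0 (J h_) v = t *: v -> (forall m : nat, k - t - m%:R != 0) ->
  iter i (md (-1) (J e_)) v != 0.
Proof.
move=> v0 hf ht nz; apply/eqP => h; move/eqP: v0; apply.
apply: (f1_descent (S := fun w => w = 0) _ _ hf ht nz h).
  by move=> n a w ->; rewrite linear0.
exact: subspace_zero.
Qed.

Lemma ypow_neq0 (W : wmod L) (v : W) i : v != 0 -> singular J v -> md 0 (J h_) v = - 1 *: v ->
  iter i (md 0 (J y_)) v != 0.
Proof.
move=> v0 hv ht; elim: i => // i IH; apply/eqP => h.
have := x_ypow hJ hv ht i; rewrite h linear0 => /esym/eqP.
rewrite scaler_eq0 (negPf IH) orbF.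
have [h1 h2] := xcoefE (-1 : K) i./2.
rewrite -(odd_double_half i); case: (odd i); rewrite ?add1n ?add0n ?h1 ?h2.
  by rewrite oppr_eq0 pnatr_eq0.
by rewrite -opprD oppr_eq0 addrC natr1 pnatr_eq0.
Qed.

Lemma f0_pow_neq0 (W : wmod L) (v : W) i : v != 0 -> singular J v -> md 0 (J h_) v = - 1 *: v ->
  iter i (md 0 (J f_)) v != 0.
Proof.
move=> v0 hv ht; rewrite (f0_iter hJ) scaler_eq0 signr_eq0 /=.
exact: ypow_neq0.
Qed.

Section LocE.
Variables (W : wmod L) (mu : K).
Local Notation E := (md (-1) (J e_)).
Local Notation loc_in := (@loc_in K L W (J e_) (-1) 1 mu current_even_e deg_e nil_e).
Local Notation cl := (@loc_cl K L W (J e_) (-1) 1 mu current_even_e deg_e nil_e).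

Lemma loc_in_x n w : md n (J x_) (loc_in w) = loc_in (md n (J x_) w).
Proof.
rewrite [LHS](loc_actE mu current_even_e deg_e nil_e); last exact: pows_A.
congr (cl _); apply/funext => m; exact: (x_pow_e hJ).
Qed.

(** Interpolation of [y(n) E^m w = E^m y(n) w + m E^(m-1) x(n-1) w] at [m = mu]. The factor [E] on
    both sides absorbs the power [m - 1], which would be negative at index 0. *)
Lemma loc_in_y n w : E (md n (J y_) (loc_in w))
  = E (loc_in (md n (J y_) w)) + mu *: loc_in (md (n - 1) (J x_) w).
Proof.
have hA := locA_subspace W (J e_) (-1).
have Ap (x : W) : locA (J e_) (-1) (pows (J e_) (-1) x) := pows_A (J e_) (-1) x.
have Am (x : W) := locA_mulm (Ap x).
rewrite [md n _ (loc_in w)](loc_actE mu current_even_e deg_e nil_e) //.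
rewrite [LHS]cl_E; last exact: (locA_act current_even_e nil_e).
rewrite /loc_in [E (cl _)]cl_E // -cl_mulm // -[X in X + _]scale1r -loc_clP //; last exact: locA_E.
congr (cl _); apply/funext => m.
have -> (X Y : seqU W) : (1 *: X + Y) m = 1 *: X m + Y m by [].
rewrite /seqE /seq_act /mulm /pows scale1r; case: m => [|m].
  by rewrite scale0r addr0.
by rewrite (y_pow_e hJ) linearD linearZ.
Qed.

Lemma loc_in_h0 w t : md 0 (J h_) w = t *: w ->
  md 0 (J h_) (loc_in w) = (t + 2 * mu) *: loc_in w.
Proof.
move=> ht.
have Ap : locA (J e_) (-1) (pows (J e_) (-1) w) := pows_A (J e_) (-1) w.
have Am := locA_mulm Ap; have hA := locA_subspace W (J e_) (-1).
rewrite [LHS](loc_actE mu current_even_e deg_e nil_e) //.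
have -> : seq_act 0 (J h_) (pows (J e_) (-1) w)
    = t *: pows (J e_) (-1) w + 2 *: mulm (pows (J e_) (-1) w).
  apply/funext => m.
  have -> (X Y : seqU W) c c' : (c *: X + c' *: Y) m = c *: X m + c' *: Y m by [].
  rewrite /seq_act /mulm /pows scalerA -scalerDl; elim: m => [|m IH].
    by rewrite mulr0 addr0.
  rewrite iterS (weight_act hJ) IH linearZ /= -natr1; lmod_ring K W.
rewrite loc_clP //; last exact: (subZ hA).
by rewrite loc_clZ // cl_mulm // scalerA scalerDl.
Qed.

(** Interpolation of [f(1) E^m w = m (k - t - m + 1) E^(m-1) w] at [m = mu]. *)
Lemma loc_in_f1 w t : md 1 (J f_) w = 0 -> md 0 (J h_) w = t *: w ->
  E (md 1 (J f_) (loc_in w)) = (mu * (k - t - mu + 1)) *: loc_in w.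
Proof.
move=> hf ht.
have Ap : locA (J e_) (-1) (pows (J e_) (-1) w) := pows_A (J e_) (-1) w.
have Am := locA_mulm Ap; have Amm := locA_mulm Am.
have hA := locA_subspace W (J e_) (-1).
rewrite [md 1 _ (loc_in w)](loc_actE mu current_even_e deg_e nil_e) //.
rewrite [LHS]cl_E; last exact: (locA_act current_even_e nil_e).
have -> : seqE (J e_) (-1) (seq_act 1 (J f_) (pows (J e_) (-1) w))
    = (k - t + 1) *: mulm (pows (J e_) (-1) w) + (-1) *: mulm (mulm (pows (J e_) (-1) w)).
  apply/funext => m.
  have -> (X Y : seqU W) c c' : (c *: X + c' *: Y) m = c *: X m + c' *: Y m by [].
  rewrite /seqE /seq_act /mulm /pows; case: m => [|m].
    by rewrite hf linear0 !scale0r !scaler0 addr0.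
  by rewrite (singular_f1_pow hJ m hf ht) linearZ /= -natr1; lmod_ring K W.
rewrite loc_clP //; last exact: (subZ hA).
rewrite loc_clZ // !cl_mulm // !scalerA -scalerDl; congr (_ *: _); ring.
Qed.

End LocE.
End TorsionFree.

Section HighestWeightVectors.
Variables (K : numFieldType) (L : vsa K) (J : osp -> L).

Record hwvec (W : wmod L) (v : W) (t d : K) (p : bool) : Prop := {
  hw_sing : singular J v;
  hw_wt : md 0 (J h_) v = t *: v;
  hw_deg : wdeg W v = d *: v;
  hw_par : homog p v;
  hw_nz : v != 0
}.

Lemma hwvec_reflect (W W' : wmod L) (f : W -> W') v t d p : whom f -> injective f ->
  hwvec (f v) t d p -> hwvec v t d p.
Proof.
move=> hf inj [h1 h2 h3 h4 h5]; split.
- exact: (singular_reflect hf inj h1).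
- by apply: inj; rewrite (wh_act hf) (whomZ hf).
- by apply: inj; rewrite (wh_deg hf) (whomZ hf).
- by apply: inj; rewrite (wh_par hf) (whomZ hf).
- by apply: contra_neq h5 => ->; exact: whom0 hf.
Qed.

Lemma hwvec_image (W W' : wmod L) (f : W -> W') v t d p : whom f -> f v != 0 ->
  hwvec v t d p -> hwvec (f v) t d p.
Proof.
move=> hf nz [h1 h2 h3 h4 h5]; split=> //.
- exact: (singular_image hf h1).
- by rewrite -(wh_act hf) h2 (whomZ hf).
- by rewrite -(wh_deg hf) h3 (whomZ hf).
- by rewrite /homog -(wh_par hf) h4 (whomZ hf).
Qed.

Section Cyclic.
Variables (W : wmod L) (v : W).
Definition cyc : wmod L := sub_mod (gen_sub (fun x : W => x = v)).
Definition cyc_incl : cyc -> W := @sub_incl K L W _ (gen_sub (fun x : W => x = v)).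
Definition cyc_gen : cyc := sub_elt (gen_sub (fun x : W => x = v)) v.

Lemma cyc_hom : whom cyc_incl. Proof. exact: sub_incl_hom. Qed.
Lemma cyc_inj : injective cyc_incl. Proof. exact: sub_incl_inj. Qed.
Lemma cyc_genE : cyc_incl cyc_gen = v.
Proof. by apply: sub_eltK; apply: gen_in. Qed.
Lemma cyc_cyclic (q : cyc) : gen (fun x => x = cyc_gen) q.
Proof. by apply: sub_elt_gen => //; apply: gen_in. Qed.
Lemma cyc_lift w : gen (fun x => x = v) w -> exists q, cyc_incl q = w.
Proof. by move=> h; exists (sub_elt (gen_sub _) w); apply: sub_eltK. Qed.
End Cyclic.

End HighestWeightVectors.

(** * Construction of the extension *)

(** An interface to [loc] that forgets the sequences. The exponent of the twist reappears only in
    the extra relations of [locE_exists]. *)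
Record is_localization (K : numFieldType) (L : vsa K) (b : L) (q : int)
    (W Q : wmod L) (i : W -> Q) : Prop := {
  il_lin : linear i;
  il_inj : forall w, i w = 0 -> w = 0;
  il_Einj : forall x : Q, md q b x = 0 -> x = 0;
  il_Esurj : forall x : Q, exists y, md q b y = x;
  il_E : forall w, i (md q b w) = md q b (i w);
  il_par : forall w, sv_par Q (i w) = i (sv_par W w);
  il_deg : forall w, wdeg Q (i w) = i (wdeg W w);
  il_repr : forall x : Q, exists (j : nat) w, iter j (md q b) x = i w;
  il_hat : forall S : Q -> Prop, wsub S -> (forall x, S (md q b x) -> S x) ->
    wsub (fun w => S (i w))
}.

Section Localization.
Variables (K : numFieldType) (L : vsa K) (b : L) (q : int) (W Q : wmod L) (i : W -> Q).
Hypothesis hi : is_localization b q i.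

Lemma il0 : i 0 = 0.
Proof. by have := il_lin hi (-1) 0 0; rewrite scaler0 addr0 scaleN1r addNr. Qed.
Lemma ilZ c w : i (c *: w) = c *: i w.
Proof. by have := il_lin hi c w 0; rewrite il0 !addr0. Qed.
Lemma ilD u w : i (u + w) = i u + i w.
Proof. by have := il_lin hi 1 u w; rewrite !scale1r. Qed.
End Localization.

Section Construction.
Variables (K : numFieldType) (L : vsa K) (J : osp -> L).
Local Notation k := (- (3 / 2) : K).
Hypothesis hJ : osp_currents k J.
Hypothesis hgen : generates J.
Hypothesis hirr : wirr (adjoint_w L).

Local Notation A := (adjoint_w L).
Local Notation E := (md (-1) (J e_)).
Local Notation F := (md 0 (J f_)).
Local Notation op a n := (md n (J a)).
Local Notation locE W := (@loc K L W (J e_) (-1) 1 (- (1 / 2)) (current_even_e hJ) (deg_e hJ) (nil_e hJ hgen)).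
Local Notation inE := (@loc_in K L _ (J e_) (-1) 1 (- (1 / 2)) (current_even_e hJ) (deg_e hJ) (nil_e hJ hgen)).
Local Notation locF W := (@loc K L W (J f_) 0 0 0 (current_even_f hJ) (deg_f hJ) (nil_f hJ hgen)).
Local Notation inF := (@loc_in K L _ (J f_) 0 0 0 (current_even_f hJ) (deg_f hJ) (nil_f hJ hgen)).

Lemma half_nonint (n : int) : k - n%:~R != 0.
Proof.
apply/eqP => h.
have : (2 * n + 3)%:~R = 0 :> K.
  have e : n%:~R = - (3 / 2) :> K by apply/eqP; rewrite eq_sym -subr_eq0 h.
  by rewrite intrD intrM e; field.
by move=> /eqP; rewrite intr_eq0 => /eqP; lia.
Qed.

Lemma half_nonint_nat (t : int) (m : nat) : k - t%:~R - m%:R != 0.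
Proof. by have := half_nonint (t + m%:Z); rewrite intrD opprD addrA. Qed.

Lemma vac_neq0 : vac L != 0.
Proof.
have [w w0] := hirr.1; apply: contra_neq w0 => e.
by rewrite -[w]vac_creation' e linear0.
Qed.

Lemma vac_vacuum a (n : nat) : md (W := A) n a (vac L) = 0.
Proof. exact: vac_regular. Qed.

Lemma vac_hw : hwvec J (W := A) (vac L) 0 0 false.
Proof.
split; rewrite ?scale0r //.
- by split=> [n|n|]; rewrite ?vac_vacuum // (vac_vacuum _ 1).
- exact: (vac_vacuum _ 0).
- exact: vdeg_vac.
- exact: vac_even.
- exact: vac_neq0.
Qed.

Lemma vac_cyclic (w : A) : gen (fun x : A => x = vac L) w.
Proof.
by rewrite -[w]vac_creation'; apply: (ws_act (gen_sub _)); apply: gen_in.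
Qed.

Lemma E_inj_adj (w : A) : E w = 0 -> w = 0.
Proof.
have [[_ _ hf] ht _ _ nz] := vac_hw.
refine (torsion_free (current_even_e hJ) (deg_e hJ) (nil_e hJ hgen) hirr (v := vac L : A) _ (w := w)) => i.
exact: (f1_pow_neq0 hJ i nz hf ht (half_nonint_nat 0)).
Qed.

Lemma hw_loc (W : wmod L) (w : W) d p : (forall w : W, E w = 0 -> w = 0) ->
  hwvec J w 0 d p -> hwvec J (W := locE W) (inE w) (-1) d p.
Proof.
move=> inj [[hx hy hf] ht hd hp nz].
have injQ (x : locE W) : E x = 0 -> x = 0 by exact: loc_Einj inj x.
split.
- split=> [n|n|]; first by rewrite loc_in_x hx; exact: loc_in0.
    apply: injQ; rewrite loc_in_y hy.
    have -> : n.+1%:Z - 1 = n by lia.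
    by rewrite hx loc_in0 linear0 scaler0 addr0.
  apply: injQ; rewrite (loc_in_f1 _ _ _ hf ht).
  (* The second factor is [k - mu + 1], zero because [mu = k + 1]. *)
  have -> : - (1 / 2) * (k - 0 - - (1 / 2) + 1) = 0 :> K by field.
  by rewrite scale0r.
- by rewrite (loc_in_h0 _ _ _ ht); congr (_ *: _); field.
- by rewrite loc_in_deg hd loc_inZ.
- by rewrite /homog loc_in_par hp loc_inZ.
- by apply/eqP => /(loc_in_inj inj) /eqP; rewrite (negPf nz).
Qed.

Lemma locE_exists (W : wmod L) : (forall w : W, E w = 0 -> w = 0) ->
  exists (Q : wmod L) (i : W -> Q), [/\ is_localization (J e_) (-1) i,
    forall n w, op x_ n (i w) = i (op x_ n w),
    forall n w, E (op y_ n (i w)) = i (E (op y_ n w)) - (1 / 2) *: i (op x_ (n - 1) w)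
  & forall w d p, hwvec J w 0 d p -> hwvec J (i w) (-1) d p].
Proof.
move=> inj; exists (locE W), inE; split.
- split=> [c u w|w|x|x|w|w|w|x|S hS sat].
  + exact: loc_inP.
  + exact: loc_in_inj inj w.
  + exact: loc_Einj inj x.
  + exact: loc_Esurj.
  + exact: loc_in_E.
  + exact: loc_in_par.
  + exact: loc_in_deg.
  + exact: loc_repr.
  + exact: hat_sub.
- by move=> n w; rewrite loc_in_x.
- by move=> n w; rewrite loc_in_y loc_in_E scaleNr.
- by move=> w d p; apply: hw_loc.
Qed.

Lemma locF_exists (W : wmod L) : (forall w : W, F w = 0 -> w = 0) ->
  exists (Q : wmod L) (i : W -> Q), is_localization (J f_) 0 i /\ whom i.
Proof.
move=> inj; exists (locF W), inF; split.
  split=> [c u w|w|x|x|w|w|w|x|S hS sat].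
  + exact: loc_inP.
  + exact: loc_in_inj inj w.
  + exact: loc_Einj inj x.
  + exact: loc_Esurj.
  + exact: loc_in_E.
  + exact: loc_in_par.
  + exact: loc_in_deg.
  + exact: loc_repr.
  + exact: hat_sub.
split=> [c u v|n a w|w|w].
- exact: loc_inP.
- by rewrite loc_in_hom0.
- by rewrite loc_in_par.
- by rewrite loc_in_deg.
Qed.

(** On the image of [w] under the twisted embedding of [locE_exists] this equals the image of
    [e(-1) y(0) w]. *)
Definition sum_rel (W : wmod L) (w : W) : W := E (op y_ 0 w) + (1 / 2) *: op x_ (-1) w.

Lemma sum_rel_hom (W W' : wmod L) (f : W -> W') w : whom f -> f (sum_rel w) = sum_rel (f w).
Proof. by move=> hf; rewrite /sum_rel (whomD hf) (whomZ hf) !(wh_act hf). Qed.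

Lemma wsub_gen_le (W : wmod L) (S : W -> Prop) x : wsub S -> S x ->
  forall w, gen (fun y => y = x) w -> S w.
Proof. by move=> hS Sx w; apply=> // _ ->. Qed.

Lemma cyc_exists (W : wmod L) (v : W) : exists (C : wmod L) (c : C) (i : C -> W),
  [/\ whom i, injective i, i c = v, forall q, gen (fun x => x = c) q
    & forall w, gen (fun x => x = v) w -> exists q, i q = w].
Proof.
exists (cyc v), (cyc_gen v), (@cyc_incl _ _ _ v); split.
- exact: cyc_hom.
- exact: cyc_inj.
- exact: cyc_genE.
- exact: cyc_cyclic.
- exact: cyc_lift.
Qed.

Let satE (W : wmod L) (S : W -> Prop) : wsub S -> wsub (saturation (J e_) (-1) S).
Proof. exact: (saturation_sub (current_even_e hJ) (deg_e hJ) (nil_e hJ hgen)). Qed.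

(** Irreducibility is inherited from [L]: saturating a nonzero submodule in the localization gives a
    nonzero preimage in [L], hence the vacuum. So the submodule contains some [e(-1)^m v1], and
    [f1_descent] recovers [v1]. *)
Lemma N0_exists : exists (N0 : wmod L) (n0 : N0),
  [/\ hwvec J n0 (-1) 0 false, sum_rel n0 = 0, wirr N0,
     forall q, gen (fun x => x = n0) q & forall i, iter i E n0 != 0].
Proof.
have [L1 [inE [hl lx ly lhw]]] := locE_exists E_inj_adj.
have v1_hw := lhw _ _ _ vac_hw; set v1 := inE _ in v1_hw.
have v1_rel : sum_rel v1 = 0.
  rewrite /sum_rel ly (vac_vacuum _ 0) md0r (il0 hl) add0r lx.
  by rewrite addNr.
have [N0 [n0 [i [hi inj en cycn lift]]]] := cyc_exists v1.
have n0_hw : hwvec J n0 (-1) 0 false.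
  by apply: (hwvec_reflect hi inj); rewrite en.
exists N0, n0; split=> //.
- by apply: inj; rewrite (sum_rel_hom _ hi) en v1_rel (whom0 hi).
- split=> [|S hS [s [Ss s0]]]; first by exists n0; exact: hw_nz n0_hw.
  pose S1 (w : L1) := exists2 q, S q & i q = w.
  have hS1 : wsub S1 := image_sub hi hS.
  have hS2 := satE hS1.
  have hH := il_hat hl hS2 (@saturation_sat _ _ _ _ _ _).
  have [j [l e]] := il_repr hl (i s).
  have S2s : saturation (J e_) (-1) S1 (inE l).
    rewrite -e; elim: j {e} => [|j IH]; first by exists 0%N; exists s.
    by rewrite iterS; apply: (ws_act hS2).
  have l0 : l != 0.
    apply/eqP => l0; move: e; rewrite l0 (il0 hl) => /(iter_inj_of (il_Einj hl)) e.
    by move/eqP: s0; apply; apply: inj; rewrite e (whom0 hi).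
  have [m S1v] : saturation (J e_) (-1) S1 v1 by apply: (hirr.2 _ hH); exists l.
  have [[_ _ hf] ht _ _ nz] := v1_hw.
  have [q Sq e'] : S1 v1.
    apply: (f1_descent hJ (ws_act hS1) (ws_lin hS1) hf ht _ S1v).
    exact: half_nonint_nat (-1).
  move=> w; apply: (wsub_gen_le hS _ (cycn w)).
  by suff -> : n0 = q by []; apply: inj; rewrite en.
- move=> m; apply/eqP => /(congr1 i); rewrite (whom_iter hi) en (whom0 hi).
  by move=> /(iter_inj_of (il_Einj hl))/eqP; rewrite (negPf (hw_nz v1_hw)).
Qed.

(* [p = y(0) f(0)^-1 n0] spans with [n0] a highest weight module in which the
   class of [p] behaves like the vacuum *)
Lemma P_exists : exists (P : wmod L) (p : P),
  [/\ hwvec J p 0 0 true, forall q, gen (fun x => x = p) q,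
      forall w : P, E w = 0 -> w = 0
    & exists v : P, [/\ op y_ 0 p = - v, hwvec J v (-1) 0 false & sum_rel v = 0]].
Proof.
have [N0 [n0 [n0_hw n0_rel N0_irr n0_cyc En0]]] := N0_exists.
have F_inj_N0 (w : N0) : F w = 0 -> w = 0.
  have [hs ht _ _ nz] := n0_hw.
  refine (torsion_free (current_even_f hJ) (deg_f hJ) (nil_f hJ hgen) N0_irr (v := n0) _ (w := w)) => i.
  exact: (f0_pow_neq0 hJ i nz hs ht).
have [L2 [inF [hl hF]]] := locF_exists F_inj_N0.
have inj := il_Einj hl.
have v2_hw : hwvec J (inF n0) (-1) 0 false.
  apply: (hwvec_image hF _ n0_hw).
  by apply/eqP => /(il_inj hl)/eqP; rewrite (negPf (hw_nz n0_hw)).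
have v2_rel : sum_rel (inF n0) = 0 by rewrite -(sum_rel_hom _ hF) n0_rel (whom0 hF).
set v2 := inF n0 in v2_hw v2_rel.
(* Clearing powers of [f(0)] from a torsion vector gives one in the image of [N0]; by irreducibility
   [n0] would be torsion, against [En0]. *)
have E_inj_L2 (w : L2) : E w = 0 -> w = 0.
  move=> e; apply: contrapT => /eqP w0.
  have hT := satE (wsub_zero L2).
  have Tw : saturation (J e_) (-1) (fun w : L2 => w = 0) w by exists 1%N.
  have [j [n en]] := il_repr hl w.
  have Tn : saturation (J e_) (-1) (fun w : L2 => w = 0) (inF n).
    by rewrite -en; elim: j {en} => // j; rewrite iterS; apply: (ws_act hT).
  have n0' : n != 0.
    apply/eqP => n0'; move: en; rewrite n0' (whom0 hF) => /(iter_inj_of inj).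
    by move/eqP: w0.
  have [i h] : saturation (J e_) (-1) (fun w : L2 => w = 0) (inF n0).
    by apply: (N0_irr.2 _ (preim_sub hF hT)); exists n.
  move/eqP: (En0 i); apply; apply: (il_inj hl).
  by rewrite (whom_iter hF).
have [[hx hy hf] ht hd hp nz] := v2_hw.
have pos := singular_pos hJ (hw_sing v2_hw).
have [z ez] : exists z : L2, F z = v2 := il_Esurj hl _.
(* Modes of [z], which is [f(0)^-1 v2], are computed by applying the injective [f(0)] and commuting
   it through to [v2]. *)
have F0 a n := swap_f0 hJ a n z.
have hx0 : op x_ 0 v2 = 0 := hx 0%N.
have zy (n : nat) : op y_ n.+1 z = 0.
  by apply: inj; rewrite F0 ez hy /= scale0r addr0.
have zx (n : nat) : op x_ n.+1 z = 0.
  by apply: inj; rewrite F0 ez hx /= zy scaler0 addr0.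
have zf (n : nat) : op f_ n.+1 z = 0.
  by apply: inj; rewrite F0 ez pos /= scale0r addr0.
have zh (n : nat) : op h_ n.+1 z = 0.
  by apply: inj; rewrite F0 ez pos /= zf scaler0 addr0.
have zh0 : op h_ 0 z = z.
  apply/eqP; rewrite -subr_eq0; apply/eqP/inj.
  rewrite mdBr F0 /= ez ht; lmod_ring K L2.
have zpar : sv_par L2 z = z.
  apply/eqP; rewrite -subr_eq0; apply/eqP/inj; rewrite mdBr.
  have := current_par hJ (W := L2) f_ 0 z; rewrite /= expr0 scale1r => <-.
  by rewrite ez hp expr0 scale1r subrr.
have zdeg : wdeg L2 z = 0.
  apply: inj; have := current_deg hJ (W := L2) f_ 0 z.
  by rewrite scale0r subr0 => <-; rewrite ez hd scale0r.
(* This amounts to [x(0) p = 0], because [x(0) y(0) z = h(0) z - y(0) x(0) z] and [h(0) z = z]. *)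
have yx : op y_ 0 (op x_ 0 z) = z.
  apply/eqP; rewrite -subr_eq0; apply/eqP/inj; rewrite mdBr (swap_fy hJ).
  have e1 : op f_ 0 (op x_ 0 z) = - op y_ 0 z.
    by rewrite (swap_fx hJ) ez hx0 sub0r addr0.
  by rewrite e1 mdNr -(f0_yy hJ) subrr.
have yp : op y_ 0 (op y_ 0 z) = - v2 by rewrite -ez (f0_yy hJ) opprK.
have p_hw : hwvec J (op y_ 0 z) 0 0 true.
  split.
  - split=> [[|n]|n|].
    + by rewrite [op x_ _ _](swap_x0y0 hJ) zh0 yx subrr.
    + by rewrite (swap_xy hJ) // addr0 zh zx md0r subr0.
    + by rewrite (swap_yy hJ) addr0 zf scaler0 oppr0 zy md0r subr0.
    + by rewrite (swap_fy hJ) (zf 0%N) md0r.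
  - by rewrite (weight_act hJ) zh0 scale0r /=; lmod_ring K L2.
  - by rewrite (current_deg hJ) zdeg md0r !scale0r subr0.
  - by rewrite /homog (current_par hJ) zpar.
  - apply/eqP => e; move: yp; rewrite e md0r => /esym/eqP.
    by rewrite oppr_eq0 (negPf nz).
have [P [p [i [hi iinj ep cycp _]]]] := cyc_exists (op y_ 0 z).
have ev : i (- op y_ 0 p) = v2.
  by rewrite -scaleN1r (whomZ hi) (wh_act hi) ep yp scaleN1r opprK.
exists P, p; split=> //.
- by apply: (hwvec_reflect hi iinj); rewrite ep.
- move=> w /(congr1 i); rewrite (wh_act hi) (whom0 hi) => /E_inj_L2 e.
  by apply: iinj; rewrite e (whom0 hi).
exists (- op y_ 0 p); split; first by rewrite opprK.
  by apply: (hwvec_reflect hi iinj); rewrite ev.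
by apply: iinj; rewrite (sum_rel_hom _ hi) ev v2_rel (whom0 hi).
Qed.

End Construction.

(** * Vacuum-like vectors and the submodules they generate *)

Section VacuumVectors.
Variables (K : numFieldType) (k : K) (L : vsa K) (J : osp -> L).
Hypothesis hJ : osp_currents k J.
Hypothesis hgen : generates J.
Variables (W : wmod L) (x : W) (d : K) (p : bool).
Hypotheses (hd : wdeg W x = d *: x) (hp : homog p x).

Lemma vacuum_mode_par (b : L) :
  sv_par W (md (-1) b x) = (-1) ^+ p *: md (-1) (sv_par L b) x.
Proof. by rewrite md_par hp mdZr. Qed.

Lemma vacuum_mode_deg (b : L) : wdeg W (md (-1) b x) = md (-1) (vdeg b) x + d *: md (-1) b x.
Proof. by rewrite md_deg hd mdZr addNr scale0r subr0. Qed.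

Section Modulo.
Variable S : W -> Prop.
Hypotheses (hS : wsub S) (hx : forall a (n : nat), S (md n (J a) x)).

(** Modulo [S] the vector [x] is vacuum-like, so [b |-> b_(-1) x] commutes with modes and its image
    is already stable. *)
Lemma vacuum_span_sub : wsub (fun w => exists b, S (w - md (-1) b x)).
Proof.
have hl := ws_lin hS; split=> [|n a w [b h]|w [b h]|w [b h]].
- split=> [|c u v [b hb] [b' hb']]; first by exists 0; rewrite md0l subr0; exact: sub0 hl.
  exists (c *: b + b'); have -> : c *: u + v - md (-1) (c *: b + b') x
      = c *: (u - md (-1) b x) + (v - md (-1) b' x).
    by rewrite mdPl; lmod_ring K W.
  exact: hl.2.
- exists (vprod n a b).
  have h1 := vacuum_like_span hJ hgen hS hx n a b.
  have -> : md n a w - md (-1) (vprod n a b) x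
      = md n a (w - md (-1) b x) - (md (-1) (vprod n a b) x - md n a (md (-1) b x)).
    by rewrite mdBr; lmod_ring K W.
  by apply: (subB hl) => //; apply: (ws_act hS).
- exists ((-1) ^+ p *: sv_par L b).
  by rewrite mdZl -vacuum_mode_par -linearB; apply: (ws_par hS).
- exists (vdeg b + d *: b).
  by rewrite mdDl mdZl -vacuum_mode_deg -linearB; apply: (ws_deg hS).
Qed.

Lemma vacuum_preim_sub (T : W -> Prop) : wsub T -> (forall w, S w -> T w) ->
  wsub (W := adjoint_w L) (fun b => T (md (-1) b x)).
Proof.
move=> hT hST; have hl := ws_lin hT; split=> [|n a b h|b h|b h].
- exact: subspace_mode hl.
- have h1 := hST _ (vacuum_like_span hJ hgen hS hx n a b).
  rewrite -[md (-1) _ x](subrK (md n a (md (-1) b x))).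
  by apply: (subD hl) => //; apply: (ws_act hT).
- have nz : (-1) ^+ p != 0 :> K by rewrite signr_eq0.
  by apply: (subZI hl nz); rewrite -vacuum_mode_par; apply: (ws_par hT).
- have -> : md (-1) (vdeg b) x = wdeg W (md (-1) b x) - d *: md (-1) b x.
    by rewrite vacuum_mode_deg addrK.
  by apply: (subB hl); [apply: (ws_deg hT) | apply: (subZ hl)].
Qed.
End Modulo.

Hypothesis hx : forall a (n : nat), md n (J a) x = 0.

Lemma vacuum_hom n (a b : L) : md (-1) (vprod n a b) x = md n a (md (-1) b x).
Proof.
apply/eqP; rewrite -subr_eq0; apply/eqP.
exact: (vacuum_like_span hJ hgen (wsub_zero W) hx n a b).
Qed.

Lemma vacuum_vac : md (-1) (vac L) x = x.
Proof. by rewrite md_vac. Qed.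

Lemma vacuum_gen w : gen (fun y => y = x) w <-> exists b, md (-1) b x = w.
Proof.
split=> [h|[b <-]]; last by apply: (ws_act (gen_sub _)); apply: gen_in.
have [b] : exists b, w - md (-1) b x = 0.
  apply: (h _ (vacuum_span_sub (wsub_zero W) hx)) => _ ->.
  by exists (vac L); rewrite vacuum_vac subrr.
by move=> /eqP; rewrite subr_eq0 => /eqP ->; exists b.
Qed.

End VacuumVectors.

Section HighestWeightDecomposition.
Variables (K : numFieldType) (k : K) (L : vsa K) (J : osp -> L).
Hypothesis hJ : osp_currents k J.
Hypothesis hgen : generates J.
Variables (W : wmod L) (v : W) (t d : K) (p : bool).
Hypothesis hv : hwvec J v t d p.
Hypothesis hcyc : forall w : W, gen (fun x => x = v) w.

Definition degree_val (c : K) : Prop := exists n : nat, c = d + n%:R.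
Definition weight_val (c : K) : Prop := exists n : int, c = t + n%:~R.

Lemma hw_deg_semisimple : semisimple_on (wdeg W) degree_val.
Proof.
case: hv => h1 h2 h3 h4 _ w; have [s ->] := hw_span hJ hgen h1 h2 h3 h4 hcyc w.
exists [seq y.2 *: hw_vec J v y.1 | y <- s]; split; first by rewrite big_map.
move=> _ /mapP[y _ ->]; exists (d + (word_degree y.1.1)%:R).
split; first by exists (word_degree y.1.1).
by rewrite linearZ /= (hw_vec_deg hJ h3) !scalerA mulrC.
Qed.

Lemma hw_weight_semisimple : semisimple_on (md (W := W) 0 (J h_)) weight_val.
Proof.
case: hv => h1 h2 h3 h4 _ w; have [s ->] := hw_span hJ hgen h1 h2 h3 h4 hcyc w.
exists [seq y.2 *: hw_vec J v y.1 | y <- s]; split; first by rewrite big_map.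
move=> _ /mapP[y _ ->]; exists (t + (word_weight y.1.1 - y.1.2%:Z)%:~R).
split; first by exists (word_weight y.1.1 - y.1.2%:Z).
rewrite mdZr (hw_vec_weight hJ h2) !scalerA mulrC; congr (_ *: _).
by rewrite intrB; ring.
Qed.

(** Lets a vector outside [G] be taken homogeneous in degree and weight: if all joint eigenvectors
    of [S] were in [G], so would be their sums. *)
Lemma hw_joint (S G : W -> Prop) s : wsub S -> wsub G -> S s -> ~ G s ->
  exists s' c1 c2, [/\ S s', ~ G s', degree_val c1, weight_val c2
     & wdeg W s' = c1 *: s' /\ md 0 (J h_) s' = c2 *: s'].
Proof.
move=> hS hG Ss; apply: contra_notP => no.
have [r [hr ->]] := semisimple_sub (ws_lin hS) (ws_deg hS) hw_deg_semisimple Ss.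
apply: (sub_sum_seq (ws_lin hG)) => x /hr[hx1 Sx hx2] _.
pose S' w := S w /\ wdeg W w = x.1 *: w.
have hS' : subspace S'.
  split=> [|c a b [Sa ea] [Sb eb]].
    by split; [exact: sub0 (ws_lin hS) | rewrite linear0 scaler0].
  split; first exact: (ws_lin hS).2.
  by rewrite linearP ea eb scalerDr !scalerA mulrC.
have hS'h w : S' w -> S' (md 0 (J h_) w).
  move=> [Sw ew]; split; first exact: ws_act.
  by rewrite (current_deg hJ) ew mdZr scale0r subr0.
have [r' [hr' ->]] := semisimple_sub hS' hS'h hw_weight_semisimple (conj Sx hx2).
apply: (sub_sum_seq (ws_lin hG)) => y /hr'[hy1 [Sy ey] hy2] _.
apply: contrapT => nG; apply: no.
by exists y.2, x.1, y.1.
Qed.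

Lemma hw_deg_ge w e : wdeg W w = e *: w -> (forall n : nat, e != d + n%:R) -> w = 0.
Proof.
case: hv => h1 h2 h3 h4 _ he hne.
have [s [-> hs]] := hw_span_deg hJ hgen h1 h2 h3 h4 hcyc he.
rewrite big_seq big1 // => x /hs e'; by have := hne (word_degree x.1.1); rewrite e' eqxx.
Qed.

End HighestWeightDecomposition.

Section Torsion.
Variables (K : numFieldType) (k : K) (L : vsa K) (J : osp -> L).
Hypothesis hJ : osp_currents k J.
Variables (W : wmod L) (G : W -> Prop) (s : W) (c : K).
Hypotheses (hG : wsub G) (hs : md 0 (J h_) s = c *: s) (hE : G (md (-1) (J e_) s)).
Hypothesis hc : forall m : nat, k - c + m%:R != 0.
Local Notation f1 := (md (W := W) 1 (J f_)).

(* [e(-1), f(1)] and their bracket span a copy of sl2 in which [s] is, modulo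
   [G], a lowest weight vector of non-integral weight *)
Lemma f1_torsion n : G (iter n f1 s) -> G s.
Proof.
have hl := ws_lin hG.
have hh m : md 0 (J h_) (iter m f1 s) = (c - 2 * m%:R) *: iter m f1 s.
  elim: m => [|m IH]; first by rewrite mulr0 subr0.
  by rewrite iterS (weight_act hJ) IH mdZr -natr1 /=; lmod_ring K W.
have key m : G (md (-1) (J e_) (iter m.+1 f1 s)
               - (m.+1%:R * (c - k - m%:R)) *: iter m f1 s).
  elim: m => [|m IH].
    have e : md (-1) (J e_) (iter 1 f1 s) - (1%:R * (c - k - 0%:R)) *: iter 0 f1 s
        = f1 (md (-1) (J e_) s).
      by rewrite /= (swap_f1e hJ) hs; lmod_ring K W.
    by rewrite e; apply: (ws_act hG).
  have e : md (-1) (J e_) (iter m.+2 f1 s) - (m.+2%:R * (c - k - m.+1%:R)) *: iter m.+1 f1 s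
      = f1 (md (-1) (J e_) (iter m.+1 f1 s) - (m.+1%:R * (c - k - m%:R)) *: iter m f1 s).
    by rewrite mdBr mdZr (swap_f1e hJ) -!iterS hh -!natr1; lmod_ring K W.
  by rewrite e; apply: (ws_act hG).
elim: n => // n IH h; apply: IH.
have nz : n.+1%:R * (c - k - n%:R) != 0 :> K.
  rewrite mulf_neq0 ?pnatr_eq0 // -oppr_eq0.
  by have := hc n; congr (_ != _); ring.
apply: (subZI hl nz); rewrite -[_ *: _]opprK; apply: (subN hl).
exact: (subDr hl (ws_act hG (-1) (J e_) h) (key n)).
Qed.
End Torsion.

Section Extension.
Variables (K : numFieldType) (L : vsa K) (J : osp -> L).
Local Notation k := (- (3 / 2) : K).
Hypothesis hJ : osp_currents k J.
Hypothesis hgen : generates J.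
Hypothesis hirr : wirr (adjoint_w L).
Local Notation E := (md (-1) (J e_)).
Local Notation op a n := (md n (J a)).

(** The last clause is the irreducibility of [M / <u>]. The saturation of such an [S] has a preimage
    in [P] that contains [v], and [P / <v>] is generated by the vacuum-like class of [p]. Either the
    preimage contains [p], and then [S] contains [m] by [f1_descent]; or it is inside [<v>], and
    then [S] is [e(-1)]-torsion modulo [<u>], which [f1_torsion] rules out. *)
Lemma M_exists : exists (M : wmod L) (m u : M),
  [/\ hwvec J m (-1) 0 true, forall q, gen (fun x => x = m) q,
      [/\ u != 0, forall a (n : nat), op a n u = 0, homog false u & wdeg M u = u],
      sum_rel J m = - u
    & forall S : M -> Prop, wsub S -> S u ->
        (exists s, S s /\ ~ gen (fun x => x = u) s) -> S m].
Proof.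
have [P [p [p_hw p_cyc inj [v [yp v_hw v_rel]]]]] := P_exists hJ hgen hirr.
have [Q [i [hl lx ly lhw]]] := locE_exists hJ hgen inj.
have m3_hw := lhw _ _ _ p_hw.
have m3_rel : sum_rel J (i p) = - i (E v).
  rewrite /sum_rel ly yp lx mdNr -scaleN1r (ilZ hl) scaleN1r.
  by rewrite subrK.
have [M [m [j [hj jinj em m_cyc lift]]]] := cyc_exists (i p).
have m_hw : hwvec J m (-1) 0 true by apply: (hwvec_reflect hj jinj); rewrite em.
pose u := - sum_rel J m.
have eu : j u = i (E v).
  by rewrite /u -scaleN1r (whomZ hj) (sum_rel_hom J _ hj) em m3_rel scaleN1r opprK.
have [[vx vy vf] vt vd vp vnz] := v_hw.
have u_nz : u != 0.
  apply/eqP => u0; move: eu; rewrite u0 (whom0 hj) => /esym/(il_inj hl)/inj/eqP.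
  by rewrite (negPf vnz).
have u3x (n : nat) : op x_ n (i (E v)) = 0.
  by rewrite lx (swap_xe hJ) vx md0r (il0 hl).
(* For [n = 0], moving [y(0)] past [e(-1)] produces [x(-1) v], of which the twist removes half; what
   is left is [sum_rel J v = 0]. *)
have u3y (n : nat) : op y_ n (i (E v)) = 0.
  apply: (il_Einj hl); rewrite ly (swap_ye hJ).
  case: n => [|n].
    rewrite -scaleNr -(ilZ hl) -(ilD hl) (swap_xe hJ) -mdZr -mdDr.
    have -> : op x_ (0 + -1) v + E (op y_ 0%N v) + - (1 / 2) *: op x_ (0%N%:Z - 1) v = sum_rel J v.
      change (op x_ (-1) v + E (op y_ 0 v) + - (1 / 2) *: op x_ (-1) v = sum_rel J v).
      by rewrite /sum_rel; lmod_coef K P; field.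
    by rewrite v_rel md0r (il0 hl).
  have -> : n.+1%:Z + -1 = n by lia.
  by rewrite (swap_xe hJ) vx vy !md0r addr0 !md0r (il0 hl) scaler0 subr0.
have u_vac a (n : nat) : op a n u = 0.
  apply: (vacuum_current_all hJ); split=> l; apply: jinj;
    by rewrite (wh_act hj) eu (whom0 hj) ?u3x ?u3y.
have u_par : homog false u.
  apply: jinj; rewrite (wh_par hj) (whomZ hj) eu (il_par hl).
  by rewrite (current_par hJ) vp /= !expr0 !scale1r.
have u_deg : wdeg M u = u.
  apply: jinj; rewrite (wh_deg hj) eu (il_deg hl) (current_deg hJ) vd.
  by rewrite scale0r md0r sub0r mulrN1z scaleN1r opprK.
exists M, m, u; split=> //; first by rewrite /u opprK.
move=> S hS Su [s0 [Ss0 nGs0]].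
have hG : wsub (gen (fun x : M => x = u)) := gen_sub _.
have [s [c1 [c2 [Ss nGs [n1 e1] [n2 e2] [sd sw]]]]] := hw_joint hJ hgen m_hw m_cyc hS hG Ss0 nGs0.
rewrite {}e1 add0r in sd; rewrite {}e2 in sw.
have satE (W : wmod L) (T : W -> Prop) : wsub T -> wsub (saturation (J e_) (-1) T).
  exact: (saturation_sub (current_even_e hJ) (deg_e hJ) (nil_e hJ hgen)).
have hat T : wsub T -> wsub (fun w : P => saturation (J e_) (-1) (fun y => exists2 q, T q & j q = y) (i w)).
  move=> hT; apply: (il_hat hl); first exact/satE/(image_sub hj hT).
  by move=> x; apply: saturation_sat.
pose N2 := gen (fun x : P => x = v).
have hN2 : wsub N2 := gen_sub _.
have N2v : N2 v by apply: gen_in.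
have hatN2 T : wsub T -> T u -> forall w, N2 w ->
    saturation (J e_) (-1) (fun y => exists2 q, T q & j q = y) (i w).
  move=> hT Tu w; apply: (wsub_gen_le (hat T hT)).
  by apply: saturation_sat; exists 0%N, u; rewrite //= eu (il_E hl).
have pull_iter T l q : saturation (J e_) (-1) (fun y => exists2 q, T q & j q = y) (iter l E (j q)) ->
    exists l', T (iter l' E q).
  move=> [l' [q' Tq' e]]; exists (l' + l)%N.
  suff -> : iter (l' + l) E q = q' by [].
  by apply: jinj; rewrite e (whom_iter hj) iterD.
have hS2 := hat S hS.
have [[mx my mf] mt md' mp mnz] := m_hw.
have descent l : S (iter l E m) -> S m.
  apply: (f1_descent hJ (ws_act hS) (ws_lin hS) mf mt).
  exact: half_nonint_nat (-1).
have case1 : saturation (J e_) (-1) (fun y => exists2 q, S q & j q = y) (i p) -> S m.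
  by rewrite -em => /(pull_iter S 0%N) [l]; exact: descent.
apply: contrapT => nSm.
have hatS w : saturation (J e_) (-1) (fun y => exists2 q, S q & j q = y) (i w) -> N2 w.
  move=> hw; have [[px py pf] pt pd pp pnz] := p_hw.
  have pvac a (n : nat) : N2 (op a n p).
    case: n => [|n]; last first.
      by rewrite (singular_pos hJ (hw_sing p_hw)); exact: sub0 (ws_lin hN2).
    have hy : N2 (op y_ 0 p) by rewrite yp; exact: subN (ws_lin hN2) _ N2v.
    have hx : N2 (op x_ 0 p) by rewrite (px 0%N); exact: sub0 (ws_lin hN2).
    case: a => //.
    - by rewrite (e_from_x hJ px 0%N); exact: sub0 (ws_lin hN2).
    - rewrite [op _ _ _](f0_yy hJ); apply: (subN (ws_lin hN2)).
      exact: (ws_act hN2).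
    - by rewrite [op _ _ _]pt scale0r; exact: sub0 (ws_lin hN2).
  have [b hb] : exists b, N2 (w - md (-1) b p).
    apply: (p_cyc w _ (vacuum_span_sub hJ hgen pd pp hN2 pvac)) => _ ->.
    by exists (vac L); rewrite vacuum_vac subrr; exact: sub0 (ws_lin hN2).
  suff b0 : b = 0 by move: hb; rewrite b0 md0l subr0.
  apply: contrapT => /eqP b0; apply/nSm/case1.
  (* The [b] with [b_(-1) p] in the preimage of [S] form a submodule of [L]; if it is nonzero, it
     contains the vacuum and the preimage contains [p]. *)
  have hB := vacuum_preim_sub hJ hgen pd pp hN2 pvac hS2 (hatN2 S hS Su).
  rewrite -(vacuum_vac p); apply: (hirr.2 _ hB); exists b; split=> //.
  have := subB (ws_lin hS2) hw (hatN2 S hS Su _ hb).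
  by rewrite opprB addrC subrK.
have [l [w ew]] := il_repr hl (j s).
have hw : saturation (J e_) (-1) (fun y => exists2 q, S q & j q = y) (i w).
  rewrite -ew; exists 0%N, (iter l E s); last by rewrite (whom_iter hj).
  by elim: l {ew} => //= l; apply: (ws_act hS).
have [l' Gs] : exists l', gen (fun x => x = u) (iter l' E s).
  apply: (pull_iter _ l); rewrite ew; apply: hatN2 (hatS _ hw) => //.
  exact: gen_in.
(* The last power of [e(-1)] that keeps [s] outside [<u>]. *)
have [r nGr GEr] : exists2 r : nat, ~ gen (fun x : M => x = u) (iter r E s)
    & gen (fun x : M => x = u) (iter r.+1 E s).
  elim: l' Gs => // l' IH h.
  by have [/IH//|h'] := pselect (gen (fun x : M => x = u) (iter l' E s)); exists l'.
have rw : op h_ 0 (iter r E s) = (-1 + n2%:~R + 2 * r%:R) *: iter r E s.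
  elim: r {nGr GEr} => [|r IH]; first by rewrite mulr0 addr0.
  by rewrite iterS (weight_act hJ) IH mdZr -natr1 /=; lmod_ring K M.
have rd : wdeg M (iter r E s) = (n1 + r)%:R *: iter r E s.
  by rewrite (iter_deg (deg_e hJ)) sd iterZ mulr1 natrD scalerDl.
(* The vector has degree [n1 + r] and [M] has no negative degrees, so [n1 + r + 1] applications of
   [f(1)] annihilate it. Integral weights avoid the half-integral [k]. *)
apply: nGr; refine (f1_torsion (n := (n1 + r).+1) hJ hG rw GEr _ _) => [a|].
  have := half_nonint K (-1 + n2 + 2 * r%:Z - a%:Z).
  by congr (_ != _); rewrite !intrD intrN !intrM; ring.
have fd a : wdeg M (iter a (op f_ 1) (iter r E s)) = ((n1 + r)%:R - a%:R) *: iter a (op f_ 1) (iter r E s).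
  elim: a => [|a IH]; first by rewrite subr0.
  by rewrite iterS (current_deg hJ) IH mdZr -natr1; lmod_ring K M.
have -> : iter (n1 + r).+1 (op f_ 1) (iter r E s) = 0; last exact: sub0 (ws_lin hG).
apply: (hw_deg_ge hJ hgen m_hw m_cyc (fd _)) => a; rewrite add0r -natr1 opprD addrA subrr sub0r.
by rewrite eq_sym -subr_eq0 opprK natr1 pnatr_eq0.
Qed.

End Extension.

(** * The Sugawara vector *)

(** Every vector of the submodule is some [b_(-1) x], and passing from [b] to [b_(-1) x] shifts the
    half-natural degrees of [L] by [d]. *)
Lemma vacuum_gen_deg (K : numFieldType) (k : K) (L : vsa K) (J : osp -> L)
    (hJ : osp_currents k J) (hgen : generates J) (W : wmod L) (x y : W) d p e :
  wdeg W x = d *: x -> homog p x -> (forall a (n : nat), md n (J a) x = 0) ->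
  gen (fun z => z = x) y -> wdeg W y = e *: y ->
  (forall c, half_nat c -> c + d != e) -> y = 0.
Proof.
move=> hd hp hx hy he hne.
have [b eb] := (vacuum_gen hJ hgen hd hp hx y).1 hy.
have sT : subspace (fun _ : L => True) by [].
have [r [hr er]] := semisimple_sub (T := vdeg) sT (fun _ _ => I)
  (hg_semisimple (vsa_grading L)) (I : (fun _ : L => True) b).
have := eigen_decomposition (T := wdeg W) (s := r) (u := fun z => md (-1) z.2 x)
  (c := fun z => z.1 + d) _ he.
rewrite -{1}eb {1}er md_suml => /(_ _ erefl) ->.
  rewrite big_seq_cond big1 // => z /andP[/hr[hz _ _] /eqP ez].
  by have := hne _ hz; rewrite ez eqxx.
move=> z /hr[_ _ hz]; rewrite (vacuum_mode_deg hd) hz mdZl; lmod_ring K W.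
Qed.

Section Sugawara.
Variables (K : numFieldType) (L : vsa K) (J : osp -> L).
Local Notation k := (- (3 / 2) : K).
Hypothesis hJ : osp_currents k J.
Local Notation op a n := (md n (J a)).

Section Vector.
Variables (W : wmod L) (u : W).

(** The quadratic Casimir element of [osp_form], where [h] is dual to [h / 2] and [(x, y) = 2],
    built on a vector [u] in place of the vacuum. *)
Definition sugawara : W := op e_ (-1) (op f_ (-1) u) + op f_ (-1) (op e_ (-1) u)
  + (1 / 2) *: op h_ (-1) (op h_ (-1) u)
  - (1 / 2) *: (op x_ (-1) (op y_ (-1) u) - op y_ (-1) (op x_ (-1) u)).

Hypothesis hu : forall a (n : nat), op a n u = 0.

Let swap0 a b (w : W) : op a 0 (op b (-1) w) =
  (osp_bracket a b).1%:~R *: op (osp_bracket a b).2 (-1) w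
  + (-1) ^+ (osp_odd a && osp_odd b) *: op b (-1) (op a 0 w).
Proof. by rewrite (current_swap hJ) /= scale0r addr0. Qed.
Let swap1 a b (w : W) : op a 1 (op b (-1) w) =
  (osp_bracket a b).1%:~R *: op (osp_bracket a b).2 0 w
  + ((osp_form a b)%:~R * k) *: w
  + (-1) ^+ (osp_odd a && osp_odd b) *: op b (-1) (op a 1 w).
Proof. by rewrite (current_swap hJ) /= mul1r. Qed.
Let swap2 a b (n : nat) (w : W) : op a n.+2 (op b (-1) w) =
  (osp_bracket a b).1%:~R *: op (osp_bracket a b).2 n.+1 w
  + (-1) ^+ (osp_odd a && osp_odd b) *: op b (-1) (op a n.+2 w).
Proof. by rewrite (current_swap hJ) /= scale0r addr0. Qed.
Let swapN a b (w : W) : op a (-1) (op b (-1) w) =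
  (osp_bracket a b).1%:~R *: op (osp_bracket a b).2 (-2) w
  + (-1) ^+ (osp_odd a && osp_odd b) *: op b (-1) (op a (-1) w).
Proof. by rewrite (current_swap hJ) /= scale0r addr0. Qed.
Let u0 a : op a 0 u = 0. Proof. exact: hu a 0%N. Qed.
Let u1 a : op a 1 u = 0. Proof. exact: hu a 1%N. Qed.

(* At the critical level, and only there, [sugawara] is vacuum-like. *)
Lemma sugawara_vacuum a (n : nat) : op a n sugawara = 0.
Proof.
have key b (m : nat) : (b = x_) \/ (b = y_) -> op b m sugawara = 0.
  move=> hb; rewrite /sugawara !(mdDr, mdNr, mdZr).
  case: m => [|[|[|m]]].
  - rewrite !swap0; case: hb => -> /=.
      rewrite !(u0, md0r, mdDr, mdZr) (swapN y_ e_) (swapN x_ h_) /=.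
      by rewrite !(u0, md0r, mdDr, mdZr, expr0, expr1); lmod_coef K W; field.
    rewrite !(u0, md0r, mdDr, mdZr) (swapN x_ f_) (swapN y_ h_) /=.
    by rewrite !(u0, md0r, mdDr, mdZr, expr0, expr1); lmod_coef K W; field.
  - rewrite !swap1; case: hb => -> /=;
    rewrite !(swap0, swap1) /= !(u0, u1, md0r, mdDr, mdZr, expr0, expr1);
    by lmod_coef K W; field.
  - rewrite !swap2; case: hb => -> /=;
    rewrite !(swap1, swap2) /= !(u0, u1, hu, md0r, mdDr, mdZr, expr0, expr1);
    by lmod_coef K W; field.
  - rewrite !swap2; case: hb => -> /=;
    rewrite !(hu, md0r, mdDr, mdZr, expr0, expr1);
    by lmod_coef K W; field.
by apply: (vacuum_current_all hJ); split=> m; apply: key; [left|right].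
Qed.

Lemma sugawara_par : homog false u -> homog false sugawara.
Proof.
rewrite /homog !expr0 !scale1r /sugawara => hu'.
rewrite !(linearD, linearB, linearN, linearZ) /=.
rewrite !(current_par hJ) !hu' !mdZr /= !expr0 !expr1.
by lmod_coef K W; field.
Qed.

Lemma sugawara_deg : wdeg W u = 0 -> wdeg W sugawara = 2 *: sugawara.
Proof.
move=> hd; rewrite /sugawara !(linearD, linearB, linearN, linearZ) /=.
rewrite !(current_deg hJ) !hd !(mdBr, md0r, mdZr).
by lmod_coef K W; field.
Qed.
End Vector.

Hypothesis hgen : generates J.
Hypothesis hirr : wirr (adjoint_w L).
Local Notation A := (adjoint_w L).

(** If nonzero it would generate the vacuum; but being vacuum-like of degree 2, it generates only
    vectors of degree at least 2. *)
Lemma sugawara_eq0 : sugawara (vac L : A) = 0.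
Proof.
have hv a (n : nat) : md (W := A) n (J a) (vac L) = 0 := vac_regular n (J a).
apply: contrapT => /eqP nz.
have hp : homog false (sugawara (vac L : A)) := sugawara_par (W := A) (vac_even L).
have hd0 : wdeg A (vac L) = 0 := vdeg_vac L.
have hd := sugawara_deg (W := A) hd0.
have g : gen (fun z : A => z = sugawara (vac L : A)) (vac L : A).
  by apply: (hirr.2 _ (gen_sub _)); exists (sugawara (vac L : A)); split=> //; apply: gen_in.
have e0 : wdeg A (vac L) = 0 *: vac L by rewrite scale0r.
move: (vac_neq0 hirr); rewrite (vacuum_gen_deg hJ hgen hd hp (sugawara_vacuum hv) g e0) ?eqxx //.
by move=> c /half_nat_ge0 c0; rewrite gt_eqF // ltr_wpDl.
Qed.

Section Casimir.
Variables (W : wmod L) (v : W) (t : K).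
Hypotheses (hv : singular J v) (ht : op h_ 0 v = t *: v).

(** Mode 1 of a product of two vectors of degree 1 preserves the degree. On a singular vector a
    single normally ordered term survives, with the two factors interchanged. *)
Lemma casimir_term a b : md 1 (md (W := A) (-1) (J a) (md (W := A) (-1) (J b) (vac L))) v
  = (-1) ^+ (osp_odd a && osp_odd b) *: op b 0 (op a 0 v).
Proof.
have hpos := singular_pos hJ hv.
have -> : md (W := A) (-1) (J b) (vac L) = J b by exact: vac_creation'.
rewrite [LHS](@md_assoc _ _ W _ _ (J a) (J b) 1 (-1) 1 v (oc_parity hJ a) (oc_parity hJ b)).
- rewrite big_ord_recl big_ord0 addr0 expr0 zbinom0r mulr1 scale1r.
  have -> : op b (1 + (ord0 : 'I_1)%:Z) v = 0 by exact: hpos b 0%N.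
  rewrite md0r sub0r -scaleNr; congr (_ *: _).
  by rewrite expN1r /= mulN1r opprK.
- by move=> [|j] // _; exact: hpos b j.+1.
- by move=> [|j] // _; exact: hpos a j.
Qed.

Lemma casimir : v != 0 -> t = 0 \/ t = -1.
Proof.
move=> nz; have [hx _ _] := hv; have hx0 : op x_ 0 v = 0 := hx 0%N.
have he0 : op e_ 0 v = 0 := e_from_x hJ hx 0%N.
have := md0l 1 v; rewrite -sugawara_eq0 /sugawara !(mdDl, mdNl, mdZl) !casimir_term /=.
have ef : op e_ 0 (op f_ 0 v) = t *: v.
  rewrite (current_swap hJ) he0 md0r /= !mul0r scale0r addr0 scaler0 addr0.
  by rewrite /= ht scale1r.
have xy : op x_ 0 (op y_ 0 v) = t *: v by rewrite (swap_x0y0 hJ) hx0 md0r subr0.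
rewrite he0 hx0 !md0r ef xy ht mdZr ht expr0 expr1 => e.
(* The surviving terms are [t] from [e, f], [t^2 / 2] from [h], and [- t / 2] from the odd part. *)
have : (t * (t + 1) / 2) *: v = 0 by rewrite -[RHS]e; lmod_coef K W; field.
move/eqP; rewrite scaler_eq0 (negPf nz) orbF mulf_eq0 invr_eq0 pnatr_eq0 orbF mulf_eq0.
case/orP => /eqP h; [by left | right].
by apply/eqP; rewrite -subr_eq0 opprK h.
Qed.
End Casimir.
End Sugawara.

(** * Uniqueness of irreducible highest weight modules *)

Lemma whom_inverse (K : numFieldType) (L : vsa K) (W W' : wmod L) (f : W -> W') :
  whom f -> injective f -> (forall w', exists w, f w = w') ->
  exists2 g : W' -> W, whom g & cancel f g /\ cancel g f.
Proof.
move=> hf inj surj; have [g gK] := choice surj.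
exists g; last by split=> // w; apply: inj; rewrite gK.
split.
- by move=> c u v; apply: inj; rewrite (wh_lin hf) !gK.
- by move=> n a w; apply: inj; rewrite (wh_act hf) !gK.
- by move=> w; apply: inj; rewrite (wh_par hf) !gK.
- by move=> w; apply: inj; rewrite (wh_deg hf) !gK.
Qed.

Section Product.
Variables (K : numFieldType) (L : vsa K) (W1 W2 : wmod L).
Let U := (W1 * W2)%type.

Let par (w : U) : U := (sv_par W1 w.1, sv_par W2 w.2).
Lemma prod_par_linear : linear par.
Proof. by move=> c u v; rewrite /par /= !linearP. Qed.
HB.instance Definition _ := GRing.isLinear.Build K U U _ par prod_par_linear.
Lemma prod_parK : involutive par.
Proof. by case=> u v; rewrite /par /= !sv_parK. Qed.
Definition prod_super : superVec K := SuperVec (prod_parK).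

Let deg (w : U) : U := (wdeg W1 w.1, wdeg W2 w.2).
Lemma prod_deg_linear : linear deg.
Proof. by move=> c u v; rewrite /deg /= !linearP. Qed.
HB.instance Definition _ := GRing.isLinear.Build K U U _ deg prod_deg_linear.

Let act (n : int) (a : L) (w : prod_super) : prod_super :=
  (md n a (w : U).1, md n a (w : U).2).

Lemma prod_action : is_vertex_action (vac L) (@vprod K L) act.
Proof.
split.
- by move=> n w c a b; rewrite /act !mdPl.
- by move=> n a c u v; rewrite /act /= !linearP.
- by move=> n a w; rewrite /act /= /par /= !md_par.
- move=> a [u v].
  have [N1 h1] := md_trunc a u; have [N2 h2] := md_trunc a v.
  exists (maxn N1 N2) => n hn; rewrite /act /= h1 ?h2 //; apply: le_trans hn.
    by rewrite lez_nat leq_maxr.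
  by rewrite lez_nat leq_maxl.
- by move=> n [u v]; rewrite /act !md_vac /=; case: eqP.
- move=> p q a b ha hb [u v] l m n.
  have [N1 h1] := va_borcherds (w_action W1) ha hb u l m n.
  have [N2 h2] := va_borcherds (w_action W2) ha hb v l m n.
  exists (maxn N1 N2) => N; rewrite geq_max => /andP[/h1 e1 /h2 e2].
  have pe (z z' : U) : z.1 = z'.1 -> z.2 = z'.2 -> z = z'.
    by case: z z' => [z1 z2] [z1' z2'] /= -> ->.
  by apply: pe; [rewrite !(raddf_sum (@fst W1 W2)) | rewrite !(raddf_sum (@snd W1 W2))].
Qed.

Definition prod_mod : wmod L.
Proof.
apply: (@Wmod K L prod_super act deg prod_action).
- by case=> u v; congr pair; exact: w_deg_par.
- by move=> n a [u v]; congr pair; exact: md_deg.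
Defined.

End Product.

Section Uniqueness.
Variables (K : numFieldType) (k : K) (L : vsa K) (J : osp -> L).
Hypotheses (hJ : osp_currents k J) (hgen : generates J).

Lemma wirr_image (C W : wmod L) (f : C -> W) (c : C) :
  wirr W -> whom f -> f c != 0 -> forall w, exists q, f q = w.
Proof.
move=> hW hf nz w.
have sT : wsub (fun _ : C => True) by split.
have [] := hW.2 _ (image_sub hf sT) _ w; first by exists (f c); split=> //; exists c.
by move=> q _ <-; exists q.
Qed.

(* If the kernel of [p1] had nonzero image under [p2], that image would
   contain [p2 c], so some vector of the kernel would have the weight and the
   degree of [c], hence be a multiple of [c]. *)
Lemma hw_kernel (C W1 W2 : wmod L) (p1 : C -> W1) (p2 : C -> W2) (c : C) t d p :
  hwvec J c t d p -> (forall q, gen (fun z => z = c) q) -> wirr W2 ->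
  whom p1 -> whom p2 -> (forall q, p1 q = 0 -> p2 q = 0 -> q = 0) ->
  p1 c != 0 -> p2 c != 0 -> forall q, p1 q = 0 -> q = 0.
Proof.
move=> [hs ht hd hp nz] hc hW h1 h2 hi nz1 nz2 q q0; apply: (hi) => //.
apply: contrapT => /eqP qn.
have [] := hW.2 _ (image_sub h2 (preim_sub h1 (wsub_zero W1))) _ (p2 c).
  by exists (p2 q); split=> //; exists q.
move=> z z1 z2.
have eigen (T1 : W1 -> W1) (T2 : W2 -> W2) (T : C -> C) (a : K) :
    (forall w, p1 (T w) = T1 (p1 w)) -> (forall w, p2 (T w) = T2 (p2 w)) ->
    T1 0 = 0 -> T c = a *: c -> T z = a *: z.
  move=> e1 e2 T10 Tc; apply/eqP; rewrite -subr_eq0; apply/eqP; apply: hi.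
    by rewrite (whomB h1) (whomZ h1) e1 z1 T10 scaler0 subr0.
  by rewrite (whomB h2) (whomZ h2) e2 z2 -e2 Tc (whomZ h2) subrr.
have zd : wdeg C z = d *: z.
  by apply: (eigen _ _ _ _ (wh_deg h1) (wh_deg h2)) => //; rewrite linear0.
have zt : md 0 (J h_) z = t *: z.
  by apply: (eigen _ _ _ _ (wh_act h1 0 (J h_)) (wh_act h2 0 (J h_))) => //; rewrite md0r.
have [a ea] := hw_top_weight hJ hgen hs ht hd hp hc zd zt.
move: z1; rewrite ea (whomZ h1) => /eqP; rewrite scaler_eq0 (negPf nz1) orbF => /eqP a0.
by move: nz2; rewrite -z2 ea a0 scale0r (whom0 h2) eqxx.
Qed.

Lemma hw_unique (W1 W2 : wmod L) (v1 : W1) (v2 : W2) t d p :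
  wirr W1 -> wirr W2 -> hwvec J v1 t d p -> hwvec J v2 t d p ->
  exists f : W1 -> W2, whom f /\ bijective f.
Proof.
move=> i1 i2 [s1 t1 d1 p1 n1] [s2 t2 d2 p2 n2].
have [C [c [i [hi ii ic hc _]]]] := cyc_exists ((v1, v2) : prod_mod W1 W2).
have pe (z z' : prod_mod W1 W2) : z.1 = z'.1 -> z.2 = z'.2 -> z = z'.
  by case: z z' => [z1 z2] [z1' z2'] /= -> ->.
have hcv : hwvec J c t d p.
  apply: (hwvec_reflect hi ii); rewrite ic; have [a1 b1 c1] := s1; have [a2 b2 c2] := s2; split.
  - by split=> [n|n|]; apply: pe; rewrite /= ?(a1, b1, c1) ?(a2, b2, c2).
  - by apply: pe.
  - by apply: pe.
  - by apply: pe.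
  - by apply: contraNneq n1 => e; rewrite -[v1]/((v1, v2) : prod_mod W1 W2).1 e.
pose q1 z := (i z).1; pose q2 z := (i z).2.
have h1 : whom q1.
  split=> [a u v|n a u|u|u]; rewrite /q1; first by rewrite (wh_lin hi).
  - by rewrite (wh_act hi).
  - by rewrite (wh_par hi).
  - by rewrite (wh_deg hi).
have h2 : whom q2.
  split=> [a u v|n a u|u|u]; rewrite /q2; first by rewrite (wh_lin hi).
  - by rewrite (wh_act hi).
  - by rewrite (wh_par hi).
  - by rewrite (wh_deg hi).
have m1 : q1 c != 0 by rewrite /q1 ic.
have m2 : q2 c != 0 by rewrite /q2 ic.
have j12 z : q1 z = 0 -> q2 z = 0 -> z = 0.
  by move=> e1 e2; apply: ii; rewrite (whom0 hi); apply: pe.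
have k1 := hw_kernel hcv hc i2 h1 h2 j12 m1 m2.
have k2 := hw_kernel hcv hc i1 h2 h1 (fun z e e' => j12 z e' e) m2 m1.
have [g hg [gK Kg]] := whom_inverse h1 (whom_inj h1 k1) (wirr_image i1 h1 m1).
have [g' hg' [gK' Kg']] := whom_inverse h2 (whom_inj h2 k2) (wirr_image i2 h2 m2).
exists (q2 \o g); split; last by exists (q1 \o g') => w /=; rewrite ?gK' ?gK ?Kg ?Kg'.
split=> [a u v|n a u|u|u] /=; first by rewrite (wh_lin hg) (wh_lin h2).
- by rewrite (wh_act hg) (wh_act h2).
- by rewrite (wh_par hg) (wh_par h2).
- by rewrite (wh_deg hg) (wh_deg h2).
Qed.
End Uniqueness.

(** * Parity reversal and degree shifts *)

Section Twist.
Variables (K : numFieldType) (L : vsa K) (W : wmod L) (b : bool) (s : K).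

Let par (w : W) : W := (-1) ^+ b *: sv_par W w.
Lemma twist_par_linear : linear par.
Proof. by move=> c u v; rewrite /par linearP; lmod_ring K W. Qed.
HB.instance Definition _ := GRing.isLinear.Build K W W _ par twist_par_linear.
Lemma twist_parK : involutive par.
Proof. by move=> w; rewrite /par linearZ sv_parK scalerA /= -signr_addb addbb scale1r. Qed.
Definition twist_super : superVec K := SuperVec twist_parK.

Let deg (w : W) : W := wdeg W w + s *: w.
Lemma twist_deg_linear : linear deg.
Proof. by move=> c u v; rewrite /deg linearP; lmod_ring K W. Qed.
HB.instance Definition _ := GRing.isLinear.Build K W W _ deg twist_deg_linear.

Lemma twist_action :
  is_vertex_action (M := twist_super) (vac L) (@vprod K L) (@wact K L W).
Proof.
have [h1 h2 h3 h4 h5 h6] := w_action W.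
split=> // n a m; rewrite /= /par h3.
exact: (esym (mdZr n _ _ _)).
Qed.

(** The modes are unchanged. This brings two highest weight vectors of equal weight to the same
    degree and parity, as [hw_unique] requires. *)
Definition twist_mod : wmod L.
Proof.
apply: (@Wmod K L twist_super (@wact K L W) deg twist_action).
- by move=> w; rewrite /= /deg /par linearZ /= w_deg_par linearD [sv_par W (s *: w)]linearZ /=; lmod_ring K W.
- move=> n a w; change (wdeg W (md n a w) + s *: md n a w =
    md n (vdeg a) w + md n a (wdeg W w + s *: w) - (n + 1)%:~R *: md n a w).
  by rewrite md_deg mdDr mdZr; lmod_ring K W.
Defined.

Lemma twist_irr : wirr W -> wirr twist_mod.
Proof.
move=> [nz h]; split=> // S [hl ha hp hd]; apply: h; split=> // w Sw.
- by have := subZ hl ((-1) ^+ b) (hp w Sw); rewrite /= /par scalerA -signr_addb addbb scale1r.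
- by have := subB hl (hd w Sw) (subZ hl s Sw); rewrite /= /deg addrK.
Qed.

Lemma twist_hwvec (J : osp -> L) (v : W) t d p :
  hwvec J v t d p -> hwvec J (v : twist_mod) t (d + s) (p (+) b).
Proof.
move=> [hs ht hd hp nz]; split=> //.
  by rewrite /= /deg hd scalerDl.
by rewrite /homog /= /par hp scalerA -signr_addb addbC.
Qed.
End Twist.

Lemma hw_iso (K : numFieldType) (k : K) (L : vsa K) (J : osp -> L)
    (W1 W2 : wmod L) (v1 : W1) (v2 : W2) t d1 d2 p1 p2 :
  osp_currents k J -> generates J -> wirr W1 -> wirr W2 ->
  hwvec J v1 t d1 p1 -> hwvec J v2 t d2 p2 ->
  exists f : W1 -> W2, [/\ linear f, forall n a w, f (md n a w) = md n a (f w),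
    exists p : bool, forall w, f (sv_par W1 w) = (-1) ^+ p *: sv_par W2 (f w) & bijective f].
Proof.
move=> hJ hgen i1 i2 h1 h2.
have := twist_hwvec (p2 (+) p1) (d1 - d2) h2; rewrite [d2 + _]addrC subrK addKb => h2'.
have [f [[fl fa fp _] fb]] := hw_unique hJ hgen i1 (twist_irr (p2 (+) p1) (d1 - d2) i2) h1 h2'.
by exists f; split=> //; exists (p2 (+) p1).
Qed.

(** * The nonsplit extension *)

Lemma linear_facts (K : pzRingType) (U V : lmodType K) (f : U -> V) : linear f ->
  [/\ f 0 = 0, forall x y, f (x + y) = f x + f y & forall c x, f (c *: x) = c *: f x].
Proof.
move=> fl; have f0 : f 0 = 0.
  by have := fl (-1) 0 0; rewrite scaler0 addr0 scaleN1r addNr.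
by split=> // [x y|c x]; [have := fl 1 x y; rewrite !scale1r | rewrite -[c *: x]addr0 fl f0 addr0].
Qed.

Section Extension.
Variables (K : numFieldType) (L : vsa K) (J : osp -> L).
Local Notation k := (- (3 / 2) : K).
Hypotheses (hJ : osp_currents k J) (hgen : generates J).
Hypothesis hirr : wirr (adjoint_w L).
Local Notation A := (adjoint_w L).

Lemma vacuum_no_singular (a : A) :
  singular J a -> md 0 (J h_) a = -1 *: a -> a = 0.
Proof.
move=> hs ht; apply: contrapT => /eqP nz.
have inj (w : A) : md 0 (J f_) w = 0 -> w = 0.
  refine (torsion_free (current_even_f hJ) (deg_f hJ) (nil_f hJ hgen) hirr (v := a) _ (w := w)) => i.
  exact: (f0_pow_neq0 hJ i nz hs ht).
by have /eqP := inj (vac L) (vac_regular 0%N (J f_)); rewrite (negPf (vac_neq0 hirr)).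
Qed.

Lemma singular_reflectJ (W W' : wmod L) (f : W -> W') (w : W) :
  f 0 = 0 -> injective f -> (forall a n w, f (md n (J a) w) = md n (J a) (f w)) ->
  singular J (f w) -> singular J w.
Proof.
move=> f0 inj fa [hx hy hf].
by split=> [n|n|]; apply: inj; rewrite fa f0.
Qed.

Lemma extension_exists : exists (M N : wmod L) (m u : M) (pr : M -> N),
  [/\ hwvec J m (-1) 0 true /\ (forall q, gen (fun z => z = m) q),
      [/\ u != 0, homog false u, wdeg M u = u, forall a (n : nat), md n (J a) u = 0
        & sum_rel J m = - u],
      injective (fun b : L => md (-1) b u),
      [/\ whom pr, forall q, exists x, pr x = q
        & forall x, pr x = 0 <-> exists b : L, md (-1) b u = x]
    & wirr N /\ hwvec J (pr m) (-1) 0 true].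
Proof.
have [M [m [u [m_hw m_cyc [u0 u_vac u_par u_deg] rel max]]]] := M_exists hJ hgen hirr.
have u_deg1 : wdeg M u = 1 *: u by rewrite scale1r.
have hB : wsub (gen (fun z => z = u)) := gen_sub _.
have pr0 := quot_pr_eq0 hB; have prh := quot_pr_hom hB; have prS := @quot_pr_surj _ _ _ _ hB.
move: (quot_mod hB) (quot_pr hB) pr0 prh prS => N pr pr0 prh prS.
(* The vector [m] has degree 0, whereas [<u>] lives in degrees at least 1. *)
have prm : pr m != 0.
  apply/eqP => /pr0 g; move: (hw_nz m_hw).
  rewrite (vacuum_gen_deg hJ hgen u_deg1 u_par u_vac g (hw_deg m_hw)) ?eqxx //.
  by move=> c /half_nat_ge0 c0; rewrite gt_eqF // ltr_wpDl.
exists M, N, m, u, pr; split=> //.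
(* The kernel of [b |-> b_(-1) u] is a submodule of [L]; if nonzero it would contain the vacuum, and
   [u] would be 0. *)
- have hK := vacuum_preim_sub hJ hgen u_deg1 u_par (wsub_zero M) u_vac (wsub_zero M) (fun w h => h).
  move=> b c /eqP; rewrite -subr_eq0 -mdBl => /eqP e; apply/eqP; rewrite -subr_eq0.
  apply: contraNT u0 => nz; apply/eqP; rewrite -(vacuum_vac u).
  exact: (hirr.2 _ hK (ex_intro _ (b - c) (conj e nz))).
- split=> // x; rewrite pr0; exact: (vacuum_gen hJ hgen u_deg1 u_par u_vac x).
- split; last exact: (hwvec_image prh prm m_hw).
  split; first by exists (pr m).
  move=> S hS [q [Sq nq]] q'; have [x ex] := prS q; have [x' <-] := prS q'.
  have hT := preim_sub prh hS.
  apply: (wsub_gen_le hT _ (m_cyc x')); apply: (max _ hT).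
    have -> : pr u = 0 by apply/pr0; apply: gen_in.
    exact: sub0 (ws_lin hS).
  by exists x; split; [rewrite ex | move=> /pr0 e; move: nq; rewrite -ex e eqxx].
Qed.

(** A section changes [m] by some [b_(-1) u] with [b] singular of weight -1, so [b = 0] and
    [s (pr m) = m]. But applying [sum_rel J] gives 0 on [pr m] and [- u] on [m]. *)
Lemma extension_nonsplit (M N : wmod L) (m u : M) (pr : M -> N) (s : N -> M) d p :
  hwvec J m (-1) d p -> u != 0 -> (forall a (n : nat), md n (J a) u = 0) ->
  sum_rel J m = - u -> injective (fun b : L => md (-1) b u) ->
  whom pr -> (forall x, pr x = 0 <-> exists b : L, md (-1) b u = x) ->
  linear s -> (forall n a q, s (md n a q) = md n a (s q)) -> ~ cancel s pr.
Proof.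
move=> [hs ht _ _ _] u0 u_vac rel inj prh prK sl sa sK.
have [s0 sD sZ] := linear_facts sl.
have [b eb] : exists b : L, md (-1) b u = s (pr m) - m.
  by apply/prK; rewrite (whomB prh) sK subrr.
have bs : singular J (b : A).
  apply: (singular_reflectJ (f := fun b : A => md (-1) b u)) => //.
  - exact: md0l.
  - by move=> a n w; exact: (vacuum_hom hJ hgen u_vac n (J a) w).
  have [hx hy hf] := hs.
  rewrite eb; split=> [n|n|]; rewrite mdBr -sa -(wh_act prh) ?(hx, hy, hf) subr0.
  - by rewrite (whom0 prh).
  - by rewrite (whom0 prh).
  - by rewrite (whom0 prh).
have bt : md 0 (J h_) (b : A) = -1 *: (b : A).
  apply: inj; rewrite [LHS](vacuum_hom hJ hgen u_vac 0 (J h_) b) mdZl eb mdBr -sa -(wh_act prh).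
  by rewrite ht (whomZ prh) sZ scalerBr.
move: eb; rewrite (vacuum_no_singular bs bt) md0l => /esym/eqP; rewrite subr_eq0 => /eqP em.
have : s (pr (sum_rel J m)) = - u.
  rewrite (sum_rel_hom J m prh) /sum_rel sD sZ !sa em; exact: rel.
have -> : pr (sum_rel J m) = 0.
  by apply/prK; exists (- vac L); rewrite rel mdNl vacuum_vac.
by move/eqP; rewrite s0 eq_sym oppr_eq0 (negPf u0).
Qed.

Lemma vacuum_not_iso (N : wmod L) (n0 : N) d p (f : A -> N) :
  hwvec J n0 (-1) d p -> linear f -> (forall n a q, f (md n a q) = md n a (f q)) ->
  ~ bijective f.
Proof.
move=> [hs ht _ _ nz] fl fa [g gK Kg].
have [f0 fD fZ] := linear_facts fl.
have inj := can_inj gK.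
have bs : singular J (g n0).
  by apply: (singular_reflectJ f0 inj) => [a n w|]; rewrite ?fa ?Kg.
have bt : md 0 (J h_) (g n0) = -1 *: (g n0).
  by apply: inj; rewrite fa Kg ht fZ Kg.
by move: nz; rewrite -(Kg n0) (vacuum_no_singular bs bt) f0 eqxx.
Qed.
End Extension.

(** * Category O *)

Lemma vmodule_exists (K : numFieldType) (L : vsa K) (W : wmod L) :
  semisimple_on (wdeg W) (@half_nat K) -> exists M : vmodule L, wmod_of M = W.
Proof.
case: W => wsp wact wdeg ha hp hd hss.
by exists (Vmodule ha (Build_is_half_grading hss hp hd)).
Qed.

Section Translation.
Variables (K : numFieldType) (L : vsa K) (M : vmodule L).
Local Notation W := (wmod_of M).

Lemma is_submodule_wsub (S : {pred M}) :
  is_submodule S -> wsub (W := W) (fun w => w \in S).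
Proof. by case=> h1 h2 h3 h4; split=> //; apply: submod_closed_subspace. Qed.

Lemma wsub_is_submodule (S : W -> Prop) :
  wsub S -> is_submodule (M := M) (fun w => `[< S w >]).
Proof.
move=> [h1 h2 h3 h4]; split; first exact: (subspace_submod_closed h1).
- by move=> n a m /asboolP Sm; apply/asboolP/h2.
- by move=> m /asboolP Sm; apply/asboolP/h3.
- by move=> m /asboolP Sm; apply/asboolP/h4.
Qed.

Lemma irreducible_wirr : irreducible M <-> wirr W.
Proof.
split=> -[nz h]; split=> // S hS [m [Sm m0]] w.
  apply/asboolP; apply: (h _ (wsub_is_submodule hS)).
  by exists m; split=> //; apply/asboolP.
exact: (h _ (is_submodule_wsub hS) (ex_intro _ m (conj Sm m0))).
Qed.
End Translation.

Lemma subspace_span (K : numFieldType) (U : lmodType K) (n : nat) (b : 'I_n -> U) :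
  subspace (fun u => exists c : 'I_n -> K, u = \sum_(i < n) c i *: b i).
Proof.
split=> [|c u v [a ->] [a' ->]].
  by exists (fun _ => 0); rewrite big1 // => i _; rewrite scale0r.
exists (fun i => c * a i + a' i); rewrite scaler_sumr -big_split.
by apply: eq_bigr => i _ /=; rewrite scalerDl scalerA.
Qed.

Definition letters (N : nat) : seq (osp * nat) :=
  [seq (a, m) | a <- [:: e_; f_; h_; x_; y_], m <- iota 0 N].

Fixpoint words (N len : nat) : seq word :=
  if len is len'.+1 then [::] :: allpairs cons (letters N) (words N len') else [:: [::]].

Lemma mem_letters N a n : (n < N)%N -> (a, n) \in letters N.
Proof.
move=> lt; apply/allpairsP; exists (a, n); split=> //=; first by case: a.
by rewrite mem_iota.
Qed.

Lemma mem_words N len wd : (size wd <= len)%N -> (word_degree wd <= N)%N -> wd \in words N len.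
Proof.
elim: len wd => [|len IH] [|[a n] wd] // hs; rewrite word_degree_cons /= => hd.
rewrite in_cons; apply/orP; right; apply: allpairs_f.
  by apply: mem_letters; lia.
by apply: IH => //; lia.
Qed.

Lemma size_word_degree wd : (size wd <= word_degree wd)%N.
Proof. by elim: wd => //= x wd IH; rewrite word_degree_cons; lia. Qed.

Section CategoryO.
Variables (K : numFieldType) (k : K) (L : vsa K) (J : osp -> L).
Hypotheses (hJ : osp_currents k J) (hgen : generates J).
Variables (M : vmodule L) (v : wmod_of M) (t : K) (p : bool).
Hypotheses (hv : hwvec J v t 0 p) (hcyc : forall w, gen (fun x => x = v) w).
Local Notation W := (wmod_of M).

(** The degree leaves finitely many words, and for each word the weight determines the power of
    [y(0)]; one vector per word spans. *)
Lemma hw_weight_fin_dim mu j : fin_dim (@weight_vector K L J M mu j).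
Proof.
case: (hv) => h1 h2 h3 h4 _.
have [idx hidx] : exists idx : word -> nat,
    forall wd (i : nat), t - i%:R + (word_weight wd)%:~R = mu -> idx wd = i.
  suff /choice[f hf] : forall wd, exists n : nat, forall i : nat,
      t - i%:R + (word_weight wd)%:~R = mu -> n = i by exists f.
  move=> wd.
  have [[i ei]|no] := pselect (exists i : nat, t - i%:R + (word_weight wd)%:~R = mu).
    exists i => i'; rewrite -ei => /addIr/addrI/oppr_inj/eqP.
    by rewrite eqr_nat eq_sym => /eqP.
  by exists 0%N => i ei; case: no; exists i.
pose B : seq W := [seq hw_vec J v (wd, idx wd) | wd <- words j j].
exists (size B), (fun i => B`_i) => w [hw1 hw2].
have [s [-> hs]] := hw_span_weight hJ hgen h1 h2 h3 h4 hcyc (hw2 : wdeg W w = _) hw1.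
have hS := subspace_span (fun i : 'I_(size B) => B`_i).
apply: (sub_sum_seq hS) => -[[wd i] c] /hs[/= ed ew] _; apply: (subZ hS).
have ei := hidx _ _ ew.
(* The index [j] counts degrees in halves, while words have integral degree. *)
have jd : j = (2 * word_degree wd)%N.
  by move: ed; rewrite add0r => ed; apply/eqP; rewrite -(eqr_nat K) natrM ed mulrC divfK // pnatr_eq0.
have hB : hw_vec J v (wd, i) \in B.
  rewrite -ei; apply: (map_f (fun wd => hw_vec J v (wd, idx wd))).
  by apply: mem_words; rewrite jd ?mul2n -addnn ?leq_addr // (leq_trans (size_word_degree wd)) ?leq_addr.
have lt := index_mem (hw_vec J v (wd, i)) B; rewrite hB in lt.
exists (fun j => (j == Ordinal lt)%:R).
rewrite (bigD1 (Ordinal lt)) //= eqxx scale1r nth_index // big1 ?addr0 //.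
by move=> l /negPf ->; rewrite scale0r.
Qed.

Lemma hw_category_O : in_category_O J M.
Proof.
split.
- move=> w; have [s [-> hs]] := hw_weight_semisimple hJ hgen hv hcyc w.
  by exists s; split=> // u /hs[c [_ e]]; exists c.
- exact: hw_weight_fin_dim.
exists [:: (t, 0%N)] => mu j w [hw1 hw2] nz.
case: (hv) => h1 h2 h3 h4 _.
have [[|[[wd i] c] s] [e hs]] := hw_span_weight hJ hgen h1 h2 h3 h4 hcyc (hw2 : wdeg W w = _) hw1.
  by move: nz; rewrite e big_nil eqxx.
have [/= ed ew] := hs _ (mem_head _ _).
have jd : j = (2 * word_degree wd)%N.
  by move: ed; rewrite add0r => ed; apply/eqP; rewrite -(eqr_nat K) natrM ed mulrC divfK // pnatr_eq0.
(* [n0] is the degree of the word; [n1] collects the power of [y(0)] and the amount by which the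
   word weight falls short of [2 n0], nonnegative by [word_weight_le]. *)
exists (t, 0%N), (i + `|(2 * word_degree wd)%N%:Z - word_weight wd|)%N, (word_degree wd).
split; rewrite ?inE //=.
rewrite -ew natrD -[X in _ - (_ + X)]/((_ : nat)%:Z%:~R) gez0_abs; last first.
  by rewrite subr_ge0 word_weight_le.
by rewrite intrB -[(_ * _)%N%:~R]/(_%:R) natrM; ring.
Qed.
End CategoryO.

Section Top.
Variables (K : numFieldType) (k : K) (L : vsa K) (J : osp -> L).
Hypotheses (hJ : osp_currents k J) (hgen : generates J).
Variables (W : wmod L) (v : W) (p : bool).
Hypotheses (hv : hwvec J v (-1) 0 p) (hcyc : forall w, gen (fun x => x = v) w).
Local Notation op a n := (md (W := W) n (J a)).

Lemma xcoef_neq0 n : xcoef (-1 : K) n != 0.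
Proof.
rewrite -[n]odd_double_half; have [e1 e2] := xcoefE (-1 : K) n./2.
case: (odd n); first by rewrite add1n e2 oppr_eq0 pnatr_eq0.
by rewrite add0n e1 -opprD oppr_eq0 -mulrS pnatr_eq0.
Qed.

(* A nonzero stable subspace of the top component contains some y(0)^i v by
   weight considerations, and x(0) takes y(0)^(i+1) v to a nonzero multiple of
   y(0)^i v. *)
Lemma top_irr (S : W -> Prop) : subspace S -> (forall w, S w -> wdeg W w = 0) ->
  (forall a w, S w -> S (op a 0 w)) -> (exists w, S w /\ w != 0) ->
  forall w, wdeg W w = 0 -> S w.
Proof.
move=> hS hd hJS [s [Ss s0]] w w0; have [hs ht hdv hp nz] := hv.
have inTop u : wdeg W u = 0 -> top J v u.
  by move=> e; apply: (hw_top hJ hgen hs ht hdv hp hcyc); rewrite e scale0r.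
have Sv : S v.
  have [n [c ec]] := inTop s (hd s Ss).
  have [i ci] : exists i : 'I_n, c i *: iter i (op y_ 0) v != 0.
    apply: contrapT => no; case/eqP: s0; rewrite ec big1 // => i _.
    by apply: contrapT => /eqP ni; case: no; exists i.
  have := eigen_component (T := op h_ 0) hS (hJS h_) (s := enum 'I_n)
    (u := fun i : 'I_n => c i *: iter i (op y_ 0) v)
    (c := fun i : 'I_n => -1 - (i : nat)%:R) (-1 - (i : nat)%:R).
  rewrite !big_enum_cond -ec /= => /(_ _ Ss) key.
  have {key} Si : S (iter i (op y_ 0) v).
    have ci0 : c i != 0 by apply: contraNneq ci => ->; rewrite scale0r.
    apply: (subZI hS ci0); rewrite (big_pred1 i) in key.
      apply: key => j _; rewrite mdZr (ypow_weight hJ ht) !scalerA mulrC //.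
    by move=> j /=; rewrite (inj_eq (addrI _)) eqr_opp eqr_nat.
  elim: (nat_of_ord i) Si => // l IH Sl; apply: IH.
  apply: (subZI hS (xcoef_neq0 l)); rewrite -(x_ypow hJ hs ht); exact: hJS.
apply: (top_gen hS _ (inTop w w0)); elim=> // i IH; exact: hJS.
Qed.
End Top.

(** As [pi] is surjective, submodules over [V] and over [L] are the same, so irreducibility pulls
    back. *)
Lemma pullback_irr_with_top (K : numFieldType) (k : K) (V L : vsa K) (J : osp -> V)
    (pi : {linear V -> L}) (hpi : is_vsa_hom pi) (N : vmodule L) (v : wmod_of N) p :
  let JL := fun a => pi (J a) in
  osp_currents k JL -> generates JL -> (forall l, exists w, pi w = l) ->
  wirr (wmod_of N) -> hwvec JL v (-1) 0 p -> is_irr_with_top J (pullback hpi N) (-1).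
Proof.
move=> JL hJ hgen surj hN hv.
have hcyc w : gen (fun x => x = v) w.
  by apply: (hN.2 _ (gen_sub _)); exists v; split; [apply: gen_in | apply: hw_nz hv].
split; first split.
- by exists v; exact: hw_nz hv.
- move=> S [h1 h2 h3 h4]; apply: ((irreducible_wirr N).2 hN).2; split=> // n a.
  by have [b <-] := surj a => m; exact: h2.
split.
  exists v; have [[hx _ _] ht hd _ nz] := hv; split=> //.
  - by have := hd; rewrite scale0r.
  - exact: (e_from_x hJ hx 0%N).
  - exact: hx 0%N.
move=> S hS hU _ hz hnz m hm.
exact: (top_irr hJ hgen hv hcyc (submod_closed_subspace hS) hU hz hnz hm).
Qed.

(** * Classification *)

Lemma eigen_value (K : numFieldType) (U : lmodType K) (T : {linear U -> U}) (P : K -> Prop)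
    (w : U) c : semisimple_on T P -> w != 0 -> T w = c *: w -> P c.
Proof.
move=> hT nz ec; apply: contrapT => nP; case/eqP: nz.
have sT : subspace (fun _ : U => True) by [].
have [r [hr er]] := semisimple_sub sT (fun _ _ => I) hT (I : (fun _ : U => True) w).
rewrite (eigen_decomposition (T := T) (s := r) (u := snd) (c := fst) _ ec er).
  by rewrite big_seq_cond big1 // => x /andP[/hr[h _ _] /eqP e]; case: nP; rewrite -e.
by move=> x /hr[].
Qed.

Lemma eigen_exists (K : numFieldType) (U : lmodType K) (T : {linear U -> U}) (P : K -> Prop)
    (S : U -> Prop) (w : U) : subspace S -> (forall u, S u -> S (T u)) ->
  semisimple_on T P -> S w -> w != 0 ->
  exists u c, [/\ S u, u != 0, P c & T u = c *: u].
Proof.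
move=> hS hST hT Sw nz; have [r [hr er]] := semisimple_sub hS hST hT Sw.
apply: contrapT => no; case/eqP: nz; rewrite er big_seq big1 // => x xr.
by apply: contrapT => /eqP x0; case: no; have [? ? ?] := hr _ xr; exists x.2, x.1.
Qed.

Section HighestWeightVector.
Variables (K : numFieldType) (k : K) (L : vsa K) (J : osp -> L).
Hypothesis hJ : osp_currents k J.
Variable M : vmodule L.
Local Notation W := (wmod_of M).
Local Notation op a n := (md (W := W) n (J a)).
Hypotheses (hM : exists m : M, m != 0) (hO : in_category_O J M).

(** Weights are scalars without a total order, so the bound is obtained by comparison: a first [i0]
    whose weight lies in a given cone yields [i + n1 + 2 b = 2 n0 + a + i0] between natural numbers,
    hence [i <= 2 j + a + i0]. *)
Lemma cone_bound (s : seq (K * nat)) (mu : K) (j : nat) :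
  exists B : nat, forall (lam : K * nat) (i n1 n0 : nat), lam \in s ->
    mu + i%:R = lam.1 - n1%:R + 2 * n0%:R -> (n0 <= j)%N -> (i < B)%N.
Proof.
elim: s => [|lam s [B hB]]; first by exists 0%N.
have [[i0 [a [b [h hb]]]]|no] := pselect (exists i n1 n0 : nat,
    mu + i%:R = lam.1 - n1%:R + 2 * n0%:R /\ (n0 <= j)%N).
  exists (maxn B (2 * j + a + i0).+1) => lam' i n1 n0; rewrite in_cons => /orP[/eqP ->|hl] e hn.
    have e' : ((i + n1 + (b + b))%N%:R : K) = (n0 + n0 + a + i0)%N%:R.
      rewrite !natrD; apply: (@addrI _ (mu - lam.1)).
      have -> : mu - lam.1 + (i%:R + n1%:R + (b%:R + b%:R))
        = mu + i%:R - lam.1 + n1%:R + 2 * b%:R by ring.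
      rewrite e; have -> : mu = lam.1 - a%:R + 2 * b%:R - i0%:R by rewrite -h addrK.
      by ring.
    by move/eqP: e'; rewrite eqr_nat => /eqP e'; rewrite leq_max; apply/orP; right; lia.
  by rewrite leq_max (hB _ _ _ _ hl e hn).
exists B => lam' i n1 n0; rewrite in_cons => /orP[/eqP ->|hl] e hn; last exact: hB hl e hn.
by case: no; exists i, n1, n0.
Qed.

(** In the lowest degree all positive modes vanish. There [x(0)] raises the weight of an
    [h(0)]-eigenvector, which the cones allow only finitely often; the last nonzero vector is
    singular, and so is a nonzero parity component of it. *)
Lemma category_O_hwvec : exists (v : W) t d p, hwvec J v t d p.
Proof.
have [hss _ [s hs]] := hO.
have hdeg : semisimple_on (wdeg W) (@half_nat K) := hg_semisimple (vm_grading M).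
have sT : subspace (fun _ : W => True) by [].
pose Q (j : nat) := `[< exists w : W, w != 0 /\ wdeg W w = (j%:R / 2) *: w >].
have exQ : exists j, Q j.
  have [m m0] := hM.
  have [w [c [_ w0 [j ->] hw]]] := eigen_exists sT (fun _ _ => I) hdeg (I : (fun _ : W => True) m) m0.
  by exists j; apply/asboolP; exists w.
have [j /asboolP[w [w0 hw]] jmin] := ex_minnP exQ.
have below (u : W) (n : nat) : wdeg W u = (j%:R / 2 - n.+1%:R) *: u -> u = 0.
  move=> hu; apply: contrapT => /eqP u0.
  have [j' ej] := eigen_value hdeg u0 hu.
  have e : (j' + 2 * n.+1)%N = j.
    apply/eqP; rewrite -(eqr_nat K) natrD natrM.
    have -> : j'%:R = j%:R - 2 * n.+1%:R :> K.
      have -> : j'%:R = 2 * (j'%:R / 2) :> K by rewrite mulrC divfK // pnatr_eq0.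
      by rewrite -ej; field.
    by rewrite subrK.
  have := jmin j'; rewrite -e; suff -> : Q j' by move=> /(_ isT); lia.
  by apply/asboolP; exists u; rewrite -ej.
have hU : subspace (fun u : W => wdeg W u = (j%:R / 2) *: u).
  split=> [|c a b ha hb]; first by rewrite linear0 scaler0.
  by rewrite linearP ha hb scalerDr !scalerA mulrC.
have opd a (n : nat) (u : W) : wdeg W u = (j%:R / 2) *: u ->
    wdeg W (op a n u) = (j%:R / 2 - n%:R) *: op a n u.
  by move=> hu; rewrite (current_deg hJ) hu mdZr scalerBl.
have op0 a (u : W) : wdeg W u = (j%:R / 2) *: u -> wdeg W (op a 0 u) = (j%:R / 2) *: op a 0 u.
  by move=> /(opd a 0%N); rewrite subr0.
have [u [mu [hu u0 _ hmu]]] := eigen_exists (T := op h_ 0) hU (op0 h_) hss hw w0.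
pose x i : W := iter i (op x_ 0) u.
have xd i : wdeg W (x i) = (j%:R / 2) *: x i.
  by elim: i => // i IH; exact: op0.
have xh i : op h_ 0 (x i) = (mu + i%:R) *: x i.
  elim: i => [|i IH]; first by rewrite addr0.
  rewrite /x iterS -/(x i) (weight_act hJ) IH mdZr /= -natr1; lmod_ring K (wmod_of M).
have [B hB] := cone_bound s mu j.
have exX : exists i, x i == 0.
  exists B; apply/eqP; apply: contrapT => /eqP nz.
  have [lam [n1 [n0 [hl e ej]]]] := hs _ _ _ (conj (xh B) (xd B)) nz.
  have := hB lam B n1 n0 hl e; rewrite ltnn => hf; suff : false by [].
  by apply: hf; lia.
have [[|i] xi imin] := ex_minnP exX; first by rewrite (negPf u0) in xi.
have vi0 : x i != 0 by apply/negP => /imin; rewrite ltnn.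
have pos a (n : nat) : op a n.+1 (x i) = 0.
  by apply: (below _ n); rewrite -opd.
have hs' : singular J (x i).
  by split=> [[|n]|n|]; [apply/eqP | | |]; auto; exact: (pos f_ 0%N).
have hv : exists p, par_part p (x i) != 0.
  apply: contrapT => no; case/eqP: vi0; rewrite (par_part_sum (x i)).
  have z p : par_part p (x i) = 0 by apply: contrapT => /eqP h; case: no; exists p.
  by rewrite !z addr0.
have [p np] := hv.
have key (S : W -> Prop) : subspace S -> S (x i) -> S (sv_par W (x i)) -> S (par_part p (x i)).
  exact: par_part_sub.
have opp a n : op a n (x i) = 0 -> op a n (par_part p (x i)) = 0.
  move=> h; apply: (key (fun w => op a n w = 0)) => //.
    exact: subspace_ker (op a n) _ (subspace_zero W).
  have /esym/eqP := current_par hJ a n (x i).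
  by rewrite h linear0 scaler_eq0 signr_eq0 => /eqP.
have [h1 h2 h3] := hs'.
exists (par_part p (x i)), (mu + i%:R), (j%:R / 2), p; split=> //.
- by split=> [n|n|]; apply: opp.
- apply: (key (fun w => op h_ 0 w = (mu + i%:R) *: w)) => //.
    split=> [|c a b ha hb]; first by rewrite linear0 scaler0.
    by rewrite mdDr mdZr ha hb scalerDr !scalerA mulrC.
  have := current_par hJ h_ 0 (x i); rewrite xh linearZ /= expr0 scale1r; by move->.
- apply: (key (fun w => wdeg W w = (j%:R / 2) *: w)) => //.
  by rewrite w_deg_par xd linearZ.
- exact: par_part_homog.
Qed.
End HighestWeightVector.

Lemma vmod_hom_exists (K : numFieldType) (L : vsa K) (M N : vmodule L) (f : M -> N) :
  linear f -> (forall n a m, f (vact n a m) = vact n a (f m)) ->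
  (exists p : bool, forall m, f (sv_par M m) = (-1) ^+ p *: sv_par N (f m)) ->
  exists2 phi : {linear M -> N}, is_vmod_hom phi & phi =1 f.
Proof.
move=> fl fa fp.
by exists (HB.pack f (GRing.isLinear.Build K M N _ f fl) : {linear M -> N}).
Qed.

Lemma half_degree (K : numFieldType) c : degree_val (0 : K) c -> half_nat c.
Proof.
by case=> n ->; exists (2 * n)%N; rewrite add0r natrM mulrC mulKf // pnatr_eq0.
Qed.

Section Classification.
Variables (K : numFieldType) (L : vsa K) (J : osp -> L).
Local Notation k := (- (3 / 2) : K).
Hypotheses (hJ : osp_currents k J) (hgen : generates J).
Hypothesis hirr : wirr (adjoint_w L).

Lemma hw_vmodule (W : wmod L) (v : W) t p : hwvec J v t 0 p ->
  (forall w, gen (fun x => x = v) w) -> exists M : vmodule L, wmod_of M = W.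
Proof.
move=> hv hc; apply: vmodule_exists => w.
have [s [-> hs]] := hw_deg_semisimple hJ hgen hv hc w.
by exists s; split=> // u /hs[c [/half_degree ? ?]]; exists c.
Qed.

Lemma hw_vmod_iso (M N : vmodule L) (v1 : wmod_of M) (v2 : wmod_of N) t d1 d2 p1 p2 :
  wirr (wmod_of M) -> wirr (wmod_of N) ->
  hwvec J v1 t d1 p1 -> hwvec J v2 t d2 p2 -> vmod_iso M N.
Proof.
move=> i1 i2 h1 h2; have [f [fl fa fp [g gK Kg]]] := hw_iso hJ hgen i1 i2 h1 h2.
have [phi hphi e] := vmod_hom_exists fl fa fp.
by exists phi; split=> //; exists g => x; rewrite ?e ?gK // -[RHS]Kg e.
Qed.

Lemma irreducible_classification (N M : vmodule L) (n0 : wmod_of N) d p :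
  wirr (wmod_of N) -> hwvec J n0 (-1) d p -> irreducible M -> in_category_O J M ->
  vmod_iso M (adjoint_module L) \/ vmod_iso M N.
Proof.
move=> hN hn0 /irreducible_wirr hM hO.
have [v [t [d' [p' hv]]]] := category_O_hwvec hJ hM.1 hO.
have [t0|t1] := casimir hJ hgen hirr (hw_sing hv) (hw_wt hv) (hw_nz hv).
  left; rewrite t0 in hv.
  exact: (hw_vmod_iso (N := adjoint_module L) hM hirr hv (vac_hw J hirr)).
by right; rewrite t1 in hv; exact: hw_vmod_iso hM hN hv hn0.
Qed.

Lemma hw_module (M : vmodule L) (v : wmod_of M) t p : hwvec J v t 0 p ->
  (forall w, gen (fun x => x = v) w) -> is_highest_weight_module J M.
Proof.
move=> [hs ht hd hp nz] hc; exists v, t, 0%N, p; split=> //.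
- by split=> //; rewrite mul0r.
- by have [hx _ _] := hs; split; [exact: (e_from_x hJ hx 0%N) | exact: hx 0%N].
- by move=> a n; exact: (singular_pos hJ hs a n).
- move=> S hS Sv m; exact: (wsub_gen_le (is_submodule_wsub hS) Sv (hc m)).
Qed.

Lemma classification_and_extension : exists (N M : vmodule L) (n0 : wmod_of N) p,
  [/\ wirr (wmod_of N), hwvec J n0 (-1) 0 p, is_highest_weight_module J M
    & nonsplit_extension (adjoint_module L) M N].
Proof.
have [M' [N' [m [u [pr [[hm mc] [u0 u_par u_deg u_vac rel] inj [prh prS prK] [hN hn]]]]]]] :=
  extension_exists hJ hgen hirr.
have nc w : gen (fun x => x = pr m) w.
  by have [x <-] := prS w; exact: (gen_image prh (mc x)).
have [M eM] := hw_vmodule hm mc; have [N eN] := hw_vmodule hn nc; subst M' N'.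
exists N, M, (pr m), true; split=> //; first exact: (hw_module hm mc).
have prp : exists p : bool, forall x : M, pr (sv_par M x) = (-1) ^+ p *: sv_par N (pr x).
  by exists false => x; rewrite expr0 scale1r; exact: wh_par prh x.
have [phi hphi ep] := vmod_hom_exists (wh_lin prh) (wh_act prh) prp.
have il : linear (fun b : L => md (W := wmod_of M) (-1) b u).
  by move=> c a b; exact: mdPl.
have ip : exists p : bool, forall b : L,
    md (W := wmod_of M) (-1) (sv_par L b) u = (-1) ^+ p *: sv_par M (md (W := wmod_of M) (-1) b u).
  exists false => b; rewrite expr0 scale1r [RHS]md_par.
  by congr (md _ _ _); rewrite [RHS]u_par expr0 scale1r.
have [iota hiota ei] := vmod_hom_exists (M := adjoint_module L) (N := M) il
  (vacuum_hom hJ hgen u_vac) ip.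
exists iota, phi; split=> //.
- by move=> a b; rewrite !ei; exact: inj.
- by move=> q; have [x ex] := prS q; exists x; rewrite ep.
- move=> x; rewrite ep; split=> [/prK[b eb]|[b eb]]; first by exists b; rewrite ei.
  by apply/prK; exists b; rewrite -eb ei.
case=> s [[sa _] sK].
have sl : linear (s : wmod_of N -> wmod_of M) by move=> c x y; exact: linearP.
have sK' : cancel (s : wmod_of N -> wmod_of M) pr by move=> q; rewrite -[RHS]sK ep.
exact: (extension_nonsplit hJ hgen hirr hm u0 u_vac rel inj prh prK sl sa sK').
Qed.
End Classification.

Unset Implicit Arguments.
Set Strict Implicit.

Theorem proposition6p3 (R : realType)
  (V : vsa R[i]) (J : osp -> V)
  (hV : is_universal_affine (- (3 / 2)) J)
  (L : vsa R[i]) (pi : {linear V -> L}) (hpi : is_vsa_hom pi)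
  (hL : is_simple_graded_quotient pi) :
  let JL := fun a => pi (J a) in
  exists N : vmodule L,
    [/\ is_irr_with_top J (pullback hpi N) (-1),
        irreducible (adjoint_module L) /\ in_category_O JL (adjoint_module L),
        irreducible N /\ in_category_O JL N,
        ~ vmod_iso (adjoint_module L) N
        /\ (forall M : vmodule L, irreducible M -> in_category_O JL M ->
              vmod_iso M (adjoint_module L) \/ vmod_iso M N)
      & exists M : vmodule L,
          is_highest_weight_module JL M
          /\ nonsplit_extension (adjoint_module L) M N].
Proof.
move=> JL; have [surj simple] := hL.
have hJ := quotient_currents hV hpi; have hgen := quotient_generates hV hpi surj.
have hirr := graded_simple_irr simple.
have [N [M [n0 [p [hN hn hM ext]]]]] := classification_and_extension hJ hgen hirr.
have nc w : gen (fun x => x = n0) w.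
  by apply: (hN.2 _ (gen_sub _)); exists n0; split; [apply: gen_in | apply: hw_nz hn].
exists N; split.
- exact: (pullback_irr_with_top hpi hJ hgen surj hN hn).
- split; first exact/(irreducible_wirr (adjoint_module L)).2.
  exact: (hw_category_O (M := adjoint_module L) hJ hgen (vac_hw JL hirr) (@vac_cyclic _ L)).
- by split; [exact: (irreducible_wirr N).2 | exact: (hw_category_O hJ hgen hn nc)].
- split; last by move=> X hX hO; exact: (irreducible_classification hJ hgen hirr hN hn hX hO).
  case=> phi [[pa _] bij].
  have phil : linear (phi : adjoint_w L -> wmod_of N) by move=> c x y; exact: linearP.
  exact: (vacuum_not_iso hJ hgen hirr hn phil pa bij).
by exists M.
Qed.
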